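(* Suppose $\tau$ is in the limit-circle case at both endpoints $a$ and $b$. Then a relation $S$ is a self-adjoint restriction of $T_{\mathrm{max}}$ if and only if there are matrices $B_a$, $B_b\in\mathbb{C}^{2\times 2}$ with \begin{align*} \operatorname{rank}(B_a | B_b) = 2 \quad\text{and}\quad B_aJB_a^\ast = B_bJB_b^\ast \quad\text{with}\quad J=\begin{pmatrix} 0 & -1 \\ 1 & 0 \end{pmatrix}, \end{align*} such that \begin{align*} S = \left\lbrace f\in T_{\mathrm{max}} \left|\, B_a\begin{pmatrix} BC_{a}^1(f) \\ BC_{a}^2(f) \end{pmatrix} = B_b \begin{pmatrix} BC_{b}^1(f) \\ BC_{b}^2(f) \end{pmatrix}\right. \right\rbrace. \end{align*}
   Context: Let $(a,b)$ be an interval and $\varrho$, $\varsigma$, $\chi$ locally finite real Borel measures on $(a,b)$, with $\varrho$ positive and supported on more than one point, $\operatorname{supp}(\varsigma)=(a,b)$, $\varsigma(\{x\})\varrho(\{x\})=\varsigma(\{x\})\chi(\{x\})=0$ for all $x$, and such that for each gap $(\alpha,\beta)$ of $\operatorname{supp}(\varrho)$ every $f$ in the maximal domain with $f(\alpha-)=f(\beta+)=0$ vanishes on $(\alpha,\beta)$. The differential expression is $\tau f = \frac{d}{d\varrho}\left(-\frac{df}{d\varsigma} + \int f\, d\chi\right)$ on its maximal domain $\mathfrak{D}_\tau$ (left-continuous $f$ locally absolutely continuous w.r.t. $\varsigma$ for which $-\frac{df}{d\varsigma}+\int^x f\,d\chi$ is locally absolutely continuous w.r.t. $\varrho$), with quasi-derivative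 $f^{[1]}=df/d\varsigma$ and Wronskian $W(f,g)=fg^{[1]}-f^{[1]}g$. $T_{\mathrm{max}}=\{(f,\tau f): f\in\mathfrak{D}_\tau,\ f,\tau f\in L^2((a,b);\varrho)\}$ (elements identified with functions in $\mathfrak{D}_\tau$), and $T_{\mathrm{min}}=T_{\mathrm{max}}^\ast$. $\tau$ is in the limit-circle case at an endpoint if for every $z\in\mathbb{C}$ all solutions of $(\tau-z)u=0$ are square integrable w.r.t. $\varrho$ near that endpoint; then $W(f,g)(a)=\lim_{x\downarrow a}W(f,g)(x)$ and $W(f,g)(b)=\lim_{x\uparrow b}W(f,g)(x)$ exist for $f,g\in T_{\mathrm{max}}$. Fix $w_1$, $w_2\in T_{\mathrm{max}}$ with $W(w_1,w_2^\ast)(a)=1$, $W(w_1,w_1^\ast)(a)=W(w_2,w_2^\ast)(a)=0$ and $W(w_1,w_2^\ast)(b)=1$, $W(w_1,w_1^\ast)(b)=W(w_2,w_2^\ast)(b)=0$, and define the linear functionals on $T_{\mathrm{max}}$: $BC_a^1(f)=W(f,w_2^\ast)(a)$, $BC_a^2(f)=W(w_1^\ast,f)(a)$, $BC_b^1(f)=W(f,w_2^\ast)(b)$, $BC_b^2(f)=W(w_1^\ast,f)(b)$. *)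

(* Defs.v *)
From HB Require Import structures.
From mathcomp Require Import all_boot all_order all_algebra.
From mathcomp Require Import all_classical all_reals all_analysis.
From mathcomp.real_closed Require Import complex.
Import Order.TTheory GRing.Theory Num.Theory.
Import numFieldNormedType.Exports.

Set Implicit Arguments.
Unset Strict Implicit.
Unset Printing Implicit Defensive.

Local Open Scope classical_set_scope.
Local Open Scope ring_scope.

Definition Iab (R : realType) (a b : \bar R) : set R :=
  [set x : R | (a < x%:E)%E /\ (x%:E < b)%E].

(* Positive Borel measures on R (only their restriction to (a,b) matters). *)
Notation pmeasure R := ({measure set R -> \bar R}).

(* A locally finite real (signed) Borel measure on (a,b) is given by its
   Jordan decomposition: a pair of mutually singular, locally finite,
   positive Borel measures. *)
Record smeasure (R : realType) := SMeasure {
  spos : pmeasure R ;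
  sneg : pmeasure R }.

Definition locfin (R : realType) (a b : \bar R) (mu : pmeasure R) : Prop :=
  forall c d : R, Iab a b c -> Iab a b d -> (mu [set y : R | (c <= y <= d)%R] < +oo)%E.

Definition jordan_locfin (R : realType) (a b : \bar R) (s : smeasure R) : Prop :=
  [/\ locfin a b (spos s), locfin a b (sneg s) &
      exists P : set R, [/\ measurable P,
        sneg s (P `&` Iab a b) = 0%E & spos s (Iab a b `\` P) = 0%E]].

Definition svar (R : realType) (s : smeasure R) (A : set R) : \bar R :=
  (spos s A + sneg s A)%E.

(* Value s({x}) of a signed measure at an atom (finite by local finiteness). *)
Definition satom (R : realType) (s : smeasure R) (x : R) : \bar R :=
  (spos s [set x] - sneg s [set x])%E.

Definition supp (R : realType) (a b : \bar R) (mu : pmeasure R) : set R :=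
  [set x | Iab a b x /\
     forall e : R, 0 < e -> (0 < mu ([set y : R | (x - e < y < x + e)%R] `&` Iab a b))%E].

Definition ssupp (R : realType) (a b : \bar R) (s : smeasure R) : set R :=
  [set x | Iab a b x /\
     forall e : R, 0 < e -> (0 < svar s ([set y : R | (x - e < y < x + e)%R] `&` Iab a b))%E].

(* real oriented integral  \int_c^x g dmu  :=  \int_[c,x) g dmu  (c < x),
   - \int_[x,c) g dmu  (x < c),  0 (x = c)  (left-continuous convention) *)
Definition oint (R : realType) (mu : pmeasure R) (c x : R) (g : R -> R) : R :=
  if c < x then Rintegral mu [set y : R | (c <= y < x)%R] g
  else if x < c then - Rintegral mu [set y : R | (x <= y < c)%R] g else 0.

Definition cint (R : realType) (mu : pmeasure R) (D : set R) (f : R -> R[i])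
  : R[i] :=
  Complex (Rintegral mu D (fun x => complex.Re (f x)))
          (Rintegral mu D (fun x => complex.Im (f x))).

Definition coint (R : realType) (mu : pmeasure R) (c x : R) (f : R -> R[i])
  : R[i] :=
  Complex (oint mu c x (fun y => complex.Re (f y))) (oint mu c x (fun y => complex.Im (f y))).

Definition scoint (R : realType) (s : smeasure R) (c x : R) (f : R -> R[i])
  : R[i] := coint (spos s) c x f - coint (sneg s) c x f.

Definition locint (R : realType) (a b : \bar R) (mu : pmeasure R)
  (f : R -> R[i]) : Prop :=
  forall c d : R, Iab a b c -> Iab a b d ->
    mu.-integrable [set y : R | (c <= y <= d)%R] (fun x => (complex.Re (f x))%:E) /\
    mu.-integrable [set y : R | (c <= y <= d)%R] (fun x => (complex.Im (f x))%:E).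

Definition slocint (R : realType) (a b : \bar R) (s : smeasure R)
  (f : R -> R[i]) : Prop :=
  locint a b (spos s) f /\ locint a b (sneg s) f.

(* The differential expression
     tau f = d/drho ( - df/dvs + \int f dchi ).
   [dtau a b rho vs chi f f1 h] means: f is in the maximal domain D_tau,
   with quasi-derivative f^[1] = df/dvs equal to f1 and tau f = h, i.e.
   f is locally absolutely continuous w.r.t. vs with density f1, and
   - f1 + \int^x f dchi is locally absolutely continuous w.r.t. rho with
   density h.  (f1 is then uniquely determined by f, and h rho-a.e.) *)
Definition dtau (R : realType) (a b : \bar R) (rho : pmeasure R)
  (vs chi : smeasure R) (f f1 h : R -> R[i]) : Prop :=
  [/\ slocint a b vs f1, slocint a b chi f, locint a b rho h &
      forall c x : R, Iab a b c -> Iab a b x ->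
        f x - f c = scoint vs c x f1 /\
        - f1 x + scoint chi c x f = - f1 c + coint rho c x h].

Definition sqn (R : realType) (z : R[i]) : R := complex.Re z ^+ 2 + complex.Im z ^+ 2.

Definition L2on (R : realType) (rho : pmeasure R) (D : set R)
  (f : R -> R[i]) : Prop :=
  [/\ measurable_fun D (fun x => complex.Re (f x)),
      measurable_fun D (fun x => complex.Im (f x)) &
      rho.-integrable D (fun x => (sqn (f x))%:E)].

Definition L2 (R : realType) (a b : \bar R) (rho : pmeasure R) :=
  L2on rho (Iab a b).

Definition aeeq (R : realType) (a b : \bar R) (rho : pmeasure R)
  (f g : R -> R[i]) : Prop :=
  {ae rho, forall x, Iab a b x -> f x = g x}.

Definition ip (R : realType) (a b : \bar R) (rho : pmeasure R)
  (f g : R -> R[i]) : R[i] :=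
  cint rho (Iab a b) (fun x => f x * conjc (g x)).

(* Linear relations in L^2((a,b);rho) are represented by sets of pairs of
   representatives. *)
Notation crel R := (set ((R -> R[i]) * (R -> R[i]))).

Definition Tmax (R : realType) (a b : \bar R) (rho : pmeasure R)
  (vs chi : smeasure R) : crel R :=
  [set p | [/\ L2 a b rho p.1, L2 a b rho p.2 &
     exists f f1 h, [/\ dtau a b rho vs chi f f1 h,
                        aeeq a b rho p.1 f & aeeq a b rho p.2 h]]].

Definition adjoint (R : realType) (a b : \bar R) (rho : pmeasure R)
  (S : crel R) : crel R :=
  [set p | [/\ L2 a b rho p.1, L2 a b rho p.2 &
     forall q, S q -> ip a b rho q.2 p.1 = ip a b rho q.1 p.2]].

Definition selfadjoint_restriction (R : realType) (a b : \bar R)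
  (rho : pmeasure R) (vs chi : smeasure R) (S : crel R) : Prop :=
  S `<=` Tmax a b rho vs chi /\ adjoint a b rho S = S.

Definition standing (R : realType) (a b : \bar R) (rho : pmeasure R)
  (vs chi : smeasure R) : Prop :=
  [/\ (a < b)%E,
      [/\ locfin a b rho, jordan_locfin a b vs & jordan_locfin a b chi],
      (exists x y, x <> y /\ supp a b rho x /\ supp a b rho y) /\
        ssupp a b vs = Iab a b,
      (forall x, Iab a b x ->
         (satom vs x * rho [set x])%E = 0%E /\ (satom vs x * satom chi x)%E = 0%E) &
      forall al be : R, Iab a b al -> Iab a b be -> al < be ->
        supp a b rho al -> supp a b rho be ->
        (forall y, al < y < be -> ~ supp a b rho y) ->
        forall f f1 h, dtau a b rho vs chi f f1 h ->
          (fun x => complex.Re (f x)) x @[x --> al^'-] --> 0 ->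
          (fun x => complex.Im (f x)) x @[x --> al^'-] --> 0 ->
          (fun x => complex.Re (f x)) x @[x --> be^'+] --> 0 ->
          (fun x => complex.Im (f x)) x @[x --> be^'+] --> 0 ->
          forall y, al < y < be -> f y = 0].

Definition Iaux_left (R : realType) (a : \bar R) (c : R) : set R :=
  [set x : R | (a < x%:E)%E /\ x < c].
Definition Iaux_right (R : realType) (b : \bar R) (c : R) : set R :=
  [set x : R | c < x /\ (x%:E < b)%E].

Definition LC_left (R : realType) (a b : \bar R) (rho : pmeasure R)
  (vs chi : smeasure R) : Prop :=
  forall (z : R[i]) (u u1 h : R -> R[i]),
    dtau a b rho vs chi u u1 h -> aeeq a b rho h (fun x => z * u x) ->
    exists c, Iab a b c /\ L2on rho (Iaux_left a c) u.

Definition LC_right (R : realType) (a b : \bar R) (rho : pmeasure R)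
  (vs chi : smeasure R) : Prop :=
  forall (z : R[i]) (u u1 h : R -> R[i]),
    dtau a b rho vs chi u u1 h -> aeeq a b rho h (fun x => z * u x) ->
    exists c, Iab a b c /\ L2on rho (Iaux_right b c) u.

Definition Wr (R : realType) (f f1 g g1 : R -> R[i]) (x : R) : R[i] :=
  f x * g1 x - f1 x * g x.

Definition at_left_end (R : realType) (a : \bar R) : set_system R :=
  match a with
  | EFin r => r^'+
  | -oo%E => ninfty_nbhs R
  | +oo%E => pinfty_nbhs R
  end.

Definition at_right_end (R : realType) (b : \bar R) : set_system R :=
  match b with
  | EFin r => r^'-
  | -oo%E => ninfty_nbhs R
  | +oo%E => pinfty_nbhs R
  end.

Definition clim (R : realType) (F : R -> R[i]) (fl : set_system R) : R[i] :=
  Complex (lim ((fun x : R => (complex.Re (F x) : R)) @ fl))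
          (lim ((fun x : R => (complex.Im (F x) : R)) @ fl)).

Definition cconj (R : realType) (f : R -> R[i]) : R -> R[i] :=
  fun x => conjc (f x).

(* W(f,g)(a) and W(f,g)(b), functions given with their quasi-derivatives *)
Definition Wa (R : realType) (a : \bar R) (f f1 g g1 : R -> R[i]) : R[i] :=
  clim (Wr f f1 g g1) (at_left_end a).
Definition Wb (R : realType) (b : \bar R) (f f1 g g1 : R -> R[i]) : R[i] :=
  clim (Wr f f1 g g1) (at_right_end b).

Definition Jmx (R : realType) : 'M[R[i]]_2 :=
  \matrix_(i < 2, j < 2)
    (if ((i : nat) == 0%N) && ((j : nat) == 1%N) then -1
     else if ((i : nat) == 1%N) && ((j : nat) == 0%N) then 1 else 0).

Definition adjmx (R : realType) (M : 'M[R[i]]_2) : 'M[R[i]]_2 :=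
  (map_mx (@conjc R) M)^T.

Definition col2 (R : realType) (x y : R[i]) : 'cV[R[i]]_2 :=
  \col_(i < 2) (if (i : nat) == 0%N then x else y).

(* Main.v *)
(* Lagrange's identity expresses <tau f, g> - <f, tau g> through W(f, conj g) at b minus its value
   at a. By the Pluecker relation for Wronskians, passed to the limit at the endpoints, this
   depends only on the boundary values (BC_a f, BC_b f), as the skew-hermitian form given by J on
   C^2 + C^2. The boundary values can be prescribed arbitrarily, and the adjoint of a relation
   containing every element with vanishing boundary values is contained in T_max; hence the
   self-adjoint restrictions of T_max correspond to the subspaces of C^2 + C^2 that equal their own
   orthogonal complement for this form. These are the two-dimensional isotropic subspaces, and
   (B_a | B_b) encodes a basis.

   In the limit-circle case at both endpoints tau u = 0 has a real fundamental system in L^2,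
   obtained by Picard iteration, and Wronskians with it show that every solution of tau f = h with
   h in L^2 is in L^2. The fundamental system is linearly independent in L^2 because a solution
   that vanishes rho-a.e. has, by the gap hypothesis and since the support of varsigma is
   everything, a common zero with its quasi-derivative, so that its Wronskians vanish. *)

Require Import Defs.
From HB Require Import structures.
From mathcomp Require Import all_boot all_order all_algebra.
From mathcomp Require Import all_classical all_reals all_analysis.
From mathcomp.real_closed Require Import complex.
From mathcomp Require Import measurable_realfun ring lra.
Import Order.TTheory GRing.Theory Num.Theory.
Import numFieldNormedType.Exports.
Local Open Scope classical_set_scope.
Local Open Scope ring_scope.

Set Implicit Arguments.
Unset Strict Implicit.
Unset Printing Implicit Defensive.

(** * Integration by parts *)

(** Atoms shape the analysis. Integrals run over [[c, x)], and a product rule for such primitives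
    has a correction at common atoms; it vanishes because varsigma shares no atom with varrho or
    chi, although varrho and chi may share some. The measures are real, so the complex equation
    splits into two real ones, and the equation is studied for real functions. Fubini is applied on
    sets of finite measure only.

    The fundamental system is made orthogonal in L^2. By Lagrange's identity the boundary values of
    f at b are those at a shifted by the inner products of tau f with the fundamental system; since
    its Gram matrix is diagonal, a right-hand side in its span reaches any prescribed values at b.

    Relations are sets of pairs of representatives, whereas boundary values belong to functions of
    the maximal domain. Membership therefore asks for some function of the domain that is almost
    everywhere equal to the given one. Adjoints are stable under such changes, so a self-adjoint
    relation can be tested on elements of the domain. *)

Lemma measurable_lt_fun (R : realType) d (T : measurableType d) (f g : T -> R) :
  measurable_fun setT f -> measurable_fun setT g -> measurable [set z | f z < g z].
Proof.
move=> mf mg; rewrite -[X in measurable X]setTI.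
have /(_ measurableT [set true]) := measurable_fun_ltr mf mg.
by apply.
Qed.

Section fubini_indicator.
Context (R : realType) d1 d2 (T1 : measurableType d1) (T2 : measurableType d2).
Context (m1 : {finite_measure set T1 -> \bar R}) (m2 : {finite_measure set T2 -> \bar R}).
Context (E : set (T1 * T2)) (mE : measurable E) (phi : T1 -> R) (psi : T2 -> R).
Hypotheses (iphi : m1.-integrable setT (EFin \o phi))
           (ipsi : m2.-integrable setT (EFin \o psi)).

Let f (z : T1 * T2) : \bar R := (phi z.1 * psi z.2 * \1_E z)%:E.

Let mphi : measurable_fun setT phi.
Proof. by apply/measurable_EFinP; exact: measurable_int iphi. Qed.
Let mpsi : measurable_fun setT psi.
Proof. by apply/measurable_EFinP; exact: measurable_int ipsi. Qed.

Let mf : measurable_fun setT f.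
Proof.
apply/measurable_EFinP; apply: measurable_funM; last exact: measurable_indic.
by apply: measurable_funM; apply: measurableT_comp => //.
Qed.

Let intf : (m1 \x m2)%E.-integrable setT f.
Proof.
apply/integrable12ltyP => //.
apply: (@le_lt_trans _ _ (\int[m1]_x (`|phi x|%:E * \int[m2]_y `|(psi y)%:E|)))%E.
  apply: ge0_le_integral => //.
  - by move=> x _; apply: integral_ge0.
  - apply: (measurable_fun_fubini_tonelli_F (abse \o f)) => //=; exact: measurableT_comp.
  - apply: emeasurable_funM => //. apply/measurable_EFinP; exact: measurableT_comp.
  - move=> x _; rewrite -ge0_integralZl//; last first.
      by apply: measurableT_comp => //; exact/measurable_EFinP.
    apply: ge0_le_integral => //.
    + by apply: measurableT_comp => //; apply: measurableT_comp => //; exact: pair1_measurable.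
    + by apply: emeasurable_funM => //; apply: measurableT_comp => //; exact/measurable_EFinP.
    + move=> y _; rewrite /f /= -EFinM lee_fin !normrM -[leRHS]mulr1 ler_wpM2l ?mulr_ge0//.
      by rewrite indicE; case: (_ \in _); rewrite ?normr0 ?normr1.
have [_ p1] := integrableP _ _ _ ipsi; have [_ p2] := integrableP _ _ _ iphi.
have g0 : (0 <= \int[m2]_y `|(psi y)%:E|)%E by apply: integral_ge0.
rewrite ge0_integralZr//; last by apply/measurable_EFinP; exact: measurableT_comp.
by rewrite lte_mul_pinfty// ?integral_ge0// ge0_fin_numE// integral_ge0.
Qed.

Let F x := Rintegral m2 [set y | E (x, y)] psi.
Let G y := Rintegral m1 [set x | E (x, y)] phi.

Let mE1 x : measurable [set y | E (x, y)].
Proof. by have := measurable_xsection x mE; rewrite xsectionE. Qed.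
Let mE2 y : measurable [set x | E (x, y)].
Proof. by have := measurable_ysection y mE; rewrite ysectionE. Qed.

Let fubF : fubini_F m2 f = fun x => (phi x * F x)%:E.
Proof.
apply/funext => x; rewrite /fubini_F /f /=.
under eq_integral do rewrite -mulrA EFinM.
rewrite integralZl//; last first.
  apply: (le_integrable _ _ _ ipsi) => //.
    apply/measurable_EFinP; apply: measurable_funM => //.
    apply: (measurableT_comp (measurable_indic mE)); exact: pair1_measurable.
  move=> y _ /=; rewrite lee_fin normrM -[leRHS]mulr1 ler_wpM2l//.
  by rewrite indicE; case: (_ \in _); rewrite ?normr0 ?normr1.
rewrite EFinM; congr (_ * _)%E.
rewrite /F /Rintegral fineK; last first.
  by apply: integrable_fin_num => //; exact: integrableS ipsi.
rewrite [RHS]integral_mkcond; apply: eq_integral => y _.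
rewrite /patch indicE; have -> : ((x, y) \in E) = (y \in [set y0 | E (x, y0)]).
  by apply/idP/idP; rewrite !inE.
by case: ifP => _; rewrite ?mulr1 ?mulr0.
Qed.

Let fubG : fubini_G m1 f = fun y => (psi y * G y)%:E.
Proof.
apply/funext => y; rewrite /fubini_G /f /=.
under eq_integral do rewrite (mulrC (phi _)) -mulrA EFinM.
rewrite integralZl//; last first.
  apply: (le_integrable _ _ _ iphi) => //.
    apply/measurable_EFinP; apply: measurable_funM => //.
    apply: (measurableT_comp (measurable_indic mE)); exact: pair2_measurable.
  move=> x _ /=; rewrite lee_fin normrM -[leRHS]mulr1 ler_wpM2l//.
  by rewrite indicE; case: (_ \in _); rewrite ?normr0 ?normr1.
rewrite EFinM; congr (_ * _)%E.
rewrite /G /Rintegral fineK; last first.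
  by apply: integrable_fin_num => //; exact: integrableS iphi.
rewrite [RHS]integral_mkcond; apply: eq_integral => x _.
rewrite /patch indicE; have -> : ((x, y) \in E) = (x \in [set y0 | E (y0, y)]).
  by apply/idP/idP; rewrite !inE.
by case: ifP => _; rewrite ?mulr1 ?mulr0.
Qed.

(** Fubini for the integrand [phi x * psi y * \1_E], which is dominated by a product of integrable
    functions; in each iterated integral one factor leaves the inner integral. *)
Lemma Rintegral_section_swap :
  Rintegral m1 setT (fun x => phi x * F x) = Rintegral m2 setT (fun y => psi y * G y).
Proof. by rewrite /Rintegral -fubF -fubG; congr fine; exact: (Fubini intf). Qed.

Lemma integrable_section_l : m1.-integrable setT (fun x => (phi x * F x)%:E).
Proof. by rewrite -fubF; exact: integrable_fubini_F. Qed.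

End fubini_indicator.

Section mfrestr_integral.
Context (R : realType) d (T : measurableType d) (mu : {measure set T -> \bar R}).
Context (D : set T) (mD : measurable D) (fD : (mu D < +oo)%E).
Let r : {measure set T -> \bar R} := mfrestr mD fD.

(** The Fubini argument above is for finite measures on the whole space. A measure that is finite on
    D becomes one by restriction to D, and a function on D is extended by 0. *)
Lemma integrable_mfrestr (f : T -> R) :
  r.-integrable setT (EFin \o (f \_ D)) <-> mu.-integrable D (EFin \o f).
Proof.
rewrite -restrict_EFin; apply: (iff_trans (iff_sym (integrable_mkcond _ mD))).
have E : (\int[r]_(x in D) `|(EFin \o f) x| = \int[mu]_(x in D) `|(EFin \o f) x|)%E.
  apply: eq_measure_integral => A mA AD.
  by rewrite /r /= /mfrestr /mrestr setIidl.
by split=> /integrableP[mf iy]; apply/integrableP; split; rewrite ?E// -E.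
Qed.

Lemma Rintegral_mfrestr (A : set T) (f : T -> R) :
  Rintegral r A (f \_ D) = Rintegral mu (A `&` D) f.
Proof.
rewrite -Rintegral_mkcondr /Rintegral (@eq_measure_integral _ _ _ _ mu)//.
by move=> B mB BD; rewrite /r /= /mfrestr /mrestr setIidl// => x /BD[].
Qed.

End mfrestr_integral.

Section fubini_restrict.
Context (R : realType) d1 d2 (T1 : measurableType d1) (T2 : measurableType d2).
Context (m1 : {measure set T1 -> \bar R}) (m2 : {measure set T2 -> \bar R}).
Context (D1 : set T1) (D2 : set T2) (mD1 : measurable D1) (mD2 : measurable D2).
Hypotheses (f1 : (m1 D1 < +oo)%E) (f2 : (m2 D2 < +oo)%E).
Context (E : set (T1 * T2)) (mE : measurable E) (phi : T1 -> R) (psi : T2 -> R).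
Hypotheses (iphi : m1.-integrable D1 (EFin \o phi))
           (ipsi : m2.-integrable D2 (EFin \o psi)).

Lemma Rintegral_fubini :
  Rintegral m1 D1 (fun x => phi x * Rintegral m2 ([set y | E (x, y)] `&` D2) psi) =
  Rintegral m2 D2 (fun y => psi y * Rintegral m1 ([set x | E (x, y)] `&` D1) phi).
Proof.
have := Rintegral_section_swap mE ((integrable_mfrestr mD1 f1 _).2 iphi)
  ((integrable_mfrestr mD2 f2 _).2 ipsi).
under eq_Rintegral do rewrite Rintegral_mfrestr patchE.
under [X in _ = X -> _]eq_Rintegral do rewrite Rintegral_mfrestr patchE.
have pE T (D : set T) (f g : T -> R) : (fun x => (if x \in D then f x else 0) * g x)
    = (fun x => f x * g x) \_ D.
  by apply/funext => x; rewrite patchE; case: ifP; rewrite ?mul0r.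
by rewrite !pE !Rintegral_mfrestr !setTI.
Qed.

Lemma integrable_fubini :
  m1.-integrable D1 (fun x => (phi x * Rintegral m2 ([set y | E (x, y)] `&` D2) psi)%:E).
Proof.
have := integrable_section_l mE ((integrable_mfrestr mD1 f1 _).2 iphi)
  ((integrable_mfrestr mD2 f2 _).2 ipsi).
move=> h; apply/(integrable_mfrestr mD1 f1); apply: eq_integrable h => // x _ /=.
by rewrite Rintegral_mfrestr !patchE; case: ifP => //; rewrite mul0r.
Qed.

End fubini_restrict.

Section integration_by_parts.
Context (R : realType) (mu nu : {measure set R -> \bar R}) (D : set R).
Context (mD : measurable D) (muD : (mu D < +oo)%E) (nuD : (nu D < +oo)%E).
Context (phi psi : R -> R).
Hypotheses (iphi : mu.-integrable D (EFin \o phi))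
           (ipsi : nu.-integrable D (EFin \o psi)).

Let below (y : R) := [set s | s < y] `&` D.

Let mlt (y : R) : measurable [set s : R | s < y].
Proof. by rewrite -set_itvNyo. Qed.
Let mgt (y : R) : measurable [set s : R | y < s].
Proof. by rewrite -set_itvoy. Qed.

Let mbelow y : measurable (below y).
Proof. exact: measurableI. Qed.

Let atom_term (f : R -> R) (m : {measure set R -> \bar R}) : m.-integrable D (EFin \o f) ->
  forall y, D y -> Rintegral m D f =
    Rintegral m ([set s | y < s] `&` D) f + Rintegral m (below y) f + f y * fine (m [set y]).
Proof.
move=> mf y Dy.
have -> : Rintegral m D f = Rintegral m (([set s | y < s] `&` D) `|` (below y `|` [set y])) f.
  congr (Rintegral m _ f); apply/seteqP; split => [x Dx|x [[]|[[]|->]]//].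
  by have [xy|yx|->] := ltgtP x y; [right; left|left|right; right].
rewrite Rintegral_setU//; first last.
- apply/disj_setPS => x [[/= yx _]] [[/= xy _]|/= e].
    by move: (lt_trans xy yx); rewrite ltxx.
  by move: yx; rewrite e ltxx.
- apply: integrableS mf => //.
    by apply: measurableU; [exact: measurableI|apply: measurableU].
  by move=> x [[]|[[]|->]]//.
- by apply: measurableU.
- exact: measurableI.
rewrite -addrA; congr (_ + _).
rewrite Rintegral_setU//; first last.
- by apply/disj_setPS => x [[/= xy _]] /= e; move: xy; rewrite e ltxx.
- by apply: integrableS mf => //; [exact: measurableU|move=> x [[]|->]//].
congr (_ + _).
rewrite -[in RHS]Rintegral_cst//; apply: eq_Rintegral => x; rewrite inE => ->//.
Qed.

Let mE : measurable [set z : R * R | z.1 < z.2].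
Proof. exact: measurable_lt_fun. Qed.
Let mE' : measurable [set z : R * R | z.2 < z.1].
Proof. exact: measurable_lt_fun. Qed.

Let igt := integrable_fubini mD mD muD nuD mE iphi ipsi.
Let ilt := integrable_fubini mD mD muD nuD mE' iphi ipsi.

Lemma integrable_by_parts_primitive :
  mu.-integrable D (fun y => (phi y * Rintegral nu (below y) psi)%:E).
Proof. exact: ilt. Qed.

(** The diagonal term is what the two open triangles leave of [phi y] times the full integral of
    [psi], so its integrability follows by subtraction. *)
Lemma integrable_by_parts_atom :
  mu.-integrable D (fun y => (phi y * (psi y * fine (nu [set y])))%:E).
Proof.
have := integrableB mD (integrableB mD (integrableZl mD (Rintegral nu D psi) iphi) igt) ilt.
apply: eq_integrable => // x; rewrite inE => Dx /=.
rewrite (atom_term ipsi Dx) -!EFinM -!EFinB; congr EFin.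
by rewrite /below; ring.
Qed.

(** The square over D splits into two open triangles and the diagonal. Fubini exchanges the
    variables on one triangle, and the diagonal carries the common atoms. *)
Lemma Rintegral_by_parts :
  Rintegral mu D phi * Rintegral nu D psi =
  Rintegral nu D (fun y => Rintegral mu (below y) phi * psi y) +
  Rintegral mu D (fun y => Rintegral nu (below y) psi * phi y) +
  Rintegral mu D (fun y => phi y * (psi y * fine (nu [set y]))).
Proof.
have fub := Rintegral_fubini mD mD muD nuD mE iphi ipsi.
have iC := integrable_by_parts_atom.
have := igt; have := ilt => /= jlt jgt; rewrite /= in fub.
rewrite -RintegralZr//.
transitivity (Rintegral mu D (fun x => phi x * Rintegral nu ([set y | x < y] `&` D) psi +
   phi x * Rintegral nu (below x) psi + phi x * (psi x * fine (nu [set x])))).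
  by apply: eq_Rintegral => x; rewrite inE => Dx; rewrite (atom_term ipsi Dx); ring.
rewrite RintegralD//; last first.
  by have := integrableD mD jgt jlt; apply: eq_integrable.
rewrite RintegralD// fub; congr (_ + _ + _).
  by apply: eq_Rintegral => x _; rewrite mulrC.
by apply: eq_Rintegral => x _; rewrite mulrC.
Qed.

End integration_by_parts.

(** For each n only finitely many points of D have mass above [1/(n+1)], since infinitely many would
    exceed the finite mass of D. *)
Lemma countable_atoms (R : realType) (nu : {measure set R -> \bar R}) (D : set R) :
  measurable D -> (nu D < +oo)%E -> countable [set y | D y /\ nu [set y] != 0%E].
Proof.
move=> mD nuD.
have fin y : D y -> nu [set y] \is a fin_num.
  move=> Dy; rewrite ge0_fin_numE//; apply: le_lt_trans nuD.
  by apply: le_measure; rewrite ?inE//; move=> _ ->.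
rewrite [X in countable X](_ : _ =
    \bigcup_n [set y | D y /\ (n.+1%:R^-1 : R) < fine (nu [set y])]); last first.
  apply/seteqP; split=> [y/= [Dy n0]|y/= [k _] [Dy lt]].
    have /ltr_add_invr[k] : 0 < fine (nu [set y]).
      by rewrite lt0r fine_ge0// andbT fine_eq0// fin.
    by rewrite add0r => lt; exists k.
  split => //; apply/eqP => e; move: lt; rewrite e /= ltNge.
  by rewrite invr_ge0 ler0n.
apply: bigcup_countable => // n _; apply: finite_set_countable.
apply: contrapT => /infiniteP/pcard_leP/injfunPex[/= q q_fun q_inj].
have Dq k : D (q k) by have [] := q_fun k I.
have mq : measurable (\bigcup_k [set q k]) by apply: bigcup_measurable.
have lt : (\sum_(0 <= k <oo) nu [set q k] < +oo)%E.
  have -> : (\sum_(0 <= k <oo) nu [set q k] = nu (\bigcup_k [set q k]))%E.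
    rewrite measure_bigcup//; first by apply: eq_eseriesl => i; rewrite in_setT.
  apply/trivIsetP => i j _ _ ij; apply/seteqP; split => // x [-> e].
    by move: ij; rewrite (q_inj i j) ?inE ?eqxx.
  by apply: le_lt_trans nuD; apply: le_measure; rewrite ?inE// => _ [k _ ->].
(* [N] is chosen so that [N] points of mass above [1/(n+1)] already outweigh the whole series. *)
have [N hN] : exists N : nat, (fine (\sum_(0 <= k <oo) nu [set q k]) * n.+1%:R < N%:R)%R.
  exists (Num.bound (fine (\sum_(0 <= k <oo) nu [set q k])%E * n.+1%:R)).
  by rewrite archi_boundP// mulr_ge0// fine_ge0// nneseries_ge0.
have fs : (\sum_(0 <= k <oo) nu [set q k])%E \is a fin_num.
  by rewrite ge0_fin_numE// nneseries_ge0.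
have : (\sum_(0 <= k < N) nu [set q k] <= \sum_(0 <= k <oo) nu [set q k])%E.
  exact: nneseries_lim_ge.
rewrite -(fineK fs) leNgt => /negP; apply.
apply: (@lt_le_trans _ _ (\sum_(0 <= k < N) (n.+1%:R^-1 : R))%:E%E).
  by rewrite lte_fin sumr_const_nat subn0 -[ltRHS]mulr_natl ltr_pdivlMr.
rewrite -sumEFin.
apply: lee_sum => k _; rewrite -(fineK (fin _ (Dq k))) lee_fin ltW//.
by have [] := q_fun k I.
Qed.

Lemma countable_null (R : realType) (mu : {measure set R -> \bar R}) (A : set R) :
  countable A -> (forall y, A y -> mu [set y] = 0%E) -> measurable A /\ mu A = 0%E.
Proof.
move=> cA h; have mA : measurable A by exact: countable_measurable.
split => //; apply: measure_negligible => //.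
have [->|/set0P[a Aa]] := eqVneq A set0; first exact: negligible_set0.
have /pfcard_geP[A0|[f]] := cA; first by rewrite A0; exact: negligible_set0.
have -> : A = \bigcup_k [set f k].
  apply/seteqP; split=> [x Ax|x [k _ ->]]; last exact: funS.
  by have [k _ <-] := @surj _ _ _ _ f x Ax; exists k.
apply: negligible_bigcup => k; apply/negligibleP; first exact: measurable_set1.
by apply: h; exact: funS.
Qed.

Lemma eq_Rintegral_off (R : realType) d (T : measurableType d) (mu : {measure set T -> \bar R})
    (D N : set T) (f g : T -> R) :
  measurable D -> measurable N -> mu N = 0%E ->
  measurable_fun D f -> measurable_fun D g ->
  (forall x, D x -> ~ N x -> f x = g x) ->
  Rintegral mu D f = Rintegral mu D g.
Proof.
move=> mD mN N0 mf mg fg; congr fine; apply: ae_eq_integral => //; try exact/measurable_EFinP.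
exists N; split => // x /= /not_implyP[Dx ne]; apply: contrapT => Nx; apply: ne.
by rewrite fg.
Qed.

Section no_common_atoms.
Context (R : realType) (mu nu : {measure set R -> \bar R}) (D : set R).
Context (mD : measurable D) (nuD : (nu D < +oo)%E).
Hypothesis disj : forall y, D y -> nu [set y] = 0%E \/ mu [set y] = 0%E.

Lemma atoms_null : exists N : set R, [/\ measurable N, mu N = 0%E &
  forall y, D y -> ~ N y -> nu [set y] = 0%E].
Proof.
exists [set y | D y /\ nu [set y] != 0%E].
have [|mN N0] := countable_null (mu := mu) (countable_atoms mD nuD).
  by move=> y [Dy /eqP ne]; have [] := disj Dy.
split => // y Dy nN; apply: contrapT => /eqP ne; exact: nN.
Qed.

(** The integrand is supported on the atoms of [nu]; they are countably many and none of them is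
    charged by [mu]. *)
Lemma Rintegral_atom_eq0 (phi : R -> R) :
  mu.-integrable D (fun y => (phi y * fine (nu [set y]))%:E) ->
  Rintegral mu D (fun y => phi y * fine (nu [set y])) = 0.
Proof.
move=> iphi; have [N [mN N0 hN]] := atoms_null.
rewrite (@eq_Rintegral_off _ _ _ _ _ N _ (cst 0))//.
- by rewrite Rintegral_cst ?mul0r.
- by apply/measurable_EFinP; exact: measurable_int iphi.
- by move=> x Dx Nx; rewrite hN//= mulr0.
Qed.

End no_common_atoms.

(** * Signed measures *)

Section signed_integral.
Context (R : realType).
Implicit Types (s t r : smeasure R) (D : set R) (f g phi psi : R -> R).

Definition sint s D g := Rintegral (spos s) D g - Rintegral (sneg s) D g.
Definition sintegrable s D g :=
  (spos s).-integrable D (EFin \o g) /\ (sneg s).-integrable D (EFin \o g).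
Definition sfin s D := (spos s D < +oo)%E /\ (sneg s D < +oo)%E.

Lemma eq_sint s D f g : (forall x, D x -> f x = g x) -> sint s D f = sint s D g.
Proof.
by move=> fg; rewrite /sint; congr (_ - _); apply: eq_Rintegral => x; rewrite inE => /fg.
Qed.

Lemma eq_sintegrable s D f g : measurable D -> (forall x, D x -> f x = g x) ->
  sintegrable s D f -> sintegrable s D g.
Proof.
move=> mD fg [h1 h2].
by split; [move: h1|move: h2]; apply: eq_integrable => // x; rewrite inE /= => /fg ->.
Qed.

Lemma sintegrableS s D1 D2 f : measurable D1 -> measurable D2 -> D1 `<=` D2 ->
  sintegrable s D2 f -> sintegrable s D1 f.
Proof. by move=> m1 m2 sub [h1 h2]; split; [move: h1|move: h2]; exact: integrableS. Qed.

Lemma sintD s D f g : measurable D -> sintegrable s D f -> sintegrable s D g ->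
  sint s D (fun x => f x + g x) = sint s D f + sint s D g.
Proof. by move=> mD [f1 f2] [g1 g2]; rewrite /sint !RintegralD//; ring. Qed.

Lemma sintB s D f g : measurable D -> sintegrable s D f -> sintegrable s D g ->
  sint s D (fun x => f x - g x) = sint s D f - sint s D g.
Proof. by move=> mD [f1 f2] [g1 g2]; rewrite /sint !RintegralB//; ring. Qed.

Lemma sintZl s D (k : R) f : measurable D -> sintegrable s D f ->
  sint s D (fun x => k * f x) = k * sint s D f.
Proof. by move=> mD [f1 f2]; rewrite /sint !RintegralZl//; ring. Qed.

Lemma sintegrableD s D f g : measurable D -> sintegrable s D f -> sintegrable s D g ->
  sintegrable s D (fun x => f x + g x).
Proof.
by move=> mD [f1 f2] [g1 g2]; split;
  [have := integrableD mD f1 g1|have := integrableD mD f2 g2]; apply: eq_integrable.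
Qed.

Lemma sintegrableB s D f g : measurable D -> sintegrable s D f -> sintegrable s D g ->
  sintegrable s D (fun x => f x - g x).
Proof.
by move=> mD [f1 f2] [g1 g2]; split;
  [have := integrableB mD f1 g1|have := integrableB mD f2 g2]; apply: eq_integrable.
Qed.

Lemma sintegrableZl s D (k : R) f : measurable D -> sintegrable s D f ->
  sintegrable s D (fun x => k * f x).
Proof.
by move=> mD [f1 f2]; split;
  [have := integrableZl mD k f1|have := integrableZl mD k f2]; apply: eq_integrable.
Qed.

Lemma sint_setU s (A B : set R) f : measurable A -> measurable B ->
  sintegrable s (A `|` B) f -> [disjoint A & B] ->
  sint s (A `|` B) f = sint s A f + sint s B f.
Proof. by move=> mA mB [f1 f2] AB; rewrite /sint !Rintegral_setU//; ring. Qed.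

Lemma sint_set0 s f : sint s set0 f = 0.
Proof. by rewrite /sint !Rintegral_set0 subrr. Qed.

(** Lets the positive measure of the equation share the calculus of the two signed ones. *)
Definition posm (rho : pmeasure R) : smeasure R := SMeasure rho mzero.

Lemma sint_posm rho D f : sint (posm rho) D f = Rintegral rho D f.
Proof. by rewrite /sint /= {2}/Rintegral integral_measure_zero subr0. Qed.

Lemma sintegrable_posm rho D f : measurable D -> sintegrable (posm rho) D f <-> rho.-integrable D (EFin \o f).
Proof.
move=> mD; split=> [[]//|h]; split => //; apply/integrableP; split; first exact: measurable_int h.
by rewrite integral_measure_zero.
Qed.

(** Both Jordan parts are required to vanish, because integration by parts is applied to each pair
    of parts separately. *)
Definition sdisj s t D := forall y, D y ->
  (spos s [set y] = 0%E /\ sneg s [set y] = 0%E) \/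
  (spos t [set y] = 0%E /\ sneg t [set y] = 0%E).

Section signed_by_parts.
Context s t D (mD : measurable D) (sD : sfin s D) (tD : sfin t D) (st : sdisj s t D).
Context phi psi (iphi : sintegrable s D phi) (ipsi : sintegrable t D psi).

Let below (y : R) := [set x | x < y] `&` D.

Let pair (m n : {measure set R -> \bar R}) (f g : R -> R) : (m D < +oo)%E -> (n D < +oo)%E ->
  m.-integrable D (EFin \o f) -> n.-integrable D (EFin \o g) ->
  (forall y, D y -> n [set y] = 0%E \/ m [set y] = 0%E) ->
  Rintegral m D f * Rintegral n D g =
  Rintegral n D (fun y => Rintegral m (below y) f * g y) +
  Rintegral m D (fun y => Rintegral n (below y) g * f y).
Proof.
move=> mf nf jf jg dj; rewrite (Rintegral_by_parts mD mf nf jf jg).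
have := integrable_by_parts_atom mD mf nf jf jg.
under eq_fun do rewrite mulrA.
under [X in _ -> _ + _ + X = _]eq_Rintegral do rewrite mulrA.
by move/(Rintegral_atom_eq0 mD nf dj) => ->; rewrite addr0.
Qed.

Let ipair (m n : {measure set R -> \bar R}) (f g : R -> R) : (m D < +oo)%E -> (n D < +oo)%E ->
  m.-integrable D (EFin \o f) -> n.-integrable D (EFin \o g) ->
  m.-integrable D (EFin \o (fun y => Rintegral n (below y) g * f y)).
Proof.
move=> mf nf jf jg; have := integrable_by_parts_primitive mD mf nf jf jg.
by apply: eq_integrable => // x _; rewrite /= mulrC.
Qed.

Lemma sintegrable_by_parts : sintegrable s D (fun y => sint t (below y) psi * phi y).
Proof.
case: sD tD iphi ipsi => s1 s2 [t1 t2] [p1 p2] [q1 q2]; split.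
- have := integrableB mD (ipair s1 t1 p1 q1) (ipair s1 t2 p1 q2).
  by apply: eq_integrable => // x _ /=; rewrite -EFinB; congr EFin; rewrite /sint; ring.
- have := integrableB mD (ipair s2 t1 p2 q1) (ipair s2 t2 p2 q2).
  by apply: eq_integrable => // x _ /=; rewrite -EFinB; congr EFin; rewrite /sint; ring.
Qed.

(** Bilinear expansion into the four pairs of Jordan parts; for each pair the diagonal term vanishes
    because there is no common atom. *)
Lemma sint_by_parts :
  sint s D phi * sint t D psi =
  sint t D (fun y => sint s (below y) phi * psi y) +
  sint s D (fun y => sint t (below y) psi * phi y).
Proof.
have d11 y : D y -> spos t [set y] = 0%E \/ spos s [set y] = 0%E.
  by move/st => [[? ?]|[? ?]]; [right|left].
have d12 y : D y -> sneg t [set y] = 0%E \/ spos s [set y] = 0%E.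
  by move/st => [[? ?]|[? ?]]; [right|left].
have d21 y : D y -> spos t [set y] = 0%E \/ sneg s [set y] = 0%E.
  by move/st => [[? ?]|[? ?]]; [right|left].
have d22 y : D y -> sneg t [set y] = 0%E \/ sneg s [set y] = 0%E.
  by move/st => [[? ?]|[? ?]]; [right|left].
case: sD tD iphi ipsi => s1 s2 [t1 t2] [p1 p2] [q1 q2].
rewrite /sint.
have E1 (m : {measure set R -> \bar R}) : (m D < +oo)%E -> m.-integrable D (EFin \o psi) ->
   Rintegral m D (fun y => (Rintegral (spos s) (below y) phi - Rintegral (sneg s) (below y) phi) * psi y) =
   Rintegral m D (fun y => Rintegral (spos s) (below y) phi * psi y) -
   Rintegral m D (fun y => Rintegral (sneg s) (below y) phi * psi y).
  move=> mf jm; rewrite -RintegralB//; [|exact: ipair|exact: ipair].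
  by apply: eq_Rintegral => x _; ring.
have E2 (m : {measure set R -> \bar R}) : (m D < +oo)%E -> m.-integrable D (EFin \o phi) ->
   Rintegral m D (fun y => (Rintegral (spos t) (below y) psi - Rintegral (sneg t) (below y) psi) * phi y) =
   Rintegral m D (fun y => Rintegral (spos t) (below y) psi * phi y) -
   Rintegral m D (fun y => Rintegral (sneg t) (below y) psi * phi y).
  move=> mf jm; rewrite -RintegralB//; [|exact: ipair|exact: ipair].
  by apply: eq_Rintegral => x _; ring.
rewrite !E1// !E2// mulrBl !mulrBr.
rewrite (pair s1 t1)// (pair s1 t2)// (pair s2 t1)// (pair s2 t2)//.
repeat match goal with |- context [Rintegral ?m ?E ?f] => generalize (Rintegral m E f) => ? end.
by ring.
Qed.

End signed_by_parts.
End signed_integral.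

Section primitives.
Context (R : realType).
Implicit Types (s t r : smeasure R) (c d : R).

Definition ico c d : set R := [set y | c <= y < d].
Definition icc c d : set R := [set y | c <= y <= d].

Lemma measurable_ico c d : measurable (ico c d).
Proof. by rewrite /ico -set_itvco. Qed.
Lemma measurable_icc c d : measurable (icc c d).
Proof. by rewrite /icc -set_itvcc. Qed.
Hint Resolve measurable_ico measurable_icc : core.

Lemma ico_below c d y : ico c d y -> [set x | x < y] `&` ico c d = ico c y.
Proof.
move=> /andP[cy yd]; apply/seteqP; split=> x /=.
  by move=> [xy /andP[cx xd]]; apply/andP.
by move=> /andP[cx xy]; split => //; apply/andP; split => //; exact: lt_trans yd.
Qed.

(** The product rule for a function f, a primitive for varsigma, and a quasi-derivative, a primitive
    for chi minus one for varrho. G enters linearly, so integration by parts is used for the pairs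
    [s, t] and [s, r] only, and [t] and [r] may share atoms. The absence of atoms common to [s] and
    [t] or [r] is what allows both integrands to be evaluated at the point itself instead of as
    right limits. *)
Lemma primitive_mul s t r c d (F G phi psi1 psi2 : R -> R) : c <= d ->
  sfin s (ico c d) -> sfin t (ico c d) -> sfin r (ico c d) ->
  sdisj s t (ico c d) -> sdisj s r (ico c d) ->
  sintegrable s (ico c d) phi -> sintegrable t (ico c d) psi1 -> sintegrable r (ico c d) psi2 ->
  (forall y, icc c d y -> F y = F c + sint s (ico c y) phi) ->
  (forall y, icc c d y -> G y = G c + (sint t (ico c y) psi1 - sint r (ico c y) psi2)) ->
  [/\ sintegrable t (ico c d) (fun y => F y * psi1 y),
      sintegrable r (ico c d) (fun y => F y * psi2 y),
      sintegrable s (ico c d) (fun y => phi y * G y) &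
  F d * G d - F c * G c = sint t (ico c d) (fun y => F y * psi1 y) -
     sint r (ico c d) (fun y => F y * psi2 y) + sint s (ico c d) (fun y => phi y * G y)].
Proof.
move=> cd fs ft fr st sr iphi i1 i2 FE GE.
set D := ico c d in fs ft fr st sr iphi i1 i2 *.
have mD : measurable D by exact: measurable_ico.
have Dcc y : D y -> icc c d y by move=> /andP[cy yd]; rewrite /icc /= cy ltW.
have b (q : smeasure R) (f g : R -> R) : forall y, D y ->
  sint q ([set x | x < y] `&` D) f * g y = sint q (ico c y) f * g y.
  by move=> y Dy; rewrite ico_below.
have ts : sdisj t s D by move=> y /st []; [right|left].
have rs : sdisj r s D by move=> y /sr []; [right|left].
have A1 := eq_sintegrable mD (b s phi psi1) (sintegrable_by_parts mD ft fs i1 iphi).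
have A2 := eq_sintegrable mD (b s phi psi2) (sintegrable_by_parts mD fr fs i2 iphi).
have A3 := eq_sintegrable mD (b t psi1 phi) (sintegrable_by_parts mD fs ft iphi i1).
have A4 := eq_sintegrable mD (b r psi2 phi) (sintegrable_by_parts mD fs fr iphi i2).
have P1 := sint_by_parts mD fs ft st iphi i1.
have P2 := sint_by_parts mD fs fr sr iphi i2.
rewrite (eq_sint _ (b s phi psi1)) (eq_sint _ (b t psi1 phi)) in P1.
rewrite (eq_sint _ (b s phi psi2)) (eq_sint _ (b r psi2 phi)) in P2.
have e1 y : D y -> F c * psi1 y + sint s (ico c y) phi * psi1 y = F y * psi1 y.
  by move=> /Dcc /FE ->; ring.
have e2 y : D y -> F c * psi2 y + sint s (ico c y) phi * psi2 y = F y * psi2 y.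
  by move=> /Dcc /FE ->; ring.
have e3 y : D y -> G c * phi y + (sint t (ico c y) psi1 * phi y - sint r (ico c y) psi2 * phi y) = phi y * G y.
  by move=> /Dcc /GE ->; ring.
have c1 := sintegrableZl (F c) mD i1.
have c2 := sintegrableZl (F c) mD i2.
have c3 := sintegrableZl (G c) mD iphi.
have c4 := sintegrableB mD A3 A4.
split.
- exact: eq_sintegrable e1 (sintegrableD mD c1 A1).
- exact: eq_sintegrable e2 (sintegrableD mD c2 A2).
- exact: eq_sintegrable e3 (sintegrableD mD c3 c4).
rewrite -(eq_sint _ e1) -(eq_sint _ e2) -(eq_sint _ e3).
rewrite (sintD mD c1 A1) (sintD mD c2 A2) (sintD mD c3 c4) (sintZl _ mD i1) (sintZl _ mD i2).
rewrite (sintZl _ mD iphi) (sintB mD A3 A4).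
have cdd : icc c d d by rewrite /icc /= cd lexx.
rewrite (FE d cdd) (GE d cdd) -/D.
have -> : (F c + sint s D phi) * (G c + (sint t D psi1 - sint r D psi2)) - F c * G c =
  F c * sint t D psi1 - F c * sint r D psi2 + G c * sint s D phi
  + sint s D phi * sint t D psi1 - sint s D phi * sint r D psi2 by ring.
rewrite P1 P2.
repeat match goal with |- context [sint ?m ?E ?f] => generalize (sint m E f) => ? end.
by ring.
Qed.

End primitives.
#[global] Hint Resolve measurable_ico measurable_icc : core.

(** * The real equation and Lagrange's identity *)

Section real_equation.
Context (R : realType) (a b : \bar R).
Implicit Types (s : smeasure R) (c d x y : R) (f g h : R -> R).

Lemma Iab_convex c d y : Iab a b c -> Iab a b d -> c <= y <= d -> Iab a b y.
Proof.
move=> [ac cb] [ad db] /andP[cy yd]; split.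
  by apply: lt_le_trans ac _; rewrite lee_fin.
by apply: le_lt_trans db; rewrite lee_fin.
Qed.

Definition slocint_real s f := forall c d, Iab a b c -> Iab a b d -> sintegrable s (icc c d) f.
Definition slocfin s := forall c d, Iab a b c -> Iab a b d -> sfin s (icc c d).

Lemma ico_sub_icc c d : ico c d `<=` icc c d.
Proof. by move=> y /andP[cy yd]; rewrite /icc /= cy ltW. Qed.

Lemma slocint_ico s f : slocint_real s f -> forall c d, Iab a b c -> Iab a b d -> sintegrable s (ico c d) f.
Proof. by move=> h c d ? ?; apply: sintegrableS (h c d _ _) => //; exact: ico_sub_icc. Qed.

Lemma sfinS s (A B : set R) : measurable A -> measurable B -> A `<=` B -> sfin s B -> sfin s A.
Proof.
by move=> mA mB AB [f1 f2]; split; [apply: le_lt_trans f1|apply: le_lt_trans f2];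
  apply: le_measure; rewrite ?inE.
Qed.

Lemma slocfin_ico s : slocfin s -> forall c d, Iab a b c -> Iab a b d -> sfin s (ico c d).
Proof. by move=> h c d ? ?; apply: sfinS (h c d _ _) => //; exact: ico_sub_icc. Qed.

Lemma ico_split c y d : c <= y -> y <= d -> ico c d = ico c y `|` ico y d.
Proof.
move=> cy yd; apply/seteqP; split=> x; rewrite /ico /=.
  by move=> /andP[cx xd]; have [xy|yx] := ltP x y; [left; rewrite cx|right].
by case=> /andP[u v]; apply/andP; split => //; [exact: lt_le_trans yd|exact: le_trans u].
Qed.

Lemma disj_ico c y d : [disjoint ico c y & ico y d].
Proof.
apply/disj_setPS => x [/= /andP[_ xy] /andP[yx _]].
by move: (lt_le_trans xy yx); rewrite ltxx.
Qed.

Lemma ico_eq0 c d : d <= c -> ico c d = set0.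
Proof.
move=> dc; apply/seteqP; split => // x /= /andP[cx xd].
by have := le_lt_trans (le_trans dc cx) xd; rewrite ltxx.
Qed.

Lemma sint_ico_split s f c y d : c <= y -> y <= d -> sintegrable s (ico c d) f ->
  sint s (ico c d) f = sint s (ico c y) f + sint s (ico y d) f.
Proof.
move=> cy yd; rewrite (ico_split cy yd) => jf; rewrite sint_setU//.
exact: disj_ico.
Qed.

(** The equation for real functions, restricted to [c <= x] and solved for the quasi-derivative,
    which is the shape the product rule takes. *)
Definition real_dtau (rho : pmeasure R) (vs chi : smeasure R) (f f1 h : R -> R) : Prop :=
  [/\ slocint_real vs f1, slocint_real chi f, slocint_real (posm rho) h &
      forall c x : R, Iab a b c -> Iab a b x -> c <= x ->
        f x = f c + sint vs (ico c x) f1 /\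
        f1 x = f1 c + (sint chi (ico c x) f - sint (posm rho) (ico c x) h)].

Context (rho : pmeasure R) (vs chi : smeasure R).

Lemma oint_le (mu : pmeasure R) c x f : c <= x -> oint mu c x f = Rintegral mu (ico c x) f.
Proof.
rewrite /oint le_eqVlt => /predU1P[->|->//].
by rewrite ltxx ico_eq0// Rintegral_set0.
Qed.

Lemma oint_ge (mu : pmeasure R) c x f : x <= c -> oint mu c x f = - Rintegral mu (ico x c) f.
Proof.
rewrite /oint le_eqVlt => /predU1P[->|xc].
  by rewrite ltxx ico_eq0// Rintegral_set0 oppr0.
by rewrite (lt_gtF xc) xc.
Qed.

Lemma locint_posm (mu : pmeasure R) (F : R -> R[i]) : locint a b mu F <->
  slocint_real (posm mu) (fun x => complex.Re (F x)) /\
  slocint_real (posm mu) (fun x => complex.Im (F x)).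
Proof.
split=> [h|[h1 h2] c d ic id].
  by split=> c d ic id; apply/sintegrable_posm => //; have [] := h c d ic id.
by have [? _] := h1 c d ic id; have [? _] := h2 c d ic id.
Qed.

Lemma slocint_realE (s : smeasure R) (F : R -> R[i]) : slocint a b s F <->
  slocint_real s (fun x => complex.Re (F x)) /\
  slocint_real s (fun x => complex.Im (F x)).
Proof.
split=> [[h1 h2]|[h1 h2]].
  split=> c d ic id; have [? ?] := h1 c d ic id; have [? ?] := h2 c d ic id => //.
split=> c d ic id; have [? ?] := h1 c d ic id; have [? ?] := h2 c d ic id => //.
Qed.

(** The measures are real, so real and imaginary parts decouple; the case [x < c] is the case
    [c <= x] with the endpoints exchanged. *)
Lemma dtau_realE (F F1 H : R -> R[i]) : dtau a b rho vs chi F F1 H <->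
  real_dtau rho vs chi (fun x => complex.Re (F x)) (fun x => complex.Re (F1 x)) (fun x => complex.Re (H x)) /\
  real_dtau rho vs chi (fun x => complex.Im (F x)) (fun x => complex.Im (F1 x)) (fun x => complex.Im (H x)).
Proof.
have ReI (z w u v : R[i]) : z - w = u - v <-> (complex.Re z - complex.Re w = complex.Re u - complex.Re v /\
  complex.Im z - complex.Im w = complex.Im u - complex.Im v).
  case: z w u v => z1 z2 [w1 w2] [u1 u2] [v1 v2] /=; split=> [[]//|[e1 e2]].
  by apply/eqP; rewrite eq_complex /=; apply/andP; split; apply/eqP.
split.
  move=> [/slocint_realE[s1 s2] /slocint_realE[c1 c2] /locint_posm[l1 l2] e].
  split; split => // c x ic ix cx; have [e1 e2] := e c x ic ix; split.
  - move/ReI: e1 => [+ _]; rewrite /scoint /coint /= !oint_le// /sint => /eqP.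
    by rewrite subr_eq => /eqP ->; rewrite addrC.
  - move: e2; rewrite -[_ + coint _ _ _ _]opprK => /(congr1 (@complex.Re R)).
    case: (F1 x) (F1 c) => u1 u2 [v1 v2]; rewrite /scoint /coint /= !oint_le// sint_posm /sint => e'.
    by apply/eqP; rewrite -subr_eq0; apply/eqP; move/eqP: e'; rewrite -subr_eq0 => /eqP e'; lra.
  - move/ReI: e1 => [_]; rewrite /scoint /coint /= !oint_le// /sint => /eqP.
    by rewrite subr_eq => /eqP ->; rewrite addrC.
  - move: e2; rewrite -[_ + coint _ _ _ _]opprK => /(congr1 (@complex.Im R)).
    case: (F1 x) (F1 c) => u1 u2 [v1 v2]; rewrite /scoint /coint /= !oint_le// sint_posm /sint => e'.
    by apply/eqP; rewrite -subr_eq0; apply/eqP; move/eqP: e'; rewrite -subr_eq0 => /eqP e'; lra.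
move=> [[s1 c1 l1 e1] [s2 c2 l2 e2]]; split.
- exact/slocint_realE.
- exact/slocint_realE.
- exact/locint_posm.
move=> c x ic ix; have [cx|/ltW xc] := leP c x.
  have [] := e1 c x ic ix cx; have [] := e2 c x ic ix cx.
  rewrite !sint_posm /sint /scoint /coint !oint_le//.
  move: (F x) (F c) (F1 x) (F1 c) => [? ?] [? ?] [? ?] [? ?] /= -> -> -> ->.
  by split; apply/eqP; rewrite eq_complex /=; apply/andP; split; apply/eqP; ring.
have [] := e1 x c ix ic xc; have [] := e2 x c ix ic xc.
rewrite !sint_posm /sint /scoint /coint !oint_ge//.
move: (F x) (F c) (F1 x) (F1 c) => [? ?] [? ?] [? ?] [? ?] /= -> -> -> ->.
by split; apply/eqP; rewrite eq_complex /=; apply/andP; split; apply/eqP; ring.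
Qed.

Hypotheses (fvs : slocfin vs) (fchi : slocfin chi) (frho : slocfin (posm rho)).
Hypotheses (dchi : sdisj vs chi (Iab a b)) (drho : sdisj vs (posm rho) (Iab a b)).

(** The product rule is applied to [f * g1] and to [g * f1]. In the difference the integrals of
    [f1 * g1] against varsigma and of [f * g] against chi cancel, and only varrho remains. *)
Lemma real_lagrange f f1 h g g1 k c d : real_dtau rho vs chi f f1 h -> real_dtau rho vs chi g g1 k ->
  Iab a b c -> Iab a b d -> c <= d ->
  (f d * g1 d - f1 d * g d) - (f c * g1 c - f1 c * g c) =
  Rintegral rho (ico c d) (fun y => h y * g y - f y * k y).
Proof.
move=> [sf1 sf sh ef] [sg1 sg sk eg] ic id cd.
have sub : ico c d `<=` Iab a b.
  by move=> y /ico_sub_icc; exact: Iab_convex.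
have dc : sdisj vs chi (ico c d) by move=> y /sub /dchi.
have dr : sdisj vs (posm rho) (ico c d) by move=> y /sub /drho.
have ivs := slocfin_ico fvs ic id; have ichi := slocfin_ico fchi ic id.
have irho := slocfin_ico frho ic id.
have pf y : icc c d y -> f y = f c + sint vs (ico c y) f1.
  by move=> cyd; have /andP[cy _] := cyd; have [] := ef c y ic (Iab_convex ic id cyd) cy.
have pf1 y : icc c d y -> f1 y = f1 c + (sint chi (ico c y) f - sint (posm rho) (ico c y) h).
  by move=> cyd; have /andP[cy _] := cyd; have [] := ef c y ic (Iab_convex ic id cyd) cy.
have pg y : icc c d y -> g y = g c + sint vs (ico c y) g1.
  by move=> cyd; have /andP[cy _] := cyd; have [] := eg c y ic (Iab_convex ic id cyd) cy.
have pg1 y : icc c d y -> g1 y = g1 c + (sint chi (ico c y) g - sint (posm rho) (ico c y) k).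
  by move=> cyd; have /andP[cy _] := cyd; have [] := eg c y ic (Iab_convex ic id cyd) cy.
have [a1 a2 a3 a4] := primitive_mul cd ivs ichi irho dc dr (slocint_ico sf1 ic id)
  (slocint_ico sg ic id) (slocint_ico sk ic id) pf pg1.
have [b1 b2 b3 b4] := primitive_mul cd ivs ichi irho dc dr (slocint_ico sg1 ic id)
  (slocint_ico sf ic id) (slocint_ico sh ic id) pg pf1.
have -> : f d * g1 d - f1 d * g d - (f c * g1 c - f1 c * g c) =
  (f d * g1 d - f c * g1 c) - (g d * f1 d - g c * f1 c) by ring.
rewrite a4 b4 -sint_posm.
have -> : sint (posm rho) (ico c d) (fun y => h y * g y - f y * k y) =
  sint (posm rho) (ico c d) (fun y => g y * h y) - sint (posm rho) (ico c d) (fun y => f y * k y).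
  by rewrite -sintB//; apply: eq_sint => y _; ring.
rewrite (eq_sint (g := (fun y => g y * f y)) chi (fun y _ => mulrC (f y) (g y))).
rewrite (eq_sint (g := (fun y => g1 y * f1 y)) vs (fun y _ => mulrC (f1 y) (g1 y))).
repeat match goal with |- context [sint ?m ?E ?f] => generalize (sint m E f) => ? end.
by ring.
Qed.

End real_equation.

(** * Initial value problems *)

Section iterated_integrals.
Context (R : realType) (X : set R) (mX : measurable X) (k : R -> R).
Context (mk : measurable_fun setT k).

(* [k] is the identity for the forward and the opposite for the backward initial value problem. *)
Definition before (x : R) : set R := [set y | k y < k x] `&` X.

Lemma measurable_before x : measurable (before x).
Proof.
apply: measurableI => //.
by have := measurable_lt_fun mk (@measurable_cst _ _ _ _ setT (k x)).
Qed.
Hint Resolve measurable_before : core.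

Lemma before_sub x y : before x y -> before y `<=` before x.
Proof. by move=> [yx _] z [zy Xz]; split => //; exact: lt_trans yx. Qed.

Lemma beforeI x y : before x y -> [set z | k z < k y] `&` before x = before y.
Proof.
move=> [yx _]; apply/seteqP; split=> z; first by move=> [zy [zx Xz]].
by move=> [zy Xz]; split => //; split => //; exact: lt_trans yx.
Qed.

Section primitive.
Context (m : {measure set R -> \bar R}) (fin : forall x, X x -> (m (before x) < +oo)%E).

(** Read off from Fubini with the constant 1 as outer factor: the integral over a section is an
    integrable function, and for x in [before d] the section is [before x]. *)
Lemma measurable_primitive (mu : {measure set R -> \bar R}) (psi : R -> R) d :
  (mu (before d) < +oo)%E -> mu.-integrable (before d) (EFin \o psi) ->
  measurable_fun (before d) (fun x => Rintegral mu (before x) psi).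
Proof.
move=> fd ipsi.
have mE : measurable [set z : R * R | k z.2 < k z.1].
  by apply: measurable_lt_fun; apply: measurableT_comp.
have i1 : mu.-integrable (before d) (EFin \o cst (1 : R)).
  by apply: measurable_bounded_integrable => //; exists 1; split => // M M1 x _ /=; rewrite normr1 ltW.
have /measurable_int/measurable_EFinP := integrable_fubini (measurable_before d) (measurable_before d) fd fd mE i1 ipsi.
apply: eq_measurable_fun => x; rewrite inE => dx /=.
by rewrite mul1r beforeI.
Qed.

(** Up to a constant factor these majorise the terms of the Picard series. *)
Fixpoint iter_int n : R -> R :=
  if n is n'.+1 then fun x => Rintegral m (before x) (iter_int n') else cst 1.

Lemma iter_int_ge0 n x : 0 <= iter_int n x.
Proof. by elim: n x => [|n IH] x //=; rewrite Rintegral_ge0. Qed.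

Let Om x := Rintegral m (before x) (cst 1).

Let OmE x : X x -> Om x = fine (m (before x)).
Proof. by move=> Xx; rewrite /Om Rintegral_cst// mul1r. Qed.

Let le_Om x y : X x -> before x y -> Om y <= Om x.
Proof.
move=> Xx xy; have Xy : X y by case: xy.
rewrite !OmE// fine_le ?ge0_fin_numE ?fin//.
by apply: le_measure; rewrite ?inE//; exact: before_sub.
Qed.

Let cst_int r d : X d -> m.-integrable (before d) (EFin \o cst (r : R)).
Proof.
move=> Xd; apply: measurable_bounded_integrable => //; first exact: fin.
by exists `|r|; split => // M M1 x _ /=; rewrite ltW.
Qed.

(* With atoms the identity [n! I_n = m(before d)^n] fails, but this inequality survives by Tonelli,
   since [before] is strict; it gives the factorial decay that makes Picard iteration converge. *)
Lemma iter_int_key n : (forall d, X d -> m.-integrable (before d) (EFin \o iter_int n)) /\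
  (forall d, X d -> n.+1%:R * iter_int n.+1 d <= Rintegral m (before d) (cst 1) * iter_int n d).
Proof.
have E x y : before x y -> Rintegral m (before y) (cst 1) = Om y by [].
elim: n => [|n [IH1 IH2]].
  split; first by move=> d Xd; exact: cst_int.
  by move=> d Xd; rewrite /= mul1r mulr1.
have int1 d : X d -> m.-integrable (before d) (EFin \o iter_int n.+1).
  move=> Xd; apply: (@le_integrable _ _ _ _ _ _ _ (EFin \o cst (iter_int n.+1 d))) => //.
  - by apply/measurable_EFinP; apply: measurable_primitive; [exact: fin|exact: IH1].
  - move=> x dx /=; rewrite lee_fin !ger0_norm ?Rintegral_ge0//; last 2 first.
      by move=> ? _; exact: iter_int_ge0.
      by move=> ? _; exact: iter_int_ge0.
    rewrite /Rintegral fine_le//.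
    + by apply: integrable_fin_num => //; apply: IH1; case: dx.
    + by apply: integrable_fin_num => //; apply: IH1.
    apply: ge0_subset_integral => //.
    + by have /measurable_int := IH1 d Xd.
    + by move=> y _ /=; rewrite lee_fin iter_int_ge0.
    + exact: before_sub.
  - exact: cst_int.
split=> // d Xd.
have fd := fin Xd.
have mE : measurable [set z : R * R | k z.1 < k z.2].
  by apply: measurable_lt_fun; apply: measurableT_comp.
have mb := measurable_before d.
have fub := Rintegral_fubini mb mb fd fd mE (IH1 d Xd) (cst_int 1 Xd).
have ifub := integrable_fubini mb mb fd fd mE (IH1 d Xd) (cst_int 1 Xd).
rewrite /= in fub ifub.
have E3 : Rintegral m (before d) (fun y => cst 1 y * Rintegral m ([set x | k x < k y] `&` before d) (iter_int n)) =
   Rintegral m (before d) (iter_int n.+1).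
  by apply: eq_Rintegral => y; rewrite inE => dy; rewrite /= mul1r beforeI.
rewrite /= in E3; rewrite E3 in fub.
have iOm : m.-integrable (before d) (EFin \o (fun y => iter_int n y * Om y)).
  apply: (@le_integrable _ _ _ _ _ _ _ (EFin \o (fun y => Om d * iter_int n y))) => //.
  - apply/measurable_EFinP; apply: measurable_funM.
      by apply/measurable_EFinP; have /measurable_int := IH1 d Xd.
    by apply: measurable_primitive => //; exact: cst_int.
  - move=> y dy /=; rewrite lee_fin !ger0_norm ?mulr_ge0 ?iter_int_ge0 ?Rintegral_ge0//.
    by rewrite mulrC ler_wpM2r ?iter_int_ge0// le_Om.
  - by have := integrableZl mb (Om d) (IH1 d Xd); apply: eq_integrable.
(* Of the n+2 copies of the integral of [iter_int n.+1], n+1 are bounded through the induction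
   hypothesis by the integral of [iter_int n y] times the mass of [before y]. The last one is by
   Fubini the integral of [iter_int n y] times the mass of the part of [before d] after y. These two
   sets are disjoint parts of [before d]. *)
have -> : n.+2%:R * iter_int n.+2 d = n.+1%:R * Rintegral m (before d) (iter_int n.+1) +
    Rintegral m (before d) (iter_int n.+1).
  by rewrite -natr1 /=; ring.
rewrite -{2}fub -RintegralZl//; last exact: int1.
rewrite -RintegralD//; last first.
  by have := integrableZl mb n.+1%:R (int1 d Xd); apply: eq_integrable.
rewrite [leRHS]/= -RintegralZl//; last exact: IH1.
apply: le_Rintegral => //.
- apply: (@integrableD _ _ _ _ _ _ (EFin \o (fun x => n.+1%:R * iter_int n.+1 x)) (EFin \o _)) => //.
  by have := integrableZl mb n.+1%:R (int1 d Xd); apply: eq_integrable.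
- by have := integrableZl mb (Om d) (IH1 d Xd); apply: eq_integrable.
move=> y dy; have Xy : X y by case: dy.
apply: (@le_trans _ _ (Om y * iter_int n y + iter_int n y * Rintegral m ([set s | k y < k s] `&` before d) (cst 1))).
  by rewrite lerD2r; exact: IH2.
rewrite mulrC -mulrDr mulrC ler_wpM2r ?iter_int_ge0//.
rewrite /Om -Rintegral_setU//; first last.
- apply/disj_setPS => x [[/= xy _] [/= yx _]].
  by move: (lt_trans xy yx); rewrite ltxx.
- apply: integrableS (cst_int 1 Xd) => //.
    apply: measurableU => //; apply: measurableI => //.
    by have := measurable_lt_fun (@measurable_cst _ _ _ _ setT (k y)) mk.
  by move=> x [/(before_sub dy)|[]].
- apply: measurableI => //.
  by have := measurable_lt_fun (@measurable_cst _ _ _ _ setT (k y)) mk.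
have mU : measurable (before y `|` [set s | k y < k s] `&` before d).
  apply: measurableU => //; apply: measurableI => //.
  by have := measurable_lt_fun (@measurable_cst _ _ _ _ setT (k y)) mk.
have sub : before y `|` [set s | k y < k s] `&` before d `<=` before d.
  by move=> x [/(before_sub dy)|[]].
rewrite !Rintegral_cst// !mul1r fine_le ?ge0_fin_numE//.
  by apply: le_lt_trans fd; apply: le_measure; rewrite ?inE.
by apply: le_measure; rewrite ?inE.
Qed.

Lemma iter_int_le n d : X d -> iter_int n d <= fine (m (before d)) ^+ n / n`!%:R.
Proof.
move=> Xd; elim: n => [|n IH]; first by rewrite expr0 fact0 divr1.
have [_ /(_ d Xd)] := iter_int_key n; rewrite -mulrC -ler_pdivlMr ?ltr0n// => /le_trans; apply.
rewrite -/(Om d) OmE// factS natrM invfM exprS mulrA.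
rewrite [leRHS]mulrAC [leLHS]mulrAC mulrAC ler_wpM2r ?invr_ge0//.
by rewrite -mulrA ler_wpM2l// fine_ge0.
Qed.

End primitive.
End iterated_integrals.

Lemma cvg_norm_le (R : realType) (u : nat -> R) (l B : R) :
  (forall n, `|u n| <= B) -> u @ \oo --> l -> `|l| <= B.
Proof.
move=> uB ul; have cn : (fun n => `|u n|) @ \oo --> `|l| by exact: cvg_norm.
by rewrite -(cvg_lim (@norm_hausdorff _ R) cn); apply: limr_le;
  [exact: cvgP cn|exact: nearW].
Qed.

(** * Picard iteration for a coupled pair of integral equations *)

Section picard.
Context (R : realType) (X : set R) (mX : measurable X) (k : R -> R).
Context (mk : measurable_fun setT k) (s t : smeasure R).
Local Notation before := (before X k).
Hypotheses (fs : forall x, X x -> sfin s (before x)) (ft : forall x, X x -> sfin t (before x)).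

(** One measure that dominates both variations, so that a single sequence of iterated integrals
    bounds both components of the iteration. *)
Let m : {measure set R -> \bar R} :=
  measure_add (measure_add (spos s) (sneg s)) (measure_add (spos t) (sneg t)).

Let mb x : measurable (before x). Proof. exact: measurable_before. Qed.
Hint Resolve mb : core.

Let mE A : m A = (spos s A + sneg s A + (spos t A + sneg t A))%E.
Proof. by apply: etrans (measure_addE _ _ _) _; congr (_ + _)%E; exact: measure_addE. Qed.

Let fin x : X x -> (m (before x) < +oo)%E.
Proof.
by move=> Xx; have [? ?] := fs Xx; have [? ?] := ft Xx; rewrite mE !lte_add_pinfty.
Qed.

Let ge0_int_m D (g : R -> \bar R) : measurable D -> measurable_fun D g -> (forall x, D x -> 0 <= g x)%E ->
  (\int[m]_(x in D) g x = \int[spos s]_(x in D) g x + \int[sneg s]_(x in D) g x +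
   (\int[spos t]_(x in D) g x + \int[sneg t]_(x in D) g x))%E.
Proof. by move=> mD mg g0; rewrite /m !ge0_integral_measure_add. Qed.

Let int_m D (g : R -> R) : measurable D -> m.-integrable D (EFin \o g) ->
  sintegrable s D g /\ sintegrable t D g.
Proof.
move=> mD /integrableP[mg]; rewrite ge0_int_m//; last exact: measurableT_comp.
have P (mu : {measure set R -> \bar R}) : (0 <= \int[mu]_(x in D) `|(EFin \o g) x|)%E by exact: integral_ge0.
have Q (w x y z : \bar R) : (0 <= x)%E -> (0 <= y)%E -> (0 <= z)%E -> (w <= w + x + (y + z))%E.
  by move=> x0 y0 z0; rewrite -addeA leeDl// adde_ge0// adde_ge0.
move=> h; do 2 split; apply/integrableP; split=> //; apply: le_lt_trans h.
- by apply: Q; exact: P.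
- by rewrite (addeC (\int[spos s]_(x in D) _)%E); apply: Q; exact: P.
- by rewrite addeC; apply: Q; exact: P.
- by rewrite addeC (addeC (\int[spos t]_(x in D) _)%E); apply: Q; exact: P.
Qed.

Let Rint_m D (g : R -> R) : measurable D -> m.-integrable D (EFin \o g) -> (forall x, D x -> 0 <= g x) ->
  Rintegral m D g = Rintegral (spos s) D g + Rintegral (sneg s) D g +
    (Rintegral (spos t) D g + Rintegral (sneg t) D g).
Proof.
move=> mD ig g0; have [[i1 i2] [i3 i4]] := int_m mD ig.
rewrite /Rintegral ge0_int_m//; last exact: measurable_int ig.
have F (mu : {measure set R -> \bar R}) : mu.-integrable D (EFin \o g) ->
  (\int[mu]_(x in D) (g x)%:E \is a fin_num)%E by exact: integrable_fin_num.
have fineD4 (w x y z : \bar R) : w \is a fin_num -> x \is a fin_num -> y \is a fin_num ->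
    z \is a fin_num -> fine (w + x + (y + z))%E = fine w + fine x + (fine y + fine z).
  by move: w x y z => [w| |] [x| |] [y| |] [z| |].
exact: fineD4 (F _ i1) (F _ i2) (F _ i3) (F _ i4).
Qed.

Let I := iter_int X k m.
Let iI n d : X d -> m.-integrable (before d) (EFin \o I n).
Proof. by move=> Xd; have [h _] := iter_int_key mX mk fin n; exact: h. Qed.

Context (u0 v0 : R -> R).
Hypotheses (mu0 : forall d, X d -> measurable_fun (before d) u0)
           (mv0 : forall d, X d -> measurable_fun (before d) v0).
Hypothesis bd : forall d, X d -> exists2 M : R, 0 <= M & forall x, (before d x \/ x = d) ->
   `|u0 x| <= M /\ `|v0 x| <= M.

(** The differences of consecutive Picard iterates for u = u0 + int v ds, v = v0 + int u dt; the
    solution is the sum of all terms. *)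
Fixpoint picard_term n : (R -> R) * (R -> R) :=
  if n is n'.+1 then (fun x => sint s (before x) (picard_term n').2,
                      fun x => sint t (before x) (picard_term n').1)
  else (u0, v0).
Let p n := (picard_term n).1.
Let q n := (picard_term n).2.

Let bounded_int D (g : R -> R) n M : measurable D -> m.-integrable D (EFin \o I n) ->
  measurable_fun D g -> (forall x, D x -> `|g x| <= M * I n x) -> m.-integrable D (EFin \o g).
Proof.
move=> mD iIn mg gM; apply: (@le_integrable _ _ _ _ _ _ _ (EFin \o (fun x => M * I n x))) => //.
- exact/measurable_EFinP.
- by move=> x Dx /=; rewrite lee_fin (le_trans (gM _ Dx))// ler_norm.
- by have := integrableZl mD M iIn; apply: eq_integrable.
Qed.

Let sint_bound (r : smeasure R) D g M n : measurable D -> r = s \/ r = t -> m.-integrable D (EFin \o I n) ->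
  m.-integrable D (EFin \o g) -> (forall x, D x -> `|g x| <= M * I n x) ->
  `|sint r D g| <= M * Rintegral m D (I n).
Proof.
move=> mD rE iIn ig gM.
have igM : m.-integrable D (EFin \o (fun x => `|g x|)) by exact: integrable_norm.
have [[a1 a2] [a3 a4]] := int_m mD ig.
rewrite -RintegralZl//; apply: (@le_trans _ _ (Rintegral m D (fun x => `|g x|))); last first.
  apply: le_Rintegral => //.
  by have := integrableZl mD M iIn; apply: eq_integrable.
rewrite Rint_m//.
have n0 (mu : {measure set R -> \bar R}) : 0 <= Rintegral mu D (fun x => `|g x|).
  exact: Rintegral_ge0.
rewrite /sint; apply: (le_trans (ler_normB _ _)).
case: rE => ->.
  apply: (@le_trans _ _ (Rintegral (spos s) D (fun x => `|g x|) + Rintegral (sneg s) D (fun x => `|g x|))).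
    by rewrite lerD// le_normr_Rintegral.
  by rewrite lerDl addr_ge0.
apply: (@le_trans _ _ (Rintegral (spos t) D (fun x => `|g x|) + Rintegral (sneg t) D (fun x => `|g x|))).
  by rewrite lerD// le_normr_Rintegral.
by rewrite lerDr addr_ge0.
Qed.

Let term_bound d (M : R) : X d -> (forall x, (before d x \/ x = d) -> `|u0 x| <= M /\ `|v0 x| <= M) ->
  forall n, [/\ measurable_fun (before d) (p n), measurable_fun (before d) (q n) &
    forall x, (before d x \/ x = d) -> `|p n x| <= M * I n x /\ `|q n x| <= M * I n x].
Proof.
move=> Xd hM; elim=> [|n [mp mq h]].
  split; [exact: mu0|exact: mv0|move=> x /hM].
  by rewrite /p /q /I /= mulr1.
have ip e : before d e \/ e = d -> m.-integrable (before e) (EFin \o p n) /\ m.-integrable (before e) (EFin \o q n).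
  move=> de.
  have Xe : X e by case: de => [[]|->].
  have sub : before e `<=` before d by case: de => [/before_sub//|->].
  split; apply: (bounded_int (n := n) (M := M)) => //; try exact: iI.
  - exact: measurable_funS mp.
  - by move=> x /sub ex; have [] := h x (or_introl ex).
  - exact: measurable_funS mq.
  - by move=> x /sub ex; have [] := h x (or_introl ex).
have [ipd iqd] := ip d (or_intror erefl).
have [[b1 b2] [b3 b4]] := int_m (mb d) ipd.
have [[c1 c2] [c3 c4]] := int_m (mb d) iqd.
have [f1 f2] := fs Xd; have [f3 f4] := ft Xd.
split.
- by apply: measurable_funB; exact: measurable_primitive.
- by apply: measurable_funB; exact: measurable_primitive.
move=> x dx; have [ipx iqx] := ip x dx.
have Xx : X x by case: dx => [[]|->].
have sub : before x `<=` before d by case: dx => [/before_sub//|->].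
split; apply: sint_bound => //; try exact: iI; try by [left|right].
- by move=> y /sub dy; have [] := h y (or_introl dy).
- by move=> y /sub dy; have [] := h y (or_introl dy).
Qed.

Definition picard_sol1 x := limn (series (fun n => p n x)).
Definition picard_sol2 x := limn (series (fun n => q n x)).

Let partial_bound d (M : R) : X d -> (forall x, (before d x \/ x = d) -> `|u0 x| <= M /\ `|v0 x| <= M) -> 0 <= M ->
  exists2 B : R, 0 <= B & forall x, (before d x \/ x = d) ->
  [/\ forall n, `|series (fun n => p n x) n| <= B, forall n, `|series (fun n => q n x) n| <= B,
      series (fun n => p n x) @ \oo --> picard_sol1 x & series (fun n => q n x) @ \oo --> picard_sol2 x].
Proof.
move=> Xd hM M0.
(* The terms are at most [M * O ^+ n / n!] uniformly on [before d] and at d, so the exponential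
   series dominates and [M * expR O] bounds all partial sums. *)
set O := fine (m (before d)).
have O0 : 0 <= O by rewrite fine_ge0.
have cve := is_cvg_series_exp_coeff O.
exists (M * expR O); first by rewrite mulr_ge0// expR_ge0.
have key (g : nat -> R) : (forall n, `|g n| <= M * (exp_coeff O n)) ->
    (forall n, `|series g n| <= M * expR O) /\ series g @ \oo --> limn (series g).
  move=> gM; split.
    move=> n; apply: (@le_trans _ _ (\sum_(0 <= i < n) M * exp_coeff O i)).
      by apply: (le_trans (ler_norm_sum _ _ _)); apply: ler_sum => i _; exact: gM.
    rewrite -mulr_sumr ler_wpM2l//.
    apply: (nondecreasing_cvgn_le _ cve n).
    by apply/nondecreasing_seqP => i; rewrite /series /= big_nat_recr//= lerDl exp_coeff_ge0.
  have : cvgn (series (fun n => M * exp_coeff O n)).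
    exact: (@is_cvg_seriesZ _ (exp_coeff O) M cve).
  move=> cM; have : cvgn [normed series g].
    apply: (@series_le_cvg _ (fun n => `|g n|) _ _ _ _ cM) => // n.
    by rewrite mulr_ge0// exp_coeff_ge0.
  by move/normed_cvg.
move=> x dx.
have Xx : X x by case: dx => [[]|->].
have Ix n : M * I n x <= M * exp_coeff O n.
  rewrite ler_wpM2l//; apply: (le_trans (iter_int_le mX mk fin n Xx)).
  rewrite /exp_coeff /= ler_wpM2r ?invr_ge0//.
  rewrite lerXn2r ?nnegrE ?fine_ge0// fine_le ?ge0_fin_numE ?fin//.
  apply: le_measure; rewrite ?inE//.
  by case: dx => [/before_sub//|->].
have [h1 h2] : (forall n, `|p n x| <= M * exp_coeff O n) /\ (forall n, `|q n x| <= M * exp_coeff O n).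
  split=> n; have [_ _ /(_ x dx) [hp hq]] := term_bound Xd hM n.
    exact: le_trans (Ix n).
  exact: le_trans (Ix n).
by have [? ?] := key _ h1; have [? ?] := key _ h2; split.
Qed.

Let sint_cvg (r : smeasure R) D (g_ : nat -> R -> R) (g : R -> R) B : measurable D -> sfin r D ->
  (forall n, measurable_fun D (g_ n)) -> (forall x, D x -> g_ ^~ x @ \oo --> g x) ->
  (forall n x, D x -> `|g_ n x| <= B) ->
  (fun n => sint r D (g_ n)) @ \oo --> sint r D g.
Proof.
move=> mD [r1 r2] mg cg gB.
have one (mu : {measure set R -> \bar R}) : (mu D < +oo)%E ->
   (fun n => Rintegral mu D (g_ n)) @ \oo --> Rintegral mu D g.
  move=> muD.
  have iB : mu.-integrable D (EFin \o cst B).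
    apply: measurable_bounded_integrable => //.
    by exists `|B|; split => // M M1 x _ /=; rewrite ltW.
  have mlim : measurable_fun D g by apply: measurable_fun_cvg cg.
  have ig : mu.-integrable D (EFin \o g).
    apply: measurable_bounded_integrable => //.
    exists B; split; first exact: num_real.
    move=> M BM x Dx; rewrite /= (le_trans _ (ltW BM))//.
    by apply: cvg_norm_le (cg x Dx) => n; exact: gB.
  apply: fine_cvg; rewrite fineK; last by apply: integrable_fin_num.
  apply: (@dominated_cvg _ _ _ _ _ mD _ _ (EFin \o cst B)) => //.
  - by move=> n; exact/measurable_EFinP.
  - by move=> x Dx; apply: cvg_EFin; [near=> n|exact: cg].
by apply: cvgB; exact: one.
Unshelve. all: by end_near. Qed.

(** Integrating the n-th partial sum of one component gives the next partial sum of the other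
    without its initial term. The limit passes under the integral by dominated convergence, a
    constant being integrable on [before x]. *)
Lemma picard_spec :
  (forall d, X d -> [/\ measurable_fun (before d) picard_sol1, measurable_fun (before d) picard_sol2 &
     exists B, forall x, (before d x \/ x = d) -> `|picard_sol1 x| <= B /\ `|picard_sol2 x| <= B]) /\
  (forall x, X x -> picard_sol1 x = u0 x + sint s (before x) picard_sol2 /\
                    picard_sol2 x = v0 x + sint t (before x) picard_sol1).
Proof.
have ms d n : X d -> measurable_fun (before d) (fun x => series (fun n => p n x) n) /\
      measurable_fun (before d) (fun x => series (fun n => q n x) n).
  move=> Xd; have [M M0 hM] := bd Xd.
  by split; rewrite /series /=; apply: measurable_sum => i; have [] := term_bound Xd hM i.
split=> [d Xd|x Xx].
  have [M M0 hM] := bd Xd; have [B B0 hB] := partial_bound Xd hM M0.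
  split.
  - apply: (measurable_fun_cvg (h := fun n x => series (fun n => p n x) n)).
      by move=> n; have [] := ms d n Xd.
    by move=> x dx; have [] := hB x (or_introl dx).
  - apply: (measurable_fun_cvg (h := fun n x => series (fun n => q n x) n)).
      by move=> n; have [] := ms d n Xd.
    by move=> x dx; have [] := hB x (or_introl dx).
  exists B => x /hB [b1 b2 c1 c2].
  by split; [exact: cvg_norm_le c1|exact: cvg_norm_le c2].
have [M M0 hM] := bd Xx; have [B B0 hB] := partial_bound Xx hM M0.
have tb := term_bound Xx hM.
have isn n : (sintegrable s (before x) (p n) /\ sintegrable t (before x) (p n)) /\
  (sintegrable s (before x) (q n) /\ sintegrable t (before x) (q n)).
  have [mp mq h] := tb n.
  by split; apply: int_m => //; apply: (bounded_int (n := n) (M := M)) => //; try exact: iI;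
    move=> y dy; have [] := h y (or_introl dy).
have S1 n : series (fun n => p n x) n.+1 = u0 x + sint s (before x) (fun y => series (fun n => q n y) n).
  rewrite /series /= big_nat_recl//; congr (_ + _).
  elim: n => [|n IH].
    rewrite big_geq// (@eq_sint _ s _ _ (fun y => 0 * q 0%N y)); last by move=> y _; rewrite big_geq// mul0r.
    by rewrite (sintZl 0 (mb x) (isn 0%N).2.1) mul0r.
  rewrite big_nat_recr//= IH -sintD//.
  - by apply: eq_sint => y _; rewrite big_nat_recr.
  - elim: n {IH} => [|n IH].
      apply: eq_sintegrable (sintegrableZl 0 (mb x) (isn 0%N).2.1) => // y _.
      by rewrite big_geq// mul0r.
    apply: eq_sintegrable (sintegrableD (mb x) IH (isn n).2.1) => // y _.
    by rewrite big_nat_recr.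
  - exact: (isn n).2.1.
have S2 n : series (fun n => q n x) n.+1 = v0 x + sint t (before x) (fun y => series (fun n => p n y) n).
  rewrite /series /= big_nat_recl//; congr (_ + _).
  elim: n => [|n IH].
    rewrite big_geq// (@eq_sint _ t _ _ (fun y => 0 * p 0%N y)); last by move=> y _; rewrite big_geq// mul0r.
    by rewrite (sintZl 0 (mb x) (isn 0%N).1.2) mul0r.
  rewrite big_nat_recr//= IH -sintD//.
  - by apply: eq_sint => y _; rewrite big_nat_recr.
  - elim: n {IH} => [|n IH].
      apply: eq_sintegrable (sintegrableZl 0 (mb x) (isn 0%N).1.2) => // y _.
      by rewrite big_geq// mul0r.
    apply: eq_sintegrable (sintegrableD (mb x) IH (isn n).1.2) => // y _.
    by rewrite big_nat_recr.
  - exact: (isn n).1.2.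
have [b1 b2 c1 c2] := hB x (or_intror erefl).
split.
  have c1' : (fun n => series (fun n => p n x) n.+1) @ \oo --> picard_sol1 x.
  by move: c1; rewrite -cvg_shiftS.
rewrite -[LHS](cvg_lim (@norm_hausdorff _ R) c1'); apply: cvg_lim => //.
  under eq_fun do rewrite S1.
  apply: cvgD; first exact: cvg_cst.
  apply: (@sint_cvg s (before x) (fun n y => series (fun n => q n y) n) _ B) => //; first exact: fs.
  - by move=> n; have [] := ms x n Xx.
  - by move=> y xy; have [] := hB y (or_introl xy).
  - by move=> n y xy; have [] := hB y (or_introl xy).
have c2' : (fun n => series (fun n => q n x) n.+1) @ \oo --> picard_sol2 x.
  by move: c2; rewrite -cvg_shiftS.
rewrite -[LHS](cvg_lim (@norm_hausdorff _ R) c2'); apply: cvg_lim => //.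
under eq_fun do rewrite S2.
apply: cvgD; first exact: cvg_cst.
apply: (@sint_cvg t (before x) (fun n y => series (fun n => p n y) n) _ B) => //; first exact: ft.
- by move=> n; have [] := ms x n Xx.
- by move=> y xy; have [] := hB y (or_introl xy).
- by move=> n y xy; have [] := hB y (or_introl xy).
Unshelve. all: by end_near. Qed.

End picard.

Section more_signed.
Context (R : realType).
Implicit Types (s t : smeasure R) (D : set R) (f g : R -> R).

Definition sopp s := SMeasure (sneg s) (spos s).

Lemma sint_sopp s D f : sint (sopp s) D f = - sint s D f.
Proof. by rewrite /sint /= opprB. Qed.

Lemma sintegrable_bounded s D f (B : R) : measurable D -> sfin s D -> measurable_fun D f ->
  (forall x, D x -> `|f x| <= B) -> sintegrable s D f.
Proof.
move=> mD [f1 f2] mf fB.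
have bf : [bounded f x | x in D].
  exists B; split; first exact: num_real.
  by move=> M BM x Dx; rewrite /= (le_trans (fB x Dx))// ltW.
by split; exact: measurable_bounded_integrable.
Qed.

Lemma integrable_setU d (T : measurableType d) (mu : {measure set T -> \bar R}) (A B : set T) (f : T -> \bar R) :
  measurable A -> measurable B -> mu.-integrable A f -> mu.-integrable B f ->
  mu.-integrable (A `|` B) f.
Proof.
move=> mA mB /integrableP[mfA iA] iB.
have iBA : mu.-integrable (B `\` A) f by apply: integrableS iB => //; exact: measurableD.
have [mfB yB] := integrableP _ _ _ iBA.
have mU : measurable_fun (A `|` (B `\` A)) f.
  by apply/measurable_funU => //; exact: measurableD.
have -> : A `|` B = A `|` (B `\` A).
  apply/seteqP; split=> x; last by move=> [|[]]; [left|right].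
  by move=> [|Bx]; [left|have [Ax|nA] := pselect (A x); [left|right]].
apply/integrableP; split => //.
rewrite ge0_integral_setU//.
- exact: lte_add_pinfty.
- exact: measurableD.
- exact: measurableT_comp.
- by apply/disj_setPS => x [Ax [_ nA]].
Qed.

Lemma sintegrable_setU s (A B : set R) f : measurable A -> measurable B ->
  sintegrable s A f -> sintegrable s B f -> sintegrable s (A `|` B) f.
Proof. by move=> mA mB [a1 a2] [b1 b2]; split; exact: integrable_setU. Qed.

Lemma sint_set1 s x f : sint s [set x] f = f x * (fine (spos s [set x]) - fine (sneg s [set x])).
Proof.
have h (m : {measure set R -> \bar R}) : Rintegral m [set x] f = f x * fine (m [set x]).
  rewrite -[RHS]Rintegral_cst//; apply: eq_Rintegral => y; rewrite inE => ->//.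
by rewrite /sint !h mulrBr.
Qed.

Section off_atoms.
Context s t1 t2 D (mD : measurable D) (t1D : sfin t1 D) (t2D : sfin t2 D).
Context (st1 : sdisj s t1 D) (st2 : sdisj s t2 D).

Let off_null (m : {measure set R -> \bar R}) :
    (forall y, D y -> (spos t1 [set y] = 0%E \/ m [set y] = 0%E) /\
       (sneg t1 [set y] = 0%E \/ m [set y] = 0%E) /\
       (spos t2 [set y] = 0%E \/ m [set y] = 0%E) /\
       (sneg t2 [set y] = 0%E \/ m [set y] = 0%E)) ->
  exists N, [/\ measurable N, m N = 0%E & forall y, D y -> ~ N y ->
     [/\ spos t1 [set y] = 0%E, sneg t1 [set y] = 0%E,
     spos t2 [set y] = 0%E & sneg t2 [set y] = 0%E]].
Proof.
move: t1D t2D => [a1 a2] [b1 b2] h.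
have [|N1 [mN1 N10 hN1]] := @atoms_null _ m (spos t1) D mD a1; first by move=> y /h[].
have [|N2 [mN2 N20 hN2]] := @atoms_null _ m (sneg t1) D mD a2; first by move=> y /h[_ []].
have [|N3 [mN3 N30 hN3]] := @atoms_null _ m (spos t2) D mD b1; first by move=> y /h[_ [_ []]].
have [|N4 [mN4 N40 hN4]] := @atoms_null _ m (sneg t2) D mD b2; first by move=> y /h[_ [_ []]].
exists ((N1 `|` N2) `|` (N3 `|` N4)); split.
- by do 2 apply: measurableU => //; apply: measurableU.
- by apply: null_set_setU; try exact: measurableU; apply: null_set_setU.
- move=> x Dx nN; split;
    [apply: hN1|apply: hN2|apply: hN3|apply: hN4] => // nx; apply: nN;
    [left; left|left; right|right; left|right; right]; done.
Qed.

Let off_pos : exists N, [/\ measurable N, spos s N = 0%E & forall y, D y -> ~ N y ->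
     [/\ spos t1 [set y] = 0%E, sneg t1 [set y] = 0%E,
     spos t2 [set y] = 0%E & sneg t2 [set y] = 0%E]].
Proof.
apply: off_null => y Dy.
by have [[? ?]|[? ?]] := st1 Dy; have [[? ?]|[? ?]] := st2 Dy; do ![split]; by [left|right].
Qed.

Let off_neg : exists N, [/\ measurable N, sneg s N = 0%E & forall y, D y -> ~ N y ->
     [/\ spos t1 [set y] = 0%E, sneg t1 [set y] = 0%E,
     spos t2 [set y] = 0%E & sneg t2 [set y] = 0%E]].
Proof.
apply: off_null => y Dy.
by have [[? ?]|[? ?]] := st1 Dy; have [[? ?]|[? ?]] := st2 Dy; do ![split]; by [left|right].
Qed.

Context f g (mf : measurable_fun D f) (mg : measurable_fun D g).
Hypothesis fg : forall y, D y -> [/\ spos t1 [set y] = 0%E, sneg t1 [set y] = 0%E,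
     spos t2 [set y] = 0%E & sneg t2 [set y] = 0%E] -> f y = g y.

(** The exceptional points are atoms of [t1] or [t2], hence countably many and not charged by [s].
    This is what lets right limits be replaced by values in the backward initial value problem. *)
Lemma eq_sint_off_atoms : sint s D f = sint s D g.
Proof.
have [N1 [mN1 N10 h1]] := off_pos; have [N2 [mN2 N20 h2]] := off_neg.
rewrite /sint (eq_Rintegral_off mD mN1 N10 mf mg); last by move=> x Dx /(h1 _ Dx) /(fg Dx).
by rewrite (eq_Rintegral_off mD mN2 N20 mf mg)// => x Dx /(h2 _ Dx) /(fg Dx).
Qed.

Lemma sintegrable_off_atoms : sintegrable s D f -> sintegrable s D g.
Proof.
have mf' : measurable_fun D (EFin \o f) by exact/measurable_EFinP.
have mg' : measurable_fun D (EFin \o g) by exact/measurable_EFinP.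
have [N1 [mN1 N10 h1]] := off_pos; have [N2 [mN2 N20 h2]] := off_neg.
move=> [i1 i2]; split.
- apply/(negligible_integrable mN1 mD mg' N10).
  move/(negligible_integrable mN1 mD mf' N10): i1; apply: eq_integrable.
    exact: measurableD.
  by move=> x; rewrite inE /= => -[Dx /(h1 _ Dx)] /(fg Dx) ->.
- apply/(negligible_integrable mN2 mD mg' N20).
  move/(negligible_integrable mN2 mD mf' N20): i2; apply: eq_integrable.
    exact: measurableD.
  by move=> x; rewrite inE /= => -[Dx /(h2 _ Dx)] /(fg Dx) ->.
Qed.

End off_atoms.

End more_signed.

(** * Existence for the initial value problem *)

Section existence.
Context (R : realType) (a b : \bar R) (rho : pmeasure R) (vs chi : smeasure R).
Local Notation Iab := (Iab a b).

Lemma Iab_below x : Iab x -> exists2 y, Iab y & y < x.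
Proof.
rewrite /Defs.Iab /=; move=> [ax xb].
have [y [ay yx]] : exists y : R, (a < y%:E)%E /\ y < x.
  case: a ax => [r||]//.
  - by rewrite lte_fin => rx; exists ((r + x) / 2); rewrite lte_fin; split; lra.
  - by move=> _; exists (x - 1); split; [exact: ltNyr|lra].
by exists y => //; split => //; apply: lt_trans xb; rewrite lte_fin.
Qed.

Lemma Iab_above x : Iab x -> exists2 y, Iab y & x < y.
Proof.
rewrite /Defs.Iab /=; move=> [ax xb].
have [y [ay yx]] : exists y : R, (y%:E < b)%E /\ x < y.
  case: b xb => [r||]//.
  - by rewrite lte_fin => rx; exists ((r + x) / 2); rewrite lte_fin; split; lra.
  - by move=> _; exists (x + 1); split; [exact: ltry|lra].
by exists y => //; split => //; apply: lt_trans ax _; rewrite lte_fin.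
Qed.

Lemma measurable_Iab : measurable Iab.
Proof.
rewrite /Defs.Iab.
have -> : [set x : R | (a < x%:E)%E /\ (x%:E < b)%E] = EFin @^-1` (`]a, b[%classic).
  by apply/seteqP; split=> x /=; rewrite in_itv /= => /andP.
rewrite -[X in measurable X]setTI; apply: (EFin_measurable _) => //.
exact: emeasurable_itv.
Qed.

Hypotheses (fvs : slocfin a b vs) (fchi : slocfin a b chi) (frho : slocfin a b (posm rho)).
Hypotheses (dchi : sdisj vs chi Iab) (drho : sdisj vs (posm rho) Iab).
Context (h : R -> R) (ih : slocint_real a b (posm rho) h).
Context (c : R) (ic : Iab c) (d1 d2 : R).

(** Prepares the initial term for both directions: [e] is the sign of the varrho integral, -1
    forwards and 1 backwards. *)
Lemma primitive_data (X : set R) (k : R -> R) (e : R) : measurable X -> measurable_fun setT k ->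
  (forall x, X x -> (rho (before X k x) < +oo)%E /\ rho.-integrable (before X k x) (EFin \o h)) ->
  let v0 := fun x => d2 + e * Rintegral rho (before X k x) h in
  (forall d, X d -> measurable_fun (before X k d) v0) /\
  (forall d, X d -> exists2 M : R, 0 <= M & forall x, (before X k d x \/ x = d) ->
     `|d1| <= M /\ `|v0 x| <= M).
Proof.
move=> mX mk Xh v0; split=> d Xd; have [fd id] := Xh d Xd.
  by apply: measurable_funD => //; apply: measurable_funM => //; exact: measurable_primitive.
have I0 : 0 <= Rintegral rho (before X k d) (fun y => `|h y|) by exact: Rintegral_ge0.
exists (`|d1| + `|d2| + `|e| * Rintegral rho (before X k d) (fun y => `|h y|)).
  by rewrite !addr_ge0// mulr_ge0.
move=> x dx; split; first by rewrite -addrA lerDl addr_ge0// mulr_ge0.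
rewrite /v0 -addrA; apply: (@le_trans _ _ (`|d2| + `|e| * Rintegral rho (before X k d) (fun y => `|h y|))); last first.
  by rewrite lerDr.
apply: le_trans (ler_normD _ _) _; rewrite lerD2l normrM ler_wpM2l//.
have sub : before X k x `<=` before X k d by case: dx => [/before_sub//|->].
have mb := measurable_before mX mk.
apply: le_trans (le_normr_Rintegral _ _) _ => //; first exact: integrableS id.
rewrite /Rintegral fine_le//.
- apply: integrable_fin_num => //; apply: integrableS (integrable_norm id) => //.
- by apply: integrable_fin_num => //; exact: integrable_norm.
apply: ge0_subset_integral => //.
by have /measurable_int := integrable_norm id.
Qed.

Let forward : exists f f1 : R -> R, forall x, Iab x -> c <= x ->
  [/\ sintegrable vs (ico c x) f1, sintegrable chi (ico c x) f,
      f x = d1 + sint vs (ico c x) f1 &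
      f1 x = d2 + (sint chi (ico c x) f - sint (posm rho) (ico c x) h)].
Proof.
pose X := Iab `&` [set y | c <= y].
have mX : measurable X.
  by apply: measurableI; [exact: measurable_Iab|rewrite -set_itvcy].
have mk : measurable_fun setT (@idfun R) by exact: measurable_id.
have bE x : X x -> before X idfun x = ico c x.
  move=> [ix cx]; apply/seteqP; split=> y /=; first by move=> [yx [iy cy]]; apply/andP.
  move=> /andP[cy yx]; split => //; split => //; apply: (Iab_convex ic ix).
  by rewrite cy ltW.
have fv x : X x -> sfin vs (before X idfun x).
  by move=> Xx; rewrite bE//; exact: (slocfin_ico fvs ic (proj1 Xx)).
have fc x : X x -> sfin chi (before X idfun x).
  by move=> Xx; rewrite bE//; exact: (slocfin_ico fchi ic (proj1 Xx)).
have [m0 b0] : (forall d, X d -> measurable_fun (before X idfun d)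
     (fun x => d2 + (-1) * Rintegral rho (before X idfun x) h)) /\
  (forall d, X d -> exists2 M : R, 0 <= M & forall x, (before X idfun d x \/ x = d) ->
     `|d1| <= M /\ `|d2 + (-1) * Rintegral rho (before X idfun x) h| <= M).
  apply: primitive_data => // x Xx; rewrite bE//; split.
    by have [] := slocfin_ico frho ic (proj1 Xx).
  by have [] := slocint_ico ih ic (proj1 Xx).
have [P1 P2] := picard_spec mX mk fv fc (u0 := cst d1) (fun d _ => @measurable_cst _ _ _ _ _ d1) m0 b0.
set f := picard_sol1 _ _ _ _ _ _ in P1 P2; set f1 := picard_sol2 _ _ _ _ _ _ in P1 P2.
exists f, f1 => x ix cx; have Xx : X x by [].
have [mf mf1 [B hB]] := P1 x Xx; have [e1 e2] := P2 x Xx.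
have fcx := fc x Xx; have fvx := fv x Xx.
rewrite bE// in mf mf1 hB e1 e2 fcx fvx.
split => //.
- by apply: (@sintegrable_bounded _ _ _ _ B) => // y xy; have [] := hB y (or_introl xy).
- by apply: (@sintegrable_bounded _ _ _ _ B) => // y xy; have [] := hB y (or_introl xy).
- by rewrite e2 sint_posm; ring.
Qed.

Let ioo (x y : R) : set R := [set z | x < z < y].
Let mioo x y : measurable (ioo x y).
Proof. by rewrite /ioo -set_itvoo. Qed.

Let ico_ioo x y : x < y -> ico x y = [set x] `|` ioo x y.
Proof.
move=> xy; apply/seteqP; split=> z; rewrite /ico /ioo /=.
  by rewrite le_eqVlt => /andP[/predU1P[->|xz] zy]; [left|right; rewrite xz].
by move=> [->|/andP[xz zy]]; [rewrite lexx|rewrite ltW].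
Qed.

Let sint_ico_ioo s x y (g : R -> R) : x < y -> sintegrable s (ico x y) g ->
  sint s (ico x y) g = g x * (fine (spos s [set x]) - fine (sneg s [set x])) + sint s (ioo x y) g.
Proof.
move=> xy; rewrite ico_ioo// => ig; rewrite sint_setU ?sint_set1//.
by apply/disj_setPS => z [/= -> /andP[]]; rewrite ltxx.
Qed.

Let measurable_ico_primitive s x y (g : R -> R) : sfin s (ico x y) -> sintegrable s (ico x y) g ->
  measurable_fun (ico x y) (fun z => sint s (ico z y) g).
Proof.
move=> [s1 s2] ig; have [ig1 ig2] := ig.
have mX : measurable [set z : R | x <= z] by rewrite -set_itvcy.
have mk : measurable_fun setT (@idfun R) by exact: measurable_id.
have bE z : before [set z : R | x <= z] idfun z = ico x z.
  by apply/seteqP; split=> w; [move=> [wz xw]; apply/andP|move=> /andP[xw wz]].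
have m1 := measurable_primitive mX mk (mu := spos s) (psi := g) (d := y).
have m2 := measurable_primitive mX mk (mu := sneg s) (psi := g) (d := y).
rewrite bE in m1 m2.
apply: (@eq_measurable_fun _ _ _ _ _ (fun z => sint s (ico x y) g - (Rintegral (spos s) (before [set z : R | x <= z] idfun z) g
    - Rintegral (sneg s) (before [set z : R | x <= z] idfun z) g))).
  move=> z; rewrite inE => /andP[xz zy].
  by rewrite bE (sint_ico_split xz (ltW zy) ig) /sint; ring.
by apply: measurable_funB => //; apply: measurable_funB; [exact: m1|exact: m2].
Qed.

(* The equation at [x] involves the value at [x] itself through [x, c), so Picard iteration is run
   on the right limits, which only see (x, c); the atoms at [x] are added afterwards. *)
Let backward : exists f f1 : R -> R, forall x, Iab x -> x < c ->
  [/\ sintegrable vs (ico x c) f1, sintegrable chi (ico x c) f,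
      f x = d1 - sint vs (ico x c) f1 &
      f1 x = d2 - (sint chi (ico x c) f - sint (posm rho) (ico x c) h)].
Proof.
pose X := Iab `&` [set y | y < c].
have mX : measurable X.
  by apply: measurableI; [exact: measurable_Iab|rewrite -set_itvNyo].
have mk : measurable_fun setT (-%R : R -> R) by exact: oppr_measurable.
have bE x : X x -> before X -%R x = ioo x c.
  move=> [ix cx]; apply/seteqP; split=> y /=.
    by move=> [yx [iy cy]]; apply/andP; split => //; rewrite -ltrN2.
  move=> /andP[xy yc]; split; first by rewrite /= ltrN2.
  by split => //; apply: (Iab_convex ix ic); rewrite !ltW.
have subic x : ioo x c `<=` ico x c by move=> z /andP[xz zc]; rewrite /ico /= zc ltW.
have fin s x : slocfin a b s -> X x -> sfin s (ico x c).
  by move=> fs [ix xc]; exact: (slocfin_ico fs ix ic).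
have fv x : X x -> sfin (sopp vs) (before X -%R x).
  by move=> Xx; rewrite bE//; have [? ?] := sfinS (mioo x c) (measurable_ico x c) (@subic x) (fin vs x fvs Xx).
have fc x : X x -> sfin (sopp chi) (before X -%R x).
  by move=> Xx; rewrite bE//; have [? ?] := sfinS (mioo x c) (measurable_ico x c) (@subic x) (fin chi x fchi Xx).
have ihx x : X x -> sintegrable (posm rho) (ico x c) h.
  by move=> [ix _]; exact: (slocint_ico ih ix ic).
have [m0 b0] : (forall d, X d -> measurable_fun (before X -%R d)
     (fun x => d2 + 1 * Rintegral rho (before X -%R x) h)) /\
  (forall d, X d -> exists2 M : R, 0 <= M & forall x, (before X -%R d x \/ x = d) ->
     `|d1| <= M /\ `|d2 + 1 * Rintegral rho (before X -%R x) h| <= M).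
  apply: primitive_data => // x Xx; rewrite bE//; split.
    by have [] := sfinS (mioo x c) (measurable_ico x c) (@subic x) (fin _ x frho Xx).
  have [+ _] := ihx x Xx; apply: integrableS => //; exact: measurable_ico.
have [P1 P2] := picard_spec mX mk fv fc (u0 := cst d1) (fun d _ => @measurable_cst _ _ _ _ _ d1) m0 b0.
set v := picard_sol1 _ _ _ _ _ _ in P1 P2; set v1 := picard_sol2 _ _ _ _ _ _ in P1 P2.
have reg x : X x -> [/\ measurable_fun (ico x c) v, measurable_fun (ico x c) v1,
    sintegrable vs (ico x c) v1 & sintegrable chi (ico x c) v].
  (* The conclusions of [picard_spec] at y concern [(y, c)], which contains [[x, c)] because
     [y < x]. *)
  move=> Xx; have [ix xc] := Xx; have [y iy yx] := Iab_below ix.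
  have Xy : X y by split => //; exact: lt_trans xc.
  have [mv mv1 [B hB]] := P1 y Xy; rewrite bE// in mv mv1 hB.
  have sub : ico x c `<=` ioo y c.
    by move=> z /andP[xz zc]; rewrite /ioo /= zc (lt_le_trans yx).
  have mvx : measurable_fun (ico x c) v by exact: measurable_funS mv.
  have mv1x : measurable_fun (ico x c) v1 by exact: measurable_funS mv1.
  split => //.
  - apply: (@sintegrable_bounded _ _ _ _ B _ (fin _ _ fvs Xx) mv1x) => // z /sub xz.
    by have [] := hB z (or_introl xz).
  - apply: (@sintegrable_bounded _ _ _ _ B _ (fin _ _ fchi Xx) mvx) => // z /sub xz.
    by have [] := hB z (or_introl xz).
(* [v] and [v1] play the role of right limits, and [f], [f1] include the atoms at x. Then [f]
   differs from [v] only at atoms of varsigma, which chi does not charge, and [f1] from [v1] only at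
   atoms of chi or varrho, which varsigma does not charge. Hence the integrals of [v] and [v1] are
   those of [f] and [f1]. *)
pose f x := d1 - sint vs (ico x c) v1.
pose f1 x := d2 - (sint chi (ico x c) v - sint (posm rho) (ico x c) h).
have fE x : X x -> f x = v x - v1 x * (fine (spos vs [set x]) - fine (sneg vs [set x])).
  move=> Xx; have [_ _ i1 i2] := reg x Xx; have [e1 e2] := P2 x Xx; have [ix xc] := Xx.
  by rewrite /f sint_ico_ioo// e1 bE// sint_sopp /=; ring.
have f1E x : X x -> f1 x = v1 x - v x * (fine (spos chi [set x]) - fine (sneg chi [set x]))
     + h x * fine (rho [set x]).
  move=> Xx; have [_ _ i1 i2] := reg x Xx; have [e1 e2] := P2 x Xx; have [ix xc] := Xx.
  rewrite /f1 sint_ico_ioo// (sint_ico_ioo xc (ihx x Xx)) e2 bE// sint_sopp !sint_posm /=.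
  by rewrite /mzero /= subr0; ring.
have fv1 x : X x -> measurable_fun (ico x c) f.
  move=> Xx; have [_ _ i1 i2] := reg x Xx.
  by apply: measurable_funB => //; apply: measurable_ico_primitive => //; exact: fin.
have f1v1 x : X x -> measurable_fun (ico x c) f1.
  move=> Xx; have [_ _ i1 i2] := reg x Xx.
  apply: measurable_funB => //; apply: measurable_funB; apply: measurable_ico_primitive => //; try exact: fin.
  exact: ihx.
have dsub s t x : X x -> sdisj s t Iab -> sdisj s t (ico x c).
  by move=> [ix xc] st y xy; apply: st; apply: (Iab_convex ix ic); exact: ico_sub_icc.
have Xico x y : X x -> ico x c y -> X y.
  by move=> [ix xc] /andP[xy yc]; split => //; apply: (Iab_convex ix ic); rewrite xy ltW.
have dchi' : sdisj chi vs Iab by move=> y iy; have [] := dchi iy; [right|left].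
exists f, f1 => x ix xc; have Xx : X x by [].
have [mv mv1 i1 i2] := reg x Xx.
have s1 := dsub _ _ _ Xx dchi; have s2 := dsub _ _ _ Xx drho; have s3 := dsub _ _ _ Xx dchi'.
have e1 y : ico x c y -> [/\ spos chi [set y] = 0%E, sneg chi [set y] = 0%E,
     spos (posm rho) [set y] = 0%E & sneg (posm rho) [set y] = 0%E] -> v1 y = f1 y.
  move=> xy [z1 z2 z3 z4]; rewrite f1E; last exact: Xico xy.
  by rewrite z1 z2 /=; move: z3 => /= ->; rewrite /= subrr !mulr0 subr0 addr0.
have e2 y : ico x c y -> [/\ spos vs [set y] = 0%E, sneg vs [set y] = 0%E,
     spos vs [set y] = 0%E & sneg vs [set y] = 0%E] -> v y = f y.
  move=> xy [z1 z2 z3 z4]; rewrite fE; last exact: Xico xy.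
  by rewrite z1 z2 /= subrr !mulr0 subr0.
have mI := measurable_ico x c.
have gc := fin _ _ fchi Xx; have gr := fin _ _ frho Xx; have gv := fin _ _ fvs Xx.
have mfx := fv1 x Xx; have mf1x := f1v1 x Xx.
split.
- exact: (sintegrable_off_atoms mI gc gr s1 s2 mv1 mf1x e1 i1).
- exact: (sintegrable_off_atoms mI gv gv s3 s3 mv mfx e2 i2).
- by rewrite -(eq_sint_off_atoms mI gc gr s1 s2 mv1 mf1x e1).
- by rewrite -(eq_sint_off_atoms mI gv gv s3 s3 mv mfx e2).
Qed.

Lemma real_dtau_exists : exists f f1 : R -> R,
  [/\ real_dtau a b rho vs chi f f1 h, f c = d1 & f1 c = d2].
Proof.
have [ff [ff1 hf]] := forward; have [fb [fb1 hb]] := backward.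
pose f x := if x < c then fb x else ff x; pose f1 x := if x < c then fb1 x else ff1 x.
have fL y x : ico y c x -> fb x = f x by move=> /andP[_ xc]; rewrite /f xc.
have f1L y x : ico y c x -> fb1 x = f1 x by move=> /andP[_ xc]; rewrite /f1 xc.
have fR y x : ico c y x -> ff x = f x by move=> /andP[xc _]; rewrite /f ltNge xc.
have f1R y x : ico c y x -> ff1 x = f1 x by move=> /andP[xc _]; rewrite /f1 ltNge xc.
have R1 x : Iab x -> c <= x -> [/\ sintegrable vs (ico c x) f1, sintegrable chi (ico c x) f,
      f x = d1 + sint vs (ico c x) f1 &
      f1 x = d2 + (sint chi (ico c x) f - sint (posm rho) (ico c x) h)].
  move=> ix cx; have [i1 i2 e1 e2] := hf x ix cx; split.
  - exact: eq_sintegrable (@f1R x) i1.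
  - exact: eq_sintegrable (@fR x) i2.
  - by rewrite -(eq_sint _ (@f1R x)) -e1 /f ltNge cx.
  - by rewrite -(eq_sint _ (@fR x)) -e2 /f1 ltNge cx.
have L1 x : Iab x -> x <= c -> [/\ sintegrable vs (ico x c) f1, sintegrable chi (ico x c) f,
      f x = d1 - sint vs (ico x c) f1 &
      f1 x = d2 - (sint chi (ico x c) f - sint (posm rho) (ico x c) h)].
  move=> ix; rewrite le_eqVlt => /predU1P[->|xc].
    have [i1 i2] := R1 c ic (lexx c).
    by move: i1 i2; rewrite ico_eq0// !sint_set0 subrr !addr0 !subr0 => ? ? ? ?; split.
  have [i1 i2 e1 e2] := hb x ix xc; split.
  - exact: eq_sintegrable (@f1L x) i1.
  - exact: eq_sintegrable (@fL x) i2.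
  - by rewrite -(eq_sint _ (@f1L x)) -e1 /f xc.
  - by rewrite -(eq_sint _ (@fL x)) -e2 /f1 xc.
(* A compact interval is enlarged so as to straddle c; [d'] exceeds d strictly because [ico c d']
   must contain the right endpoint d. *)
have cov e d : Iab e -> Iab d -> exists e' d', [/\ Iab e', Iab d', e' <= c, c <= d' &
    icc e d `<=` ico e' c `|` ico c d'].
  move=> ie id; have [d' id' dd'] : exists2 d', Iab d' & Num.max c d < d'.
    by apply: Iab_above; case: (leP c d).
  exists (Num.min c e), d'; split => //.
  - by case: (leP c e).
  - by rewrite ge_min lexx.
  - by apply: ltW; apply: le_lt_trans dd'; rewrite le_max lexx.
  move=> z /andP[ez zd]; have [zc|cz] := ltP z c.
    by left; rewrite /ico /= zc andbT ge_min ez orbT.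
  by right; rewrite /ico /= cz; apply: le_lt_trans zd _; apply: le_lt_trans dd'; rewrite le_max lexx orbT.
have s1 : slocint_real a b vs f1.
  move=> e d ie id; have [e' [d' [ie' id' ec cd sub]]] := cov e d ie id.
  have [A1 _ _ _] := L1 _ ie' ec; have [A2 _ _ _] := R1 _ id' cd.
  have mU : measurable (ico e' c `|` ico c d') by apply: measurableU; exact: measurable_ico.
  exact: (sintegrableS (measurable_icc e d) mU sub
    (sintegrable_setU (measurable_ico _ _) (measurable_ico _ _) A1 A2)).
have s2 : slocint_real a b chi f.
  move=> e d ie id; have [e' [d' [ie' id' ec cd sub]]] := cov e d ie id.
  have [_ A1 _ _] := L1 _ ie' ec; have [_ A2 _ _] := R1 _ id' cd.
  have mU : measurable (ico e' c `|` ico c d') by apply: measurableU; exact: measurable_ico.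
  exact: (sintegrableS (measurable_icc e d) mU sub
    (sintegrable_setU (measurable_ico _ _) (measurable_ico _ _) A1 A2)).
have [_ _ fc f1c] := R1 c ic (lexx c).
rewrite ico_eq0// !sint_set0 subrr !addr0 in fc f1c.
exists f, f1; split => //; split => // e x ie ix ex.
have I1 := slocint_ico s1; have I2 := slocint_ico s2; have I3 := slocint_ico ih.
have [cx|xc] := leP c x; last first.
  have [_ _ -> ->] := L1 x ix (ltW xc); have [_ _ -> ->] := L1 e ie (le_trans ex (ltW xc)).
  rewrite !(@sint_ico_split _ _ _ e x c) ?(ltW xc)//; [|exact: I3|exact: I2|exact: I1].
  by split; ring.
have [_ _ -> ->] := R1 x ix cx.
have [ce|ec] := leP c e.
  have [_ _ -> ->] := R1 e ie ce.
  rewrite !(@sint_ico_split _ _ _ c e x)//; [|exact: I3|exact: I2|exact: I1].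
  by split; ring.
have [_ _ -> ->] := L1 e ie (ltW ec).
rewrite !(@sint_ico_split _ _ _ e c x) ?(ltW ec)//; [|exact: I3|exact: I2|exact: I1].
by split; ring.
Qed.

End existence.

(** * Limits at the endpoints *)

Section endpoint_filters.
Context (R : realType).
Implicit Types (a b : \bar R) (f : R -> R).

(** Sequences treat finite and infinite endpoints alike, and they are what dominated convergence
    works with. *)
Lemma at_left_end_cvgP a f (l : R) : a != +oo%E ->
  (forall u : nat -> R, (forall n, (a < (u n)%:E)%E) ->
     (forall y : R, (a < y%:E)%E -> \forall n \near \oo, u n < y) -> f \o u @ \oo --> l) ->
  f @ at_left_end a --> l.
Proof.
case: a => [r||]// _ h /=.
  apply/cvg_at_rightP => u [ru ur]; apply: h => [n|y]; rewrite ?lte_fin// => ry.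
  exact: cvgr_lt ur _ ry.
apply/cvg_ninftyP => u uN; apply: h => [n|y _]; first exact: ltNyr.
by move/cvgrNyPlt : uN; apply.
Qed.

Lemma at_right_end_cvgP b f (l : R) : b != -oo%E ->
  (forall u : nat -> R, (forall n, ((u n)%:E < b)%E) ->
     (forall y : R, (y%:E < b)%E -> \forall n \near \oo, y < u n) -> f \o u @ \oo --> l) ->
  f @ at_right_end b --> l.
Proof.
case: b => [r||]// _ h /=.
  apply/cvg_at_leftP => u [ru ur]; apply: h => [n|y]; rewrite ?lte_fin// => ry.
  exact: cvgr_gt ur _ ry.
apply/cvg_pinftyP => u uN; apply: h => [n|y _]; first exact: ltry.
by move/cvgryPgt : uN; apply.
Qed.

Lemma at_left_end_proper a : a != +oo%E -> ProperFilter (at_left_end a).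
Proof. by case: a => [r||]//= _; [exact: at_right_proper_filter|exact: proper_ninfty_nbhs]. Qed.

Lemma at_right_end_proper b : b != -oo%E -> ProperFilter (at_right_end b).
Proof. by case: b => [r||]//= _; [exact: at_left_proper_filter|exact: proper_pinfty_nbhs]. Qed.

Lemma near_at_left_end a b : (a < b)%E -> \forall x \near at_left_end a, Iab a b x.
Proof.
case: a => [r||]/=; last 2 first.
- by rewrite ltNge leey.
- case: b => [s||]// _.
  + near=> x; split; first exact: ltNyr.
    by rewrite lte_fin; near: x; exact: (nbhs_ninfty_lt (num_real _)).
  + by near=> x; split; [exact: ltNyr|exact: ltry].
case: b => [s||]//.
- rewrite lte_fin => rs; near=> x; split; rewrite lte_fin; near: x.
  + exact: nbhs_right_gt.
  + exact: nbhs_right_lt.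
- move=> _; near=> x; split; last exact: ltry.
  by rewrite lte_fin; near: x; exact: nbhs_right_gt.
Unshelve. all: by end_near. Qed.

Lemma near_at_right_end a b : (a < b)%E -> \forall x \near at_right_end b, Iab a b x.
Proof.
case: b => [r||]/=; last 2 first.
- case: a => [s||]// _.
  + near=> x; split; last exact: ltry.
    by rewrite lte_fin; near: x; exact: (nbhs_pinfty_gt (num_real _)).
  + by near=> x; split; [exact: ltNyr|exact: ltry].
- by rewrite ltNge leNye.
case: a => [s||]//.
- rewrite lte_fin => rs; near=> x; split; rewrite lte_fin; near: x.
  + exact: nbhs_left_gt.
  + exact: nbhs_left_lt.
- move=> _; near=> x; split; first exact: ltNyr.
  by rewrite lte_fin; near: x; exact: nbhs_left_lt.
Unshelve. all: by end_near. Qed.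

(** Dominated convergence with bound [|g|]. Points are only asked to lie eventually in [A n],
    because a sequence tending to an endpoint may oscillate and then the sets are not monotone. *)
Lemma Rintegral_exhaust d (T : measurableType d) (mu : {measure set T -> \bar R})
    (D : set T) (A : nat -> set T) (g : T -> R) :
  measurable D -> (forall n, measurable (A n)) -> (forall n, A n `<=` D) ->
  mu.-integrable D (EFin \o g) -> (forall x, D x -> \forall n \near \oo, A n x) ->
  (fun n => Rintegral mu (A n) g) @ \oo --> Rintegral mu D g.
Proof.
move=> mD mA AD ig h.
have E n : Rintegral mu (A n) g = Rintegral mu D (g \_ (A n)).
  by rewrite -Rintegral_mkcondr; congr (Rintegral mu _ g); apply/esym/setIidr.
under eq_fun do rewrite E.
have mg := measurable_int _ ig.
apply: fine_cvg; rewrite fineK; last exact: integrable_fin_num.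
apply: (@dominated_cvg _ _ _ _ _ mD _ _ (EFin \o (fun x => `|g x|))) => //.
- move=> n; apply/measurable_EFinP; apply/measurable_restrict => //.
  apply/measurable_EFinP; apply: measurable_funS mg => //.
- move=> x Dx; apply: cvg_near_cst.
  by apply: filterS (h x Dx) => n Anx; rewrite patchE mem_set.
- exact: integrable_norm.
- by move=> n x Dx; rewrite /= lee_fin patchE; case: ifP => //; rewrite normr0.
Qed.

Lemma Rintegral_at_left_end a (c : R) (mu : pmeasure R) (g : R -> R) : (a < c%:E)%E ->
  mu.-integrable (Iab a c%:E) (EFin \o g) ->
  (fun x => Rintegral mu (ico x c) g) @ at_left_end a --> Rintegral mu (Iab a c%:E) g.
Proof.
move=> ac ig; apply: at_left_end_cvgP; first by case: a ac {ig}.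
move=> u au ua; apply: Rintegral_exhaust => //.
- exact: measurable_Iab.
- by move=> n; exact: measurable_ico.
- move=> n x /andP[ux xc]; split; rewrite ?lte_fin//.
  by apply: lt_le_trans (au n) _; rewrite lee_fin.
- move=> x [ax xc]; have := ua x ax; apply: filterS => n ux.
  by rewrite /ico /= -lte_fin xc ltW.
Qed.

Lemma Rintegral_at_right_end b (c : R) (mu : pmeasure R) (g : R -> R) : (c%:E < b)%E ->
  let D := [set x : R | c <= x /\ (x%:E < b)%E] in
  mu.-integrable D (EFin \o g) ->
  (fun x => Rintegral mu (ico c x) g) @ at_right_end b --> Rintegral mu D g.
Proof.
move=> cb D ig; apply: at_right_end_cvgP; first by case: b cb {D ig}.
move=> u ub uy; apply: Rintegral_exhaust => //.
- have -> : D = EFin @^-1` (`[c%:E, b[%classic).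
    by apply/seteqP; split=> x; rewrite /D /= in_itv /= lee_fin => /andP.
  rewrite -[X in measurable X]setTI; apply: (EFin_measurable _) => //.
  exact: emeasurable_itv.
- by move=> n; exact: measurable_ico.
- move=> n x /andP[cx xu]; split => //.
  by apply: lt_trans (ub n); rewrite lte_fin.
- move=> x [cx xb]; have := uy x xb; apply: filterS => n ux.
  by rewrite /ico /= ux cx.
Qed.

End endpoint_filters.

Section one_sided_limits.
Context (R : realType) (a b : \bar R) (rho : pmeasure R) (vs chi : smeasure R).
Context (f f1 h : R -> R) (Hf : real_dtau a b rho vs chi f f1 h).

Lemma real_dtau_left x : Iab a b x -> f y @[y --> x^'-] --> f x.
Proof.
move=> ix; have [c ic cx] := Iab_below ix; have [s1 _ _ e] := Hf.
have [i1 i2] := slocint_ico s1 ic ix.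
have D : [set y : R | c <= y /\ (y%:E < x%:E)%E] = ico c x.
  by apply/seteqP; split=> y; rewrite /ico /= lte_fin; [move=> [-> ->]|move=> /andP].
have l1 := Rintegral_at_right_end (b := x%:E) (c := c) (mu := spos vs) (g := f1).
have l2 := Rintegral_at_right_end (b := x%:E) (c := c) (mu := sneg vs) (g := f1).
rewrite lte_fin /= D in l1 l2.
have [-> _] := e c x ic ix (ltW cx).
apply: (@cvg_trans _ ((fun y => f c + sint vs (ico c y) f1) @ x^'-)).
  apply: near_eq_cvg; near=> y; apply/esym.
  have cy : c <= y by near: y; exact: nbhs_left_ge.
  have yx : y < x by near: y; exact: nbhs_left_lt.
  by have [-> _] := e c y ic (Iab_convex ic ix (introT andP (conj cy (ltW yx)))) cy.
by apply: cvgD; [exact: cvg_cst|apply: cvgB; [exact: l1|exact: l2]].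
Unshelve. all: by end_near. Qed.

(** The interval [[x, d)] contains the atom at x, and the intervals [[y, d)] with [x < y] lose it;
    this is the jump from the value to the right limit. *)
Lemma real_dtau_right x : Iab a b x ->
  f y @[y --> x^'+] --> f x + f1 x * (fine (spos vs [set x]) - fine (sneg vs [set x])).
Proof.
move=> ix; have [d id xd] := Iab_above ix; have [s1 _ _ e] := Hf.
have ixd := slocint_ico s1 ix id.
have mI : measurable (Iab x%:E d%:E) by exact: measurable_Iab.
have split_x : ico x d = [set x] `|` Iab x%:E d%:E.
  apply/seteqP; split=> z; rewrite /ico /Iab /= !lte_fin.
    by rewrite le_eqVlt => /andP[/predU1P[->|xz] zd]; [left|right].
  by move=> [->|[xz zd]]; [rewrite lexx|rewrite ltW].
have [i1 i2] : sintegrable vs (Iab x%:E d%:E) f1.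
  by apply: sintegrableS ixd => //; rewrite split_x => z; right.
have l1 := Rintegral_at_left_end (a := x%:E) (c := d) (mu := spos vs) (g := f1).
have l2 := Rintegral_at_left_end (a := x%:E) (c := d) (mu := sneg vs) (g := f1).
rewrite lte_fin /= in l1 l2.
have -> : f x + f1 x * (fine (spos vs [set x]) - fine (sneg vs [set x])) =
   f d - sint vs (Iab x%:E d%:E) f1.
  have [-> _] := e x d ix id (ltW xd).
  rewrite split_x sint_setU -?split_x//.
    by rewrite sint_set1; ring.
  by apply/disj_setPS => z [/= ->] []; rewrite lte_fin ltxx.
apply: (@cvg_trans _ ((fun y => f d - sint vs (ico y d) f1) @ x^'+)).
  apply: near_eq_cvg; near=> y; apply/esym.
  have xy : x < y by near: y; exact: nbhs_right_gt.
  have yd : y <= d by near: y; exact: nbhs_right_le.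
  have iy : Iab a b y by apply: (Iab_convex ix id); rewrite ltW.
  by have [-> _] := e y d iy id yd; ring.
by apply: cvgB; [exact: cvg_cst|apply: cvgB; [exact: l1|exact: l2]].
Unshelve. all: by end_near. Qed.

End one_sided_limits.

(** * Solutions vanishing almost everywhere *)

Section support.
Context (R : realType) (a b : \bar R) (rho : pmeasure R).

Let nbh (x e : R) : set R := [set y : R | x - e < y < x + e] `&` Iab a b.

Let mnbh x e : measurable (nbh x e).
Proof.
apply: measurableI; last exact: measurable_Iab.
by rewrite -[X in measurable X](@set_itvoo _ R (x - e) (x + e)).
Qed.

Lemma not_supp_near x : Iab a b x -> ~ supp a b rho x ->
  exists2 e : R, 0 < e & rho (nbh x e) = 0%E.
Proof.
move=> ix nsx; apply: contrapT => h; apply: nsx; split=> // e e0.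
rewrite lt0e measure_ge0 andbT; apply/eqP => z; apply: h.
by exists e.
Qed.

Lemma supp_open_compl x : Iab a b x -> ~ supp a b rho x ->
  exists2 e : R, 0 < e & forall t, x - e < t < x + e -> ~ supp a b rho t.
Proof.
move=> ix /(not_supp_near ix)[e e0 z]; exists e => // t /andP[xt tx] [it /(_ (e - `|t - x|))].
have d0 : 0 < e - `|t - x| by rewrite subr_gt0 ltr_norml; apply/andP; split; lra.
move=> /(_ d0); apply/negP; rewrite -leNgt -z; apply: le_measure; rewrite ?inE//; first exact: mnbh.
move=> y [/andP[y1 y2] iy]; split => //; move: y1 y2.
by have [tx0|tx0] := ltP (t - x) 0; [rewrite ltr0_norm//|rewrite ger0_norm//] => ? ?; apply/andP; split; lra.
Qed.

(** Each point off the support lies in a null interval with rational endpoints; [F] enumerates these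
    countably many intervals. *)
Lemma negligible_compl_supp : rho.-negligible (Iab a b `\` supp a b rho).
Proof.
pose F n : set R := if @unpickle (rat * rat)%type n is Some (p, q) then
  (if `[< rho ([set y : R | ratr p < y < ratr q] `&` Iab a b) = 0%E >] then
   [set y : R | ratr p < y < ratr q] `&` Iab a b else set0) else set0.
have nF : rho.-negligible (\bigcup_n F n).
  apply: negligible_bigcup => n; rewrite /F; case: unpickle => [[p q]|]; last exact: negligible_set0.
  case: asboolP => [z|_]; last exact: negligible_set0.
  apply/negligibleP => //; apply: measurableI; last exact: measurable_Iab.
  by rewrite -[X in measurable X](@set_itvoo _ R (ratr p) (ratr q)).
apply: negligibleS nF => x [ix /(not_supp_near ix)[e e0 z]].
have /rat_in_itvoo[p /[!in_itv]/andP[xp px]] : x - e < x by lra.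
have /rat_in_itvoo[q /[!in_itv]/andP[xq qx]] : x < x + e by lra.
rewrite /= in xp px xq qx.
exists (pickle (p, q)); first exact: I.
rewrite /F pickleK; case: asboolP => [_|].
  by split=> //; apply/andP.
case; apply/eqP; rewrite -measure_le0 -z; apply: le_measure; rewrite ?inE.
- apply: measurableI; last exact: measurable_Iab.
  by rewrite -[X in measurable X](@set_itvoo _ R (ratr p) (ratr q)).
- exact: mnbh.
- by move=> y [/andP[y1 y2] iy]; split => //; apply/andP; split; lra.
Qed.

(** Otherwise a neighbourhood of s would be null, being covered by the points off the support, the
    points where f does not vanish and, if s is no atom, s itself. The last clause supplies zeros on
    one side of s. *)
Lemma supp_zero (f : R -> R) s e : {ae rho, forall x, Iab a b x -> f x = 0} ->
  supp a b rho s -> 0 < e -> exists t, [/\ s - e < t < s + e, supp a b rho t, f t = 0 &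
    (rho [set s] = 0%E -> t <> s)].
Proof.
move=> ae0 [is_ hs] e0; apply: contrapT => h.
have : rho.-negligible (nbh s e).
  have n1 := negligible_compl_supp.
  have n2 : rho.-negligible (if `[< rho [set s] = 0%E >] then [set s] else set0).
    by case: asboolP => z; [apply/negligibleP|exact: negligible_set0].
  apply: negligibleS (negligibleU ae0 (negligibleU n1 n2)) => t [st it].
  have [suppt|nst] := pselect (supp a b rho t); last by right; left.
  have [ft|nft] := pselect (f t = 0); last by left => /(_ it).
  right; right; case: asboolP => z.
    by apply: contrapT => ts; apply: h; exists t; split.
  by exfalso; apply: h; exists t; split.
move/(measure_negligible (mnbh s e)) => z.
by have := hs e e0; rewrite -/(nbh s e) z ltxx.
Qed.

End support.

Section vanishing.
Context (R : realType) (a b : \bar R) (vs : smeasure R).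
Context (fvs : slocfin a b vs) (P : set R) (mP : measurable P).
Hypotheses (P0 : sneg vs (P `&` Iab a b) = 0%E) (N0 : spos vs (Iab a b `\` P) = 0%E).
Context (s0 t0 : R) (g : R -> R).
Let D := ico s0 t0.
Hypotheses (DI : D `<=` Iab a b) (ig : sintegrable vs D g).
Hypothesis ig0 : forall s, s0 <= s -> s <= t0 -> sint vs (ico s t0) g = 0.

Let mD : measurable D. Proof. exact: measurable_ico. Qed.

(** The sets with vanishing integral form a lambda-system, and the rays, whose traces on D are
    intervals [[s, t0)] or empty, are a pi-system generating the Borel sets. *)
Lemma sint_borel_eq0 A : measurable A -> sint vs (A `&` D) g = 0.
Proof.
move=> mA.
have iA (B : set R) : measurable B -> sintegrable vs (B `&` D) g.
  by move=> mB; apply: sintegrableS ig => //; exact: measurableI.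
have PD : sint vs (setT `&` D) g = 0.
  rewrite setTI; have [st|ts] := leP s0 t0; first exact: ig0.
  by rewrite /D ico_eq0 ?sint_set0// ltW.
have mE : (@measurable _ R) = <<s @RGenCInfty.G R >> := RGenCInfty.measurableE R.
have mA' := mA; rewrite mE in mA'.
move: mA'; apply: (@dynkin_induction _ R (@RGenCInfty.G R) (fun A => sint vs (A `&` D) g = 0) mE) => //.
- move=> _ _ [x ->] [y ->]; exists (Num.max x y).
  apply/seteqP; split=> z /=; rewrite !in_itv /= !andbT ge_max.
    by move=> [-> ->].
  by move=> /andP[].
- move=> _ [x ->].
  have [tx|xt] := leP t0 (Num.max x s0).
    rewrite (_ : _ `&` _ = set0) ?sint_set0//; apply/seteqP; split=> z //= [].
    rewrite in_itv /= andbT => xz /andP[sz zt].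
    have : Num.max x s0 < t0 by rewrite gt_max (le_lt_trans xz zt) (le_lt_trans sz zt).
    by rewrite ltNge tx.
  rewrite (_ : _ `&` _ = ico (Num.max x s0) t0).
    by apply: ig0; [rewrite le_max lexx orbT|exact: ltW].
  apply/seteqP; split=> z; rewrite /D /ico /= in_itv /= andbT ge_max.
    by move=> [-> /andP[-> ->]].
  by move=> /andP[/andP[-> ->] ->].
- move=> S mS S0.
  have := PD; rewrite (_ : setT `&` D = (S `&` D) `|` (~` S `&` D)); last first.
    by rewrite -setIUl setUv.
  rewrite sint_setU ?S0 ?add0r//; try exact: measurableI.
  + by apply: measurableI => //; exact: measurableC.
  + by rewrite -setIUl setUv; exact: iA.
  + by apply/disj_setPS => x [[Sx _] [nS _]].
- move=> F mF tF F0.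
  pose A_ n := \big[setU/set0]_(k < n) F k `&` D.
  have mA_ n : measurable (A_ n).
    by apply: measurableI => //; exact: bigsetU_measurable.
  have A0 n : sint vs (A_ n) g = 0.
    elim: n => [|n IH]; first by rewrite /A_ big_ord0 set0I sint_set0.
    rewrite /A_ big_ord_recr /= setIUl sint_setU -?/(A_ n) ?IH ?F0 ?addr0//.
    + exact: measurableI.
    + by rewrite /A_ -setIUl; apply: iA; apply: measurableU => //; exact: bigsetU_measurable.
    + apply/disj_setPS => x [[+ _] [Fn _]]; rewrite -bigcup_mkord => -[k /= kn Fk].
      have /trivIsetP/(_ k n I I) := tF; rewrite neq_ltn kn => /(_ isT) e.
      by have : (F k `&` F n) x by []; rewrite e.
  have mU : measurable (\bigcup_k F k `&` D) by apply: measurableI => //; exact: bigcup_measurable.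
  have mUF : measurable (\bigcup_k F k) by exact: bigcup_measurable.
  have [i1 i2] := iA _ mUF.
  have sub n : A_ n `<=` \bigcup_k F k `&` D.
    by move=> x [+ Dx]; rewrite -bigcup_mkord => -[k _ Fk]; split => //; exists k.
  have ev x : (\bigcup_k F k `&` D) x -> \forall n \near \oo, A_ n x.
    move=> [[k _ Fk] Dx]; exists k.+1 => // n /= kn; split => //.
    by rewrite -bigcup_mkord; exists k.
  have c1 := Rintegral_exhaust mU mA_ sub i1 ev.
  have c2 := Rintegral_exhaust mU mA_ sub i2 ev.
  have c : (fun n => sint vs (A_ n) g) @ \oo --> sint vs (\bigcup_k F k `&` D) g by exact: cvgB.
  rewrite -(cvg_lim (@norm_hausdorff _ R) c); under eq_fun do rewrite A0.
  by rewrite lim_cst//; exact: norm_hausdorff.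
Qed.

(** On each side of the Hahn decomposition only one Jordan part is present, so all integrals of [g]
    against that part vanish and [g = 0] almost everywhere there. If [g] had no zero in D, both
    parts of D would be null. *)
Lemma sint_eq0_zero : svar vs D != 0%E -> exists2 t, D t & g t = 0.
Proof.
move=> nz; apply: contrapT => h.
have gne t : D t -> g t <> 0 by move=> Dt gt; apply: h; exists t.
move/eqP: nz; apply.
have sD := slocfin_ico fvs.
have kill (m : {measure set R -> \bar R}) (E : set R) : measurable E -> E `<=` D ->
    m.-integrable D (EFin \o g) ->
    (forall A, measurable A -> A `<=` E -> Rintegral m A g = 0) -> m E = 0%E.
  move=> mE ED im hE.
  have imE : m.-integrable E (EFin \o g) by exact: integrableS im.
  have := @integral_ae_eq _ _ _ m E mE (cst 0%E) (EFin \o g) imE (measurable_cst _).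
  case=> [A AE mA|N [mN N00 sub]].
    rewrite integral0 -(fineK (integrable_fin_num mA _)); last exact: integrableS imE.
    by have := hE A mA AE; rewrite /Rintegral /= => ->.
  apply/eqP; rewrite -measure_le0 -N00; apply: le_measure; rewrite ?inE//.
  move=> x Ex; apply: sub => /= /(_ Ex) [] gx.
  by apply: (gne x) => //; exact: ED.
have nullI (m : {measure set R -> \bar R}) (A B : set R) : measurable A -> measurable B -> A `<=` B -> m B = 0%E -> m A = 0%E.
  by move=> mA mB AB B0; apply/eqP; rewrite -measure_le0 -B0; apply: le_measure; rewrite ?inE.
have mI := @measurable_Iab R a b.
have zero (m : {measure set R -> \bar R}) (A : set R) : measurable A -> A `<=` D -> m.-integrable D (EFin \o g) ->
  m A = 0%E -> Rintegral m A g = 0.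
  move=> mA AD im A0; rewrite /Rintegral null_set_integral//.
  by apply: measurable_funS (measurable_int _ im).
have [i1 i2] := ig.
have p1 : spos vs (D `&` P) = 0%E.
  apply: kill => //; [exact: measurableI|move=> A mA AE].
  have AD : A `<=` D by move=> x /AE[].
  have := sint_borel_eq0 mA; rewrite (setIidl AD) /sint (zero (sneg vs)) ?subr0//.
  apply: (nullI _ _ _ mA (measurableI _ _ mP mI)) P0 => x /AE[Dx Px].
  by split => //; exact: DI.
have p2 : sneg vs (D `\` P) = 0%E.
  apply: kill => //; [exact: measurableD|move=> A mA AE].
  have AD : A `<=` D by move=> x /AE[].
  have := sint_borel_eq0 mA; rewrite (setIidl AD) /sint (zero (spos vs)) ?sub0r//.
    by move/eqP; rewrite oppr_eq0 => /eqP.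
  apply: (nullI _ _ _ mA (measurableD mI mP)) N0 => x /AE[Dx Px].
  by split => //; exact: DI.
have p3 : spos vs (D `\` P) = 0%E.
  apply: (nullI _ _ _ (measurableD mD mP) (measurableD mI mP)) N0 => x [Dx Px].
  by split => //; exact: DI.
have p4 : sneg vs (D `&` P) = 0%E.
  apply: (nullI _ _ _ (measurableI _ _ mD mP) (measurableI _ _ mP mI)) P0 => x [Dx Px].
  by split => //; exact: DI.
have DE : D = (D `&` P) `|` (D `\` P) by rewrite setUIDK.
rewrite /svar DE !null_set_setU ?adde0//; try exact: measurableI; exact: measurableD.
Qed.

End vanishing.

Section standing_facts.
Context (R : realType) (a b : \bar R) (rho : pmeasure R) (vs chi : smeasure R).

(** Mutual singularity excludes cancellation: at every point one of the two Jordan parts has no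
    mass. *)
Lemma satom_eq0 (s : smeasure R) x : jordan_locfin a b s -> Iab a b x -> satom s x = 0%E ->
  spos s [set x] = 0%E /\ sneg s [set x] = 0%E.
Proof.
move=> [_ _ [P [mP P0 N0]]] ix; rewrite /satom.
have mI := @measurable_Iab R a b.
have nullI (m : {measure set R -> \bar R}) (B : set R) : measurable B -> B x -> m B = 0%E -> m [set x] = 0%E.
  by move=> mB Bx B0; apply/eqP; rewrite -measure_le0 -B0; apply: le_measure; rewrite ?inE// => _ ->.
have [Px|nPx] := pselect (P x).
  have z : sneg s [set x] = 0%E by apply: nullI P0 => //; exact: measurableI.
  by rewrite z sube0.
have z : spos s [set x] = 0%E by apply: nullI N0 => //; exact: measurableD.
by rewrite z sub0e => /eqP; rewrite oppe_eq0 => /eqP.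
Qed.

Hypothesis st : standing a b rho vs chi.

Lemma standing_fin : [/\ slocfin a b vs, slocfin a b chi & slocfin a b (posm rho)].
Proof.
case: st => _ [fr [v1 v2 _] [c1 c2 _]] _ _ _.
by split=> c d ic id; split; [exact: v1|exact: v2|exact: c1|exact: c2|exact: fr|exact: ltry].
Qed.

Lemma standing_disj : sdisj vs chi (Iab a b) /\ sdisj vs (posm rho) (Iab a b).
Proof.
case: st => _ [fr jv jc] _ h _; split=> x ix; have [/eqP hr /eqP hc] := h x ix.
  move: hc; rewrite mule_eq0 => /orP[/eqP z|/eqP z]; [left|right]; exact: satom_eq0 z.
move: hr; rewrite mule_eq0 => /orP[/eqP z|/eqP z]; [left; exact: satom_eq0 z|right].
by split.
Qed.

Context (e e1 : R -> R) (He : real_dtau a b rho vs chi e e1 (fun=> 0)).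

Let left_zero z : Iab a b z -> (forall d, 0 < d -> exists t, z - d < t < z /\ e t = 0) -> e z = 0.
Proof.
move=> iz h; apply: contrapT => /eqP ne.
have [d /= d0 hd] := cvgr_neq0 (e z) (real_dtau_left He iz) ne.
have [t [/andP[dt tz] et]] := h d d0.
have := hd t; rewrite /ball_ /= => /(_ _ tz); rewrite et eqxx.
by move=> /(_ _)/negP; apply => //; rewrite ger0_norm; lra.
Qed.

Let right_zero z : Iab a b z -> (forall d, 0 < d -> exists t, z < t < z + d /\ e t = 0) ->
  e z + e1 z * (fine (spos vs [set z]) - fine (sneg vs [set z])) = 0.
Proof.
move=> iz h; apply: contrapT => /eqP ne.
have [d /= d0 hd] := cvgr_neq0 _ (real_dtau_right He iz) ne.
have [t [/andP[zt td] et]] := h d d0.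
have := hd t; rewrite /ball_ /= => /(_ _ zt); rewrite et eqxx.
by move=> /(_ _)/negP; apply => //; rewrite ltr0_norm; lra.
Qed.

(* Either the support of rho contains an interval, on which [e] vanishes by one-sided continuity,
   or it has a gap, to which the gap hypothesis applies. *)
Lemma ae0_interval : {ae rho, forall x, Iab a b x -> e x = 0} ->
  exists al be : R, [/\ Iab a b al, Iab a b be, al < be & forall t, al < t < be -> e t = 0].
Proof.
move=> ae0.
have dr := (standing_disj).2.
case: st => _ _ [[x [y [xy [sx sy]]]] _] _ gap.
wlog lxy : x y xy sx sy / x < y.
  move=> w; have [|] := ltP x y; first exact: w.
  by rewrite le_eqVlt => /predU1P[/esym//|yx]; apply: (w y x) => // /esym.
have [ix _] := sx; have [iy _] := sy.
have [[z [zxy nz]]|all_supp] := pselect (exists z, x < z < y /\ ~ supp a b rho z); last first.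
  exists x, y; split => // t /andP[xt ty].
  have it : Iab a b t by apply: (Iab_convex ix iy); rewrite !ltW.
  apply: left_zero => // d d0.
  (* The point [t - d' / 2] lies in the support, and a zero at distance less than [d' / 2] from it
     is still to the left of t. *)
  pose d' := Num.min d (t - x); have d'0 : 0 < d' by rewrite lt_min d0 subr_gt0.
  have d'd : d' <= d by rewrite ge_min lexx.
  have d'x : d' <= t - x by rewrite ge_min lexx orbT.
  have ss : supp a b rho (t - d' / 2).
    apply: contrapT => ns; apply: all_supp; exists (t - d' / 2); split => //.
    by apply/andP; split; lra.
  have d2 : 0 < d' / 2 by lra.
  have [u [/andP[u1 u2] _ eu _]] := supp_zero ae0 ss d2.
  by exists u; split => //; apply/andP; split; lra.
have iz : Iab a b z by apply: (Iab_convex ix iy); case/andP: zxy => *; rewrite !ltW.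
have /andP[xz zy] := zxy.
(* [sup A] and [inf B] are the endpoints of the gap of the support that contains z; they belong to
   the support since its complement is open. *)
pose A := [set t | supp a b rho t /\ t <= z]; pose B := [set t | supp a b rho t /\ z <= t].
have hA : has_sup A by split; [exists x; split => //; exact: ltW|exists z => t []].
have hB : has_inf B by split; [exists y; split => //; exact: ltW|exists z => t []].
have Aal t : A t -> t <= sup A by move=> At; exact: sup_upper_bound.
have Bbe t : B t -> inf B <= t by move=> Bt; apply: ge_inf => //; exact: hB.2.
have xal : x <= sup A by apply: Aal; split => //; exact: ltW.
have bey : inf B <= y by apply: Bbe; split => //; exact: ltW.
have alz : sup A <= z by apply: ge_sup; [exact: hA.1|move=> t []].
have zbe : z <= inf B by apply: lb_le_inf; [exact: hB.1|move=> t []].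
have ial : Iab a b (sup A) by apply: (Iab_convex ix iz); rewrite xal.
have ibe : Iab a b (inf B) by apply: (Iab_convex iz iy); rewrite zbe.
have sal : supp a b rho (sup A).
  apply: contrapT => /(supp_open_compl ial)[d d0 hd].
  have [t At tl] := sup_adherent d0 hA.
  apply: (hd t); last by case: At.
  by rewrite tl /= (le_lt_trans (Aal t At))// ltrDl.
have sbe : supp a b rho (inf B).
  apply: contrapT => /(supp_open_compl ibe)[d d0 hd].
  have [t Bt tl] := inf_adherent d0 hB.
  apply: (hd t); last by case: Bt.
  by rewrite tl andbT (lt_le_trans _ (Bbe t Bt))// ltrBlDr ltrDl.
have alz' : sup A < z.
  by rewrite lt_neqAle alz andbT; apply/eqP => E; apply: nz; rewrite -E.
have zbe' : z < inf B.
  by rewrite lt_neqAle zbe andbT; apply/eqP => E; apply: nz; rewrite E.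
have nogap t : sup A < t < inf B -> ~ supp a b rho t.
  move=> /andP[at_ tb] st_; have [tz|zt] := leP t z.
    by have := Aal t (conj st_ tz); rewrite leNgt at_.
  by have := Bbe t (conj st_ (ltW zt)); rewrite leNgt tb.
(* Zeros of [e] in the support accumulate at [sup A]. None lies in the gap, so either [sup A] is one
   itself or they approach from the left, where [e] is continuous. *)
have ealpha : e (sup A) = 0.
  have [//|ne] := pselect (e (sup A) = 0); apply: left_zero => // d d0.
  pose d' := Num.min d (inf B - sup A).
  have d'0 : 0 < d' by rewrite lt_min d0 subr_gt0 (lt_trans alz').
  have d'd : d' <= d by rewrite ge_min lexx.
  have d'x : d' <= inf B - sup A by rewrite ge_min lexx orbT.
  have [u [/andP[u1 u2] su eu _]] := supp_zero ae0 sal d'0.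
  exists u; split => //; apply/andP; split; first lra.
  rewrite ltNge; apply/negP; rewrite le_eqVlt => /predU1P[E|ult].
    by apply: ne; rewrite E.
  by apply: (nogap u) => //; apply/andP; split => //; lra.
(* At this end the gap hypothesis asks for the right limit. If [inf B] is no atom of varrho, zeros
   other than [inf B] approach it from the right. If it is one, [e] vanishes there and varsigma has
   no atom there, so there is no jump. *)
have ebeta : e (inf B) + e1 (inf B) * (fine (spos vs [set inf B]) - fine (sneg vs [set inf B])) = 0.
  have [rz|rnz] := pselect (rho [set inf B] = 0%E).
    apply: right_zero => // d d0.
    pose d' := Num.min d (inf B - sup A).
    have d'0 : 0 < d' by rewrite lt_min d0 subr_gt0 (lt_trans alz').
    have d'd : d' <= d by rewrite ge_min lexx.
    have d'x : d' <= inf B - sup A by rewrite ge_min lexx orbT.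
    have [u [/andP[u1 u2] su eu nu]] := supp_zero ae0 sbe d'0.
    exists u; split => //; apply/andP; split; last lra.
    rewrite ltNge; apply/negP; rewrite le_eqVlt => /predU1P[E|ult].
      exact: (nu rz).
    by apply: (nogap u) => //; apply/andP; split => //; lra.
  have -> : e (inf B) = 0.
    have [//|ne] := pselect (e (inf B) = 0); exfalso; apply: rnz.
    apply: measure_negligible => //; apply: negligibleS ae0 => _ -> /(_ ibe).
    exact: ne.
  have [[-> ->]|[z1 _]] := dr _ ibe; first by rewrite subrr mulr0 addr0.
  by exfalso; apply: rnz.
exists (sup A), (inf B); split => //; first exact: lt_trans zbe'.
have Hc : dtau a b rho vs chi (fun x => Complex (e x) 0) (fun x => Complex (e1 x) 0) (fun=> Complex 0 0).
  apply/dtau_realE; split; first exact: He.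
  have z0 s : slocint_real a b s (fun=> 0).
    by move=> c d ic id; split; exact: integrable0.
  by split => // c d ic id cd; rewrite !sint_posm /sint /Rintegral !integral0 /= !subrr !addr0.
have lt_ab : sup A < inf B by exact: lt_trans zbe'.
move=> t tab.
have ll : (fun x => complex.Re (Complex (e x) 0)) x @[x --> (sup A)^'-] --> (0 : R).
  by have := real_dtau_left He ial; rewrite ealpha.
have lr : (fun x => complex.Re (Complex (e x) 0)) x @[x --> (inf B)^'+] --> (0 : R).
  by have := real_dtau_right He ibe; rewrite ebeta.
have h := gap (sup A) (inf B) ial ibe lt_ab sal sbe nogap _ _ _ Hc ll (cvg_cst _) lr (cvg_cst _) t tab.
have F1 : Filter (sup A)^'- by exact: _.
have F2 : Filter (inf B)^'+ by exact: _.
by have := congr1 (@complex.Re R) (h F1 F2).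
Qed.

Lemma ae0_common_zero : {ae rho, forall x, Iab a b x -> e x = 0} ->
  exists t, [/\ Iab a b t, e t = 0 & e1 t = 0].
Proof.
move=> /ae0_interval[al [be [ia ib ab e0]]].
have [fvs _ _] := standing_fin.
case: (st) => _ [_ [_ _ [P [mP P0 N0]]] _] [_ sv] _ _.
have [i1 _ _ eq] := He.
(* The middle third has both endpoints inside the open interval on which [e] vanishes, so the
   increments of [e], which are integrals of [e1], vanish on it. *)
pose s0 := al + (be - al) / 3; pose t0 := al + (be - al) * (2 / 3).
have sal : al < s0 by rewrite /s0; lra.
have st0 : s0 < t0 by rewrite /s0 /t0; lra.
have tbe : t0 < be by rewrite /t0; lra.
have is0 : Iab a b s0 by apply: (Iab_convex ia ib); apply/andP; split; lra.
have it0 : Iab a b t0 by apply: (Iab_convex ia ib); apply/andP; split; lra.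
have DI : ico s0 t0 `<=` Iab a b by move=> x /ico_sub_icc; exact: Iab_convex.
have ig0 s : s0 <= s -> s <= t0 -> sint vs (ico s t0) e1 = 0.
  move=> ss st_; have is_ : Iab a b s by apply: (Iab_convex is0 it0); rewrite ss.
  have [+ _] := eq s t0 is_ it0 st_.
  rewrite !e0 ?add0r//; apply/andP; split; lra.
have nz : svar vs (ico s0 t0) != 0%E.
  pose m := (s0 + t0) / 2.
  have im : Iab a b m by apply: (Iab_convex is0 it0); apply/andP; split; rewrite /m; lra.
  have : ssupp a b vs m by rewrite sv.
  move=> [_ /(_ ((t0 - s0) / 2))]; rewrite divr_gt0 ?subr_gt0// => /(_ isT) pos.
  apply/eqP => z; move: pos; apply/negP; rewrite -leNgt -z /svar.
  have mN : measurable ([set y | m - (t0 - s0) / 2 < y < m + (t0 - s0) / 2] `&` Iab a b).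
    apply: measurableI; last exact: measurable_Iab.
    by rewrite -[X in measurable X](@set_itvoo _ R (m - (t0 - s0) / 2) (m + (t0 - s0) / 2)).
  have sub : [set y | m - (t0 - s0) / 2 < y < m + (t0 - s0) / 2] `&` Iab a b `<=` ico s0 t0.
    by move=> y [/andP[y1 y2] _]; rewrite /ico /=; apply/andP; split; rewrite /m in y1 y2; lra.
  by apply: leeD; apply: le_measure; rewrite ?inE//; exact: measurable_ico.
have [t Dt et] := sint_eq0_zero fvs mP P0 N0 DI (slocint_ico i1 is0 it0) ig0 nz.
by exists t; split => //; [exact: DI|apply: e0; case/andP: Dt => *; apply/andP; split; lra].
Qed.

End standing_facts.

(** * Square integrable solutions *)

Section square_integrable.
Context (R : realType) d (T : measurableType d) (mu : {measure set T -> \bar R}) (D : set T).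
Context (mD : measurable D).
Implicit Types u v : T -> R.

Definition realL2 u := measurable_fun D u /\ mu.-integrable D (fun x => (u x ^+ 2)%:E).

Lemma realL2M u v : realL2 u -> realL2 v -> mu.-integrable D (EFin \o (fun x => u x * v x)).
Proof.
move=> [mu_ iu] [mv iv].
apply: (@le_integrable _ _ _ _ _ _ _ (EFin \o (fun x => u x ^+ 2 + v x ^+ 2))) => //.
- by apply/measurable_EFinP; exact: measurable_funM.
- move=> x Dx /=; rewrite lee_fin [leRHS]ger0_norm ?addr_ge0 ?sqr_ge0//.
  rewrite normrM -(real_normK (num_real (u x))) -(real_normK (num_real (v x))).
  have := sqr_ge0 (`|u x| - `|v x|); have := normr_ge0 (u x); have := normr_ge0 (v x).
  move: `|u x| `|v x| => y z z0 y0 h; nra.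
- by have := integrableD mD iu iv; apply: eq_integrable.
Qed.

Lemma realL2D u v : realL2 u -> realL2 v -> realL2 (fun x => u x + v x).
Proof.
move=> hu hv; have iuv := realL2M hu hv; move: hu hv => [mu_ iu] [mv iv].
split; first exact: measurable_funD.
have := integrableD mD (integrableD mD iu iv) (integrableZl mD 2 iuv).
by apply: eq_integrable => // x _ /=; rewrite -EFinM -!EFinD; congr EFin; ring.
Qed.

Lemma realL2Z (k : R) u : realL2 u -> realL2 (fun x => k * u x).
Proof.
move=> [mu_ iu]; split; first exact: measurable_funM.
have := integrableZl mD (k ^+ 2) iu.
by apply: eq_integrable => // x _ /=; rewrite -EFinM; congr EFin; ring.
Qed.

Lemma realL2_bounded u v (B : R) : measurable_fun D v -> (forall x, D x -> `|v x| <= B) ->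
  realL2 u -> realL2 (fun x => u x * v x).
Proof.
move=> mv vB [mu_ iu]; split; first exact: measurable_funM.
apply: (@le_integrable _ _ _ _ _ _ _ (EFin \o (fun x => B ^+ 2 * u x ^+ 2))) => //.
- by apply/measurable_EFinP; apply: measurable_funX; exact: measurable_funM.
- move=> x Dx /=; have B2 : 0 <= B ^+ 2 * u x ^+ 2 by rewrite mulr_ge0// sqr_ge0.
  rewrite lee_fin [leLHS]ger0_norm ?sqr_ge0// [leRHS]ger0_norm//.
  rewrite exprMn mulrC ler_wpM2r ?sqr_ge0// -(real_normK (num_real (v x))).
  have := vB x Dx; have := normr_ge0 (v x); move: `|v x| => y y0 h; nra.
- by have := integrableZl mD (B ^+ 2) iu; apply: eq_integrable.
Qed.

Lemma realL2_integrable u : (mu D < +oo)%E -> realL2 u -> mu.-integrable D (EFin \o u).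
Proof.
move=> fD hu.
have h1 : realL2 (cst 1).
  split; first exact: measurable_cst.
  apply: (@measurable_bounded_integrable _ _ _ _ (cst (1 ^+ 2))) => //.
  by exists 1; split => // M M1 x _ /=; rewrite expr1n normr1 ltW.
by have := realL2M hu h1; apply: eq_integrable => // x _ /=; rewrite mulr1.
Qed.

Lemma realL2_cst0 : realL2 (cst 0).
Proof.
split; first exact: measurable_cst.
by apply: eq_integrable (integrable0 mu D) => // x _ /=; rewrite expr0n.
Qed.

Lemma realL2_ae u v : measurable_fun D v -> realL2 u -> {ae mu, forall x, D x -> u x = v x} -> realL2 v.
Proof.
move=> mv [mu_ iu] [N [mN N0 sub]]; split => //.
have mv2 : measurable_fun D (fun x => (v x ^+ 2)%:E) by apply/measurable_EFinP; exact: measurable_funX.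
have mu2 : measurable_fun D (fun x => (u x ^+ 2)%:E) by apply/measurable_EFinP; exact: measurable_funX.
apply/(negligible_integrable mN mD mv2 N0).
move/(negligible_integrable mN mD mu2 N0) : iu; apply: eq_integrable; first exact: measurableD.
move=> x; rewrite inE => -[Dx nN]; congr (EFin (_ ^+ 2)); apply: contrapT => ne; apply: nN; apply: sub => /=.
by move=> /(_ Dx).
Qed.

End square_integrable.

Lemma realL2_setU (R : realType) d (T : measurableType d) (mu : {measure set T -> \bar R}) (A B : set T) (u : T -> R) :
  measurable A -> measurable B -> realL2 mu A u -> realL2 mu B u -> realL2 mu (A `|` B) u.
Proof.
move=> mA mB [m1 i1] [m2 i2]; split; first exact/measurable_funU.
exact: integrable_setU.
Qed.

Lemma realL2S (R : realType) d (T : measurableType d) (mu : {measure set T -> \bar R}) (A B : set T) (u : T -> R) :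
  measurable A -> measurable B -> A `<=` B -> realL2 mu B u -> realL2 mu A u.
Proof.
move=> mA mB AB [m i]; split; first exact: measurable_funS m.
exact: integrableS i.
Qed.

Lemma L2on_realE (R : realType) (rho : pmeasure R) (D : set R) (f : R -> R[i]) : measurable D ->
  L2on rho D f <-> realL2 rho D (fun x => complex.Re (f x)) /\ realL2 rho D (fun x => complex.Im (f x)).
Proof.
move=> mD; split=> [[m1 m2 i]|[[m1 i1] [m2 i2]]].
  by split; split => //; (apply: (le_integrable mD _ _ i);
   [by apply/measurable_EFinP; exact: measurable_funX|
    move=> x Dx; rewrite lee_fin !ger0_norm ?addr_ge0 ?sqr_ge0// /sqn ?lerDl ?lerDr sqr_ge0]).
split => //; have := integrableD mD i1 i2; apply: eq_integrable => //.
Qed.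

(** The interval is the union of countably many compact ones with rational endpoints. *)
Lemma measurable_fun_Iab (R : realType) (a b : \bar R) (f : R -> R) :
  (forall c d, Iab a b c -> Iab a b d -> measurable_fun (icc c d) f) -> measurable_fun (Iab a b) f.
Proof.
move=> h.
pose F n : set R := if @unpickle (rat * rat)%type n is Some (p, q) then
  (if `[< Iab a b (ratr p) /\ Iab a b (ratr q) >] then icc (ratr p) (ratr q) else set0) else set0.
have -> : Iab a b = \bigcup_n F n.
  apply/seteqP; split=> [x ix|x [n _]]; last first.
    rewrite /F; case: unpickle => [[p q]|//]; case: asboolP => // -[ip iq].
    exact: Iab_convex.
  have [y iy yx] := Iab_below ix; have [z iz xz] := Iab_above ix.
  have [p] := rat_in_itvoo yx; rewrite in_itv /= => /andP[yp px].
  have [q] := rat_in_itvoo xz; rewrite in_itv /= => /andP[xq qz].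
  exists (pickle (p, q)); first exact: I.
  rewrite /F pickleK; case: asboolP => [_|]; first by rewrite /icc /= !ltW.
  case; split; [apply: (Iab_convex iy ix)|apply: (Iab_convex ix iz)]; by rewrite !ltW.
apply/measurable_fun_bigcup => n.
  rewrite /F; case: unpickle => [[p q]|//]; case: asboolP => // _; exact: measurable_icc.
rewrite /F; case: unpickle => [[p q]|]; last exact: measurable_fun_set0.
by case: asboolP => [[ip iq]|_]; [exact: h|exact: measurable_fun_set0].
Qed.

Lemma normr_Rintegral_subset (R : realType) d (T : measurableType d) (mu : {measure set T -> \bar R})
    (A B : set T) (f : T -> R) : measurable A -> measurable B -> A `<=` B ->
  mu.-integrable B (EFin \o f) ->
  `|Rintegral mu A f| <= Rintegral mu B (fun x => `|f x|).
Proof.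
move=> mA mB AB iB; have iA : mu.-integrable A (EFin \o f) by exact: integrableS iB.
apply: le_trans (le_normr_Rintegral _ _) _ => //.
rewrite /Rintegral fine_le//.
- by apply: integrable_fin_num => //; exact: integrable_norm.
- by apply: integrable_fin_num => //; exact: integrable_norm.
apply: ge0_subset_integral => //.
by have /measurable_int := integrable_norm iB.
Qed.

(** * Wronskians and the real fundamental system *)

Section boundary.
Context (R : realType) (a b : \bar R) (rho : pmeasure R) (vs chi : smeasure R).
Local Notation I := (Iab a b).
Local Notation sol := (real_dtau a b rho vs chi).

Lemma Iab_inhabited : (a < b)%E -> exists c, I c.
Proof.
move=> ab; have pf : ProperFilter (at_left_end a) by apply: at_left_end_proper; case: a ab => //; case: b.
by have [c ic] := @filter_ex _ _ pf _ (near_at_left_end ab); exists c.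
Qed.

Lemma real_dtau_lin (x y : R) f f1 h g g1 k : sol f f1 h -> sol g g1 k ->
  sol (fun t => x * f t + y * g t) (fun t => x * f1 t + y * g1 t) (fun t => x * h t + y * k t).
Proof.
move=> [a1 a2 a3 a4] [b1 b2 b3 b4].
have L s u v : slocint_real a b s u -> slocint_real a b s v -> slocint_real a b s (fun t => x * u t + y * v t).
  move=> hu hv c d ic id; apply: sintegrableD => //; apply: sintegrableZl => //; [exact: hu|exact: hv].
split; [exact: L|exact: L|exact: L|move=> c t ic it ct].
have E s u v : slocint_real a b s u -> slocint_real a b s v ->
    sint s (ico c t) (fun z => x * u z + y * v z) = x * sint s (ico c t) u + y * sint s (ico c t) v.
  move=> hu hv; have iu := slocint_ico hu ic it; have iv := slocint_ico hv ic it.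
  by rewrite sintD ?sintZl//; apply: sintegrableZl.
have [e1 e2] := a4 c t ic it ct; have [e3 e4] := b4 c t ic it ct.
by rewrite !E// e1 e2 e3 e4; split; ring.
Qed.

Lemma real_dtau_measurable f f1 h : sol f f1 h -> measurable_fun I f.
Proof.
move=> [_ s _ _]; apply: measurable_fun_Iab => c d ic id.
by have [/measurable_int/measurable_EFinP] := s c d ic id.
Qed.

Lemma real_dtau_bounded f f1 h c d : sol f f1 h -> I c -> I d ->
  exists B, forall x, icc c d x -> `|f x| <= B.
Proof.
move=> [s1 _ _ e] ic id.
have [i1 i2] := slocint_ico s1 ic id.
exists (`|f c| + (Rintegral (spos vs) (ico c d) (fun y => `|f1 y|) + Rintegral (sneg vs) (ico c d) (fun y => `|f1 y|))).
move=> x cxd; have /andP[cx xd] := cxd; have ix := Iab_convex ic id cxd.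
have [-> _] := e c x ic ix cx.
apply: le_trans (ler_normD _ _) _; rewrite lerD2l; apply: le_trans (ler_normB _ _) _.
have sub : ico c x `<=` ico c d.
  by move=> y /andP[cy yx]; rewrite /ico /= cy (lt_le_trans yx).
by apply: lerD; apply: normr_Rintegral_subset => //; exact: measurable_ico.
Qed.

Hypothesis st : standing a b rho vs chi.

Let ab : (a < b)%E. Proof. by case: st. Qed.
Let pfa : ProperFilter (at_left_end a).
Proof. by apply: at_left_end_proper; case: a ab => //; case: b. Qed.
Let pfb : ProperFilter (at_right_end b).
Proof. by apply: at_right_end_proper; case: b ab => //; case: a. Qed.

Lemma realL2_slocint h : realL2 rho I h -> slocint_real a b (posm rho) h.
Proof.
move=> hL c d ic id; apply/sintegrable_posm => //.
have [_ _ /(_ c d ic id) [fr _]] := standing_fin st.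
apply: realL2_integrable => //; first exact: measurable_icc.
by apply: (realL2S (measurable_icc c d) (@measurable_Iab R a b) _ hL) => x; exact: Iab_convex.
Qed.

Definition rW (f f1 g g1 : R -> R) x := f x * g1 x - f1 x * g x.

Lemma real_wronskian f f1 h g g1 k c d : sol f f1 h -> sol g g1 k -> I c -> I d -> c <= d ->
  rW f f1 g g1 d - rW f f1 g g1 c = Rintegral rho (ico c d) (fun y => h y * g y - f y * k y).
Proof.
have [fv fc fr] := standing_fin st; have [dc dr] := standing_disj st.
exact: real_lagrange.
Qed.

Lemma Rintegral_Iab_split (c : R) q : I c -> rho.-integrable I (EFin \o q) ->
  [/\ rho.-integrable (Iab a c%:E) (EFin \o q),
      rho.-integrable [set x : R | c <= x /\ (x%:E < b)%E] (EFin \o q) &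
  Rintegral rho I q = Rintegral rho (Iab a c%:E) q + Rintegral rho [set x : R | c <= x /\ (x%:E < b)%E] q].
Proof.
move=> ic iq; have [ac cb] := ic.
have m1 : measurable (Iab a c%:E) by exact: measurable_Iab.
have IE : I = Iab a c%:E `|` [set x : R | c <= x /\ (x%:E < b)%E].
  apply/seteqP; split=> x; rewrite /Iab /=.
    by move=> [ax xb]; have [xc|cx] := ltP x c; [left|right]; rewrite ?lte_fin.
  move=> [[ax xc]|[cx xb]]; split => //; first exact: lt_trans cb.
  by apply: lt_le_trans ac _; rewrite lee_fin.
have m2 : measurable [set x : R | c <= x /\ (x%:E < b)%E].
  have -> : [set x : R | c <= x /\ (x%:E < b)%E] = EFin @^-1` (`[c%:E, b[%classic).
    by apply/seteqP; split=> x; rewrite /= in_itv /= lee_fin => /andP.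
  rewrite -[X in measurable X]setTI; apply: (EFin_measurable _) => //.
  exact: emeasurable_itv.
have mI := @measurable_Iab R a b.
split.
- by apply: integrableS iq => //; rewrite IE => x; left.
- by apply: integrableS iq => //; rewrite IE => x; right.
rewrite {1}IE Rintegral_setU// -?IE//.
apply/disj_setPS => x [[_ xc] [cx _]]; move: xc; rewrite lte_fin => xc.
by move: (le_lt_trans cx xc); rewrite ltxx.
Qed.

Lemma real_wronskian_lim f f1 h g g1 k : sol f f1 h -> sol g g1 k ->
  realL2 rho I f -> realL2 rho I h -> realL2 rho I g -> realL2 rho I k ->
  exists la lb : R, [/\ rW f f1 g g1 @ at_left_end a --> la, rW f f1 g g1 @ at_right_end b --> lb &
    lb - la = Rintegral rho I (fun y => h y * g y - f y * k y)].
Proof.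
move=> Hf Hg Lf Lh Lg Lk; set q := fun y => h y * g y - f y * k y.
have mI := @measurable_Iab R a b.
have iq : rho.-integrable I (EFin \o q).
  by have := integrableB mI (realL2M mI Lh Lg) (realL2M mI Lf Lk); apply: eq_integrable.
have [c ic] := Iab_inhabited ab; have [ac cb] := ic.
have [i1 i2 eI] := Rintegral_Iab_split ic iq.
have fa := pfa; have fb := pfb.
exists (rW f f1 g g1 c - Rintegral rho (Iab a c%:E) q),
  (rW f f1 g g1 c + Rintegral rho [set x : R | c <= x /\ (x%:E < b)%E] q).
split; last by rewrite eI; ring.
- apply: (@cvg_trans _ ((fun x => rW f f1 g g1 c - Rintegral rho (ico x c) q) @ at_left_end a)).
    apply: near_eq_cvg; have := near_at_left_end ac; apply: filterS => x [ax xc].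
    have ix : I x by split => //; exact: lt_trans cb.
    rewrite lte_fin in xc.
    by rewrite -(real_wronskian Hf Hg ix ic (ltW xc)); ring.
  by apply: cvgB; [exact: cvg_cst|exact: Rintegral_at_left_end].
- apply: (@cvg_trans _ ((fun x => rW f f1 g g1 c + Rintegral rho (ico c x) q) @ at_right_end b)).
    apply: near_eq_cvg; have := near_at_right_end cb; apply: filterS => x [cx xb].
    have ix : I x by split => //; exact: lt_trans cx.
    rewrite lte_fin in cx.
    by rewrite -(real_wronskian Hf Hg ic ix (ltW cx)); ring.
  by apply: cvgD; [exact: cvg_cst|exact: Rintegral_at_right_end].
Qed.

Lemma real_sol_nonzero e e1 g g1 : sol e e1 (fun=> 0) -> realL2 rho I e ->
  (forall x, I x -> rW e e1 g g1 x != 0) -> 0 < Rintegral rho I (fun x => e x * e x).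
Proof.
move=> He Le hW; rewrite lt_neqAle Rintegral_ge0 ?andbT; last by move=> x _; exact: sqr_ge0.
apply/eqP => /esym z.
have mI := @measurable_Iab R a b.
have ie := realL2M mI Le Le.
have e0 : {ae rho, forall x, I x -> e x = 0}.
  have /(ae_eq_integral_abs rho mI (measurable_int _ ie)) : (\int[rho]_(x in I) `|(e x * e x)%R%:E| = 0)%E.
    under eq_integral do rewrite /= ger0_norm ?sqr_ge0//.
    by rewrite -(fineK (integrable_fin_num mI ie)); congr EFin.
  apply: filterS => x h ix; have := h ix => -[] /eqP.
  by rewrite mulf_eq0 orbb => /eqP.
have [t [it et e1t]] := ae0_common_zero st He e0.
by have := hW t it; rewrite /rW et e1t !mul0r subrr eqxx.
Qed.

Hypotheses (lcl : LC_left a b rho vs chi) (lcr : LC_right a b rho vs chi).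

(** The limit-circle condition at z = 0 covers neighbourhoods of both endpoints; on the compact
    interval in between, of finite measure, the solution is bounded. *)
Lemma sol_realL2 e e1 : sol e e1 (fun=> 0) -> realL2 rho I e.
Proof.
move=> He.
have z0 s : slocint_real a b s (fun=> 0).
  by move=> c d ic id; split; exact: integrable0.
have Hc : dtau a b rho vs chi (fun x => Complex (e x) 0) (fun x => Complex (e1 x) 0) (fun=> Complex 0 0).
  apply/dtau_realE; split; first exact: He.
  by split => // c d ic id cd; rewrite !sint_posm /sint /Rintegral !integral0 /= !subrr !addr0.
have hz : aeeq a b rho (fun=> Complex 0 0) (fun x => 0 * Complex (e x) 0).
  by apply: aeW => x ix; rewrite mul0r.
have [c [ic Lc]] := lcl Hc hz; have [d [id Ld]] := lcr Hc hz.
have m1 : measurable (Iaux_left a c).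
  have -> : Iaux_left a c = Iab a c%:E by apply/seteqP; split=> x; rewrite /Iab /Iaux_left /= lte_fin.
  exact: measurable_Iab.
have m2 : measurable (Iaux_right b d).
  have -> : Iaux_right b d = Iab d%:E b by apply/seteqP; split=> x; rewrite /Iab /Iaux_right /= lte_fin.
  exact: measurable_Iab.
have m3 : measurable (icc c d) by exact: measurable_icc.
have -> : I = (Iaux_left a c `|` icc c d) `|` Iaux_right b d.
  apply/seteqP; split=> x.
    move=> [ax xb]; have [xc|cx] := ltP x c; first by left; left.
    by have [dx|xd] := ltP d x; [right|left; right; rewrite /icc /= cx xd].
  have [ac cb] := ic; have [ad db] := id.
  move=> [[[ax xc]|]|[dx xb]]; last 1 first.
  - by split => //; apply: lt_trans ad _; rewrite lte_fin.
  - by split => //; apply: lt_trans cb; rewrite lte_fin.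
  - exact: Iab_convex.
have [[L1 _] [L2 _]] := ((L2on_realE _ _ m1).1 Lc, (L2on_realE _ _ m2).1 Ld).
apply: realL2_setU => //; first exact: measurableU.
apply: realL2_setU => //.
have [B hB] := real_dtau_bounded He ic id.
have [_ _ /(_ c d ic id) [fr _]] := standing_fin st.
have m : measurable_fun (icc c d) e.
  by have [_ s _ _] := He; have [/measurable_int/measurable_EFinP] := s c d ic id.
split => //; apply: measurable_bounded_integrable => //; first exact: measurable_funX.
exists (B ^+ 2); split; first exact: num_real.
move=> M BM x cxd; rewrite /= normrX; apply: le_trans (ltW BM).
by rewrite lerXn2r ?nnegrE// ?(le_trans _ (hB x cxd))//; exact: hB.
Qed.

Lemma fundamental_system : exists e e1 g g1 : R -> R,
  [/\ sol e e1 (fun=> 0), sol g g1 (fun=> 0), realL2 rho I e, realL2 rho I g &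
   [/\ forall x, I x -> rW e e1 g g1 x = 1, Rintegral rho I (fun x => e x * g x) = 0,
     0 < Rintegral rho I (fun x => e x * e x) & 0 < Rintegral rho I (fun x => g x * g x)]].
Proof.
have [fv fc fr] := standing_fin st; have [dc dr] := standing_disj st.
have [c ic] := Iab_inhabited ab.
have z0 : slocint_real a b (posm rho) (fun=> 0).
  by move=> c' d ic' id; split; exact: integrable0.
have [e [e1 [He ec e1c]]] := real_dtau_exists fv fc fr dc dr z0 ic 1 0.
have [u [u1 [Hu uc u1c]]] := real_dtau_exists fv fc fr dc dr z0 ic 0 1.
have Le := sol_realL2 He; have Lu := sol_realL2 Hu.
have mI := @measurable_Iab R a b.
have W1 x : I x -> rW e e1 u u1 x = 1.
  have Wc : rW e e1 u u1 c = 1 by rewrite /rW ec e1c uc u1c; ring.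
  have z s t : Rintegral rho (ico s t) (fun y => 0 * u y - e y * 0) = 0.
    rewrite (@eq_Rintegral _ _ _ _ _ (cst 0)); last by move=> y _; rewrite mul0r mulr0 subrr.
    by rewrite Rintegral_cst ?mul0r//; exact: measurable_ico.
  move=> ix; have [cx|/ltW xc] := leP c x.
    by have := real_wronskian He Hu ic ix cx; rewrite z Wc => /eqP; rewrite subr_eq0 => /eqP.
  by have := real_wronskian He Hu ix ic xc; rewrite z Wc => /eqP; rewrite subr_eq0 => /eqP.
have ne : 0 < Rintegral rho I (fun x => e x * e x).
  by apply: (real_sol_nonzero (g := u) (g1 := u1) He Le) => x ix; rewrite W1// oner_neq0.
(* The Gram-Schmidt coefficient. Subtracting a multiple of [e] from [u] leaves the Wronskian with
   [e] equal to 1. *)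
pose l := Rintegral rho I (fun x => e x * u x) / Rintegral rho I (fun x => e x * e x).
pose g x := 1 * u x + (- l) * e x; pose g1 x := 1 * u1 x + (- l) * e1 x.
have Hg : sol g g1 (fun=> 0).
  by have := real_dtau_lin 1 (- l) Hu He; rewrite !mulr0 addr0.
have Lg := sol_realL2 Hg.
have Wg x : I x -> rW e e1 g g1 x = 1 by move=> ix; rewrite -(W1 x ix) /rW /g /g1; ring.
exists e, e1, g, g1; split => //; split => //.
  have -> : (fun x => e x * g x) = (fun x => e x * u x + (- l) * (e x * e x)).
    by apply/funext => x; rewrite /g; ring.
  have ieu := realL2M mI Le Lu; have iee := realL2M mI Le Le.
  rewrite RintegralD//; last by have := integrableZl mI (- l) iee; apply: eq_integrable.
  rewrite RintegralZl// /l mulNr divfK ?subrr//; exact: lt0r_neq0.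
apply: (real_sol_nonzero (g := e) (g1 := e1) Hg Lg) => x ix.
by have := Wg x ix; rewrite /rW => h; apply/eqP => h'; lra.
Qed.

Context (e e1 g g1 : R -> R) (He : sol e e1 (fun=> 0)) (Hg : sol g g1 (fun=> 0)).
Context (Le : realL2 rho I e) (Lg : realL2 rho I g) (W1 : forall x, I x -> rW e e1 g g1 x = 1).

(** The increments of the Wronskian are integrals of [h * u], a product of two square integrable
    functions. *)
Let wronskian_bounded f f1 h u u1 : sol f f1 h -> realL2 rho I h -> sol u u1 (fun=> 0) -> realL2 rho I u ->
  exists B, forall x, I x -> `|rW f f1 u u1 x| <= B.
Proof.
move=> Hf Lh Hu Lu; have [c ic] := Iab_inhabited ab.
have mI := @measurable_Iab R a b.
have ihu := realL2M mI Lh Lu.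
exists (`|rW f f1 u u1 c| + Rintegral rho I (fun y => `|h y * u y|)) => x ix.
have key s t : I s -> I t -> s <= t -> `|rW f f1 u u1 t - rW f f1 u u1 s| <= Rintegral rho I (fun y => `|h y * u y|).
  move=> is_ it st_; rewrite (real_wronskian Hf Hu is_ it st_).
  have mst : measurable (ico s t) by exact: measurable_ico.
  have sub : ico s t `<=` I by move=> y /ico_sub_icc; exact: Iab_convex.
  rewrite (@eq_Rintegral _ _ _ _ _ (fun y => h y * u y)); last by move=> y _; rewrite mulr0 subr0.
  exact: normr_Rintegral_subset.
rewrite -lerBlDl; apply: le_trans (lerB_dist _ _) _.
have [cx|/ltW xc] := leP c x; first exact: key.
by rewrite distrC; exact: key.
Qed.

(** Variation of constants: f = e W(f,g) - g W(f,e), where [e] and [g] are square integrable and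
    both Wronskians are bounded. *)
Lemma real_dtau_realL2 f f1 h : sol f f1 h -> realL2 rho I h -> realL2 rho I f.
Proof.
move=> Hf Lh; have mI := @measurable_Iab R a b.
have fE x : I x -> e x * rW f f1 g g1 x + (- 1) * (g x * rW f f1 e e1 x) = f x.
  by move=> ix; rewrite -[RHS]mulr1 -[X in _ = _ * X](W1 ix) /rW; ring.
have mW u u1 : sol u u1 (fun=> 0) -> measurable_fun I (rW f f1 u u1).
  have m1 s s1 k : sol s s1 k -> measurable_fun I s1.
    move=> [s1' _ _ _]; apply: measurable_fun_Iab => c d ic id.
    by have [/measurable_int/measurable_EFinP] := s1' c d ic id.
  move=> Hu; apply: measurable_funB; apply: measurable_funM;
    [exact: real_dtau_measurable Hf|exact: m1 Hu|exact: m1 Hf|exact: real_dtau_measurable Hu].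
have [B1 h1] := wronskian_bounded Hf Lh Hg Lg; have [B2 h2] := wronskian_bounded Hf Lh He Le.
have [m i] := realL2D mI (realL2_bounded mI (mW _ _ Hg) h1 Le)
  (realL2Z mI (-1) (realL2_bounded mI (mW _ _ He) h2 Lg)).
split; first exact: real_dtau_measurable Hf.
by apply: eq_integrable i => // x; rewrite inE => /fE ->.
Qed.

Lemma real_dtau_inhomogeneous h : realL2 rho I h -> exists f f1, sol f f1 h /\ realL2 rho I f.
Proof.
move=> Lh; have [fv fc fr] := standing_fin st; have [dc dr] := standing_disj st.
have [c ic] := Iab_inhabited ab.
have [f [f1 [Hf _ _]]] := real_dtau_exists fv fc fr dc dr (realL2_slocint Lh) ic 0 0.
by exists f, f1; split => //; exact: real_dtau_realL2 Hf Lh.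
Qed.

End boundary.

(** * Boundary values of complex functions *)

Section complex_limits.
Context (R : realType) (fl : set_system R) (pf : ProperFilter fl).
Implicit Types F G : R -> R[i].

Definition ccvg F (l : R[i]) : Prop :=
  (fun x => complex.Re (F x)) @ fl --> complex.Re l /\
  (fun x => complex.Im (F x)) @ fl --> complex.Im l.

Lemma ccvg_clim F l : ccvg F l -> clim F fl = l.
Proof.
move=> [c1 c2]; rewrite /clim; case: l c1 c2 => l1 l2 /= c1 c2.
by rewrite (cvg_lim (@norm_hausdorff _ R) c1) (cvg_lim (@norm_hausdorff _ R) c2).
Qed.

Lemma ccvg_unique F l l' : ccvg F l -> ccvg F l' -> l = l'.
Proof. by move=> /ccvg_clim <- /ccvg_clim. Qed.

Lemma ccvg_near F G l : (\forall x \near fl, F x = G x) -> ccvg F l -> ccvg G l.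
Proof.
move=> FG [c1 c2]; split.
  by apply: cvg_trans c1; apply: near_eq_cvg; apply: filterS FG => x /= ->.
by apply: cvg_trans c2; apply: near_eq_cvg; apply: filterS FG => x /= ->.
Qed.

Lemma ccvg_cst (z : R[i]) : ccvg (cst z) z.
Proof. by split; exact: cvg_cst. Qed.

Lemma ccvgD F G l m : ccvg F l -> ccvg G m -> ccvg (fun x => F x + G x) (l + m).
Proof.
move=> [f1 f2] [g1 g2]; split.
  have -> : (fun x => complex.Re (F x + G x)) = (fun x => complex.Re (F x) + complex.Re (G x)).
    by apply/funext => x; case: (F x) (G x) => ? ? [].
  have -> : complex.Re (l + m) = complex.Re l + complex.Re m by case: l m {f1 f2 g1 g2} => ? ? [].
  exact: cvgD.
have -> : (fun x => complex.Im (F x + G x)) = (fun x => complex.Im (F x) + complex.Im (G x)).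
  by apply/funext => x; case: (F x) (G x) => ? ? [].
have -> : complex.Im (l + m) = complex.Im l + complex.Im m by case: l m {f1 f2 g1 g2} => ? ? [].
exact: cvgD.
Qed.

Lemma ccvgM F G l m : ccvg F l -> ccvg G m -> ccvg (fun x => F x * G x) (l * m).
Proof.
move=> [f1 f2] [g1 g2]; split.
  have -> : (fun x => complex.Re (F x * G x)) =
      (fun x => complex.Re (F x) * complex.Re (G x) - complex.Im (F x) * complex.Im (G x)).
    by apply/funext => x; case: (F x) (G x) => ? ? [].
  have -> : complex.Re (l * m) = complex.Re l * complex.Re m - complex.Im l * complex.Im m.
    by case: l m {f1 f2 g1 g2} => ? ? [].
  by apply: cvgB; exact: cvgM.
have -> : (fun x => complex.Im (F x * G x)) =
    (fun x => complex.Re (F x) * complex.Im (G x) + complex.Im (F x) * complex.Re (G x)).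
  by apply/funext => x; case: (F x) (G x) => ? ? [].
have -> : complex.Im (l * m) = complex.Re l * complex.Im m + complex.Im l * complex.Re m.
  by case: l m {f1 f2 g1 g2} => ? ? [].
by apply: cvgD; exact: cvgM.
Qed.

Lemma ccvg_conj F l : ccvg F l -> ccvg (fun x => conjc (F x)) (conjc l).
Proof.
move=> [f1 f2]; split.
  have -> : (fun x => complex.Re (conjc (F x))) = (fun x => complex.Re (F x)).
    by apply/funext => x; case: (F x).
  by case: l f1 {f2}.
have -> : (fun x => complex.Im (conjc (F x))) = (fun x => - complex.Im (F x)).
  by apply/funext => x; case: (F x).
have -> : complex.Im (conjc l) = - complex.Im l by case: l {f1 f2}.
exact: cvgN.
Qed.

End complex_limits.

(* A function of the maximal domain, together with its quasi-derivative and its image under tau. *)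
Record elt (R : realType) := Elt { ef : R -> R[i]; ef1 : R -> R[i]; eh : R -> R[i] }.

Section elements.
Context (R : realType).
Implicit Types t s u v : elt R.

Definition wr t s := Wr (ef t) (ef1 t) (ef s) (ef1 s).
Definition econj t := Elt (cconj (ef t)) (cconj (ef1 t)) (cconj (eh t)).
Definition elin (x : R[i]) t (y : R[i]) s := Elt (fun z => x * ef t z + y * ef s z)
  (fun z => x * ef1 t z + y * ef1 s z) (fun z => x * eh t z + y * eh s z).
Definition ereal_elt (f f1 : R -> R) : elt R :=
  Elt (fun x => Complex (f x) 0) (fun x => Complex (f1 x) 0) (fun=> Complex 0 0).

Context (fl : set_system R) (pf : ProperFilter fl) (P : elt R -> Prop).
(** The filter and the class of elements are parameters, so that each identity is proved once for
    both endpoints. *)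
Definition wlim t s := clim (wr t s) fl.
Hypothesis cv : forall t s, P t -> P s -> ccvg fl (wr t s) (wlim t s).

Lemma wlim_antisym t s : P t -> P s -> wlim s t = - wlim t s.
Proof.
move=> Pt Ps; apply: ccvg_clim; rewrite -mulN1r.
apply: (@ccvg_near _ _ _ (fun x => -1 * wr t s x)); last first.
  by apply: ccvgM; [exact: ccvg_cst|exact: cv].
by apply: nearW => x; rewrite /wr /Wr; ring.
Qed.

Lemma wlim_plucker t s u v : P t -> P s -> P u -> P v ->
  wlim t s * wlim u v = wlim t u * wlim s v - wlim t v * wlim s u.
Proof.
move=> Pt Ps Pu Pv.
apply: (@ccvg_unique _ fl pf (fun x => wr t s x * wr u v x)).
  by apply: ccvgM; exact: cv.
apply: (@ccvg_near _ _ _ (fun x => wr t u x * wr s v x + -1 * (wr t v x * wr s u x))).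
  by apply: nearW => x; rewrite /wr /Wr; ring.
rewrite -[X in _ + X]mulN1r; apply: ccvgD; first by apply: ccvgM; exact: cv.
by apply: ccvgM; [exact: ccvg_cst|apply: ccvgM; exact: cv].
Qed.

Lemma wlim_conj t s : P t -> P s -> wlim (econj t) (econj s) = conjc (wlim t s).
Proof.
move=> Pt Ps; apply: ccvg_clim.
apply: (@ccvg_near _ _ _ (fun x => conjc (wr t s x))); last by apply: ccvg_conj; exact: cv.
by apply: nearW => x; rewrite /wr /Wr /econj /cconj /= rmorphB !rmorphM.
Qed.

Lemma wlim_lin x t y s u : P t -> P s -> P u ->
  wlim (elin x t y s) u = x * wlim t u + y * wlim s u.
Proof.
move=> Pt Ps Pu; apply: ccvg_clim.
apply: (@ccvg_near _ _ _ (fun z => x * wr t u z + y * wr s u z)).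
  by apply: nearW => z; rewrite /wr /Wr /elin /=; ring.
by apply: ccvgD; apply: ccvgM; try exact: ccvg_cst; exact: cv.
Qed.

(** The boundary behaviour of an element is thus encoded by the two numbers [wlim t E] and
    [wlim t G], in which the Wronskian is a determinant. *)
Lemma wlim_basis E G t s : P E -> P G -> wlim E G = 1 -> P t -> P s ->
  wlim t s = wlim t E * wlim s G - wlim t G * wlim s E.
Proof. by move=> PE PG W1 Pt Ps; rewrite -wlim_plucker// W1 mulr1. Qed.

End elements.

Section complex_integral.
Context (R : realType) (rho : pmeasure R) (D : set R) (mD : measurable D).
Implicit Types F G : R -> R[i].

Definition cintegrable F : Prop :=
  rho.-integrable D (EFin \o (fun x => complex.Re (F x))) /\
  rho.-integrable D (EFin \o (fun x => complex.Im (F x))).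

Let Re_add (z w : R[i]) : complex.Re (z + w) = complex.Re z + complex.Re w.
Proof. by case: z w => ? ? []. Qed.
Let Im_add (z w : R[i]) : complex.Im (z + w) = complex.Im z + complex.Im w.
Proof. by case: z w => ? ? []. Qed.
Let Re_mul (z w : R[i]) : complex.Re (z * w) = complex.Re z * complex.Re w - complex.Im z * complex.Im w.
Proof. by case: z w => ? ? []. Qed.
Let Im_mul (z w : R[i]) : complex.Im (z * w) = complex.Re z * complex.Im w + complex.Im z * complex.Re w.
Proof. by case: z w => ? ? []. Qed.

Lemma eq_cint F G : (forall x, D x -> F x = G x) -> cint rho D F = cint rho D G.
Proof. by move=> FG; rewrite /cint; congr Complex; apply: eq_Rintegral => x; rewrite inE => /FG ->. Qed.

Lemma cintegrableZ (z : R[i]) F : cintegrable F -> cintegrable (fun x => z * F x).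
Proof.
move=> [f1 f2]; split.
  have := integrableB mD (integrableZl mD (complex.Re z) f1) (integrableZl mD (complex.Im z) f2).
  by apply: eq_integrable => // x _; rewrite /= Re_mul.
have := integrableD mD (integrableZl mD (complex.Re z) f2) (integrableZl mD (complex.Im z) f1).
by apply: eq_integrable => // x _; rewrite /= Im_mul.
Qed.

Lemma cintD F G : cintegrable F -> cintegrable G ->
  cint rho D (fun x => F x + G x) = cint rho D F + cint rho D G.
Proof.
move=> [f1 f2] [g1 g2]; rewrite /cint.
under eq_Rintegral do rewrite Re_add.
under [X in Complex _ X]eq_Rintegral do rewrite Im_add.
by rewrite !RintegralD.
Qed.

Lemma cintZ (z : R[i]) F : cintegrable F -> cint rho D (fun x => z * F x) = z * cint rho D F.
Proof.
move=> [f1 f2]; rewrite /cint.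
under eq_Rintegral do rewrite Re_mul.
under [X in Complex _ X]eq_Rintegral do rewrite Im_mul.
have i1 k : rho.-integrable D (EFin \o (fun x => k * complex.Re (F x))).
  by have := integrableZl mD k f1; apply: eq_integrable.
have i2 k : rho.-integrable D (EFin \o (fun x => k * complex.Im (F x))).
  by have := integrableZl mD k f2; apply: eq_integrable.
by rewrite RintegralB// RintegralD// !RintegralZl//; case: z {i1 i2}.
Qed.

Lemma cintB F G : cintegrable F -> cintegrable G ->
  cint rho D (fun x => F x - G x) = cint rho D F - cint rho D G.
Proof.
move=> iF iG; rewrite -[X in _ + X]mulN1r -cintZ// -cintD//; last exact: cintegrableZ.
by apply: eq_cint => x _; rewrite mulN1r.
Qed.

Lemma cint_ae F G : cintegrable F -> cintegrable G -> {ae rho, forall x, D x -> F x = G x} ->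
  cint rho D F = cint rho D G.
Proof.
move=> [f1 f2] [g1 g2] FG; rewrite /cint; congr Complex; congr fine.
  apply: ae_eq_integral => //; [exact: measurable_int f1|exact: measurable_int g1|].
  by apply: filterS FG => x h /h /= ->.
apply: ae_eq_integral => //; [exact: measurable_int f2|exact: measurable_int g2|].
by apply: filterS FG => x h /h /= ->.
Qed.

Lemma L2on_cintegrable F G : L2on rho D F -> L2on rho D G -> cintegrable (fun x => F x * G x).
Proof.
move=> /(L2on_realE _ _ mD)[f1 f2] /(L2on_realE _ _ mD)[g1 g2]; split.
  have := integrableB mD (realL2M mD f1 g1) (realL2M mD f2 g2).
  by apply: eq_integrable => // x _; rewrite /= Re_mul.
have := integrableD mD (realL2M mD f1 g2) (realL2M mD f2 g1).
by apply: eq_integrable => // x _; rewrite /= Im_mul.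
Qed.

Lemma L2on_conj F : L2on rho D F -> L2on rho D (fun x => conjc (F x)).
Proof.
move=> /(L2on_realE _ _ mD)[f1 f2]; apply/(L2on_realE _ _ mD); split.
  by rewrite (_ : (fun x => _) = (fun x => complex.Re (F x)))//; apply/funext => x; case: (F x).
rewrite (_ : (fun x => _) = (fun x => -1 * complex.Im (F x))); first exact: realL2Z.
by apply/funext => x; case: (F x) => ? ?; rewrite mulN1r.
Qed.

Lemma L2on_lin (z w : R[i]) F G : L2on rho D F -> L2on rho D G -> L2on rho D (fun x => z * F x + w * G x).
Proof.
move=> /(L2on_realE _ _ mD)[f1 f2] /(L2on_realE _ _ mD)[g1 g2]; apply/(L2on_realE _ _ mD); split.
  rewrite (_ : (fun x => _) = (fun x => (complex.Re z * complex.Re (F x) + (- complex.Im z) * complex.Im (F x)) +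
     (complex.Re w * complex.Re (G x) + (- complex.Im w) * complex.Im (G x)))).
    by apply: realL2D => //; apply: realL2D => //; exact: realL2Z.
  by apply/funext => x; rewrite Re_add !Re_mul !mulNr.
rewrite (_ : (fun x => _) = (fun x => (complex.Re z * complex.Im (F x) + complex.Im z * complex.Re (F x)) +
   (complex.Re w * complex.Im (G x) + complex.Im w * complex.Re (G x)))).
  by apply: realL2D => //; apply: realL2D => //; exact: realL2Z.
by apply/funext => x; rewrite Im_add !Im_mul.
Qed.

Lemma L2on_ae F G : measurable_fun D (fun x => complex.Re (G x)) -> measurable_fun D (fun x => complex.Im (G x)) ->
  L2on rho D F -> {ae rho, forall x, D x -> F x = G x} -> L2on rho D G.
Proof.
move=> m1 m2 /(L2on_realE _ _ mD)[f1 f2] FG; apply/(L2on_realE _ _ mD); split.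
  by apply: (realL2_ae mD m1 f1); apply: filterS FG => x h /h ->.
by apply: (realL2_ae mD m2 f2); apply: filterS FG => x h /h ->.
Qed.

Lemma cint_sqr_eq0 F : L2on rho D F -> cint rho D (fun x => F x * conjc (F x)) = 0 ->
  {ae rho, forall x, D x -> F x = 0}.
Proof.
move=> LF /(congr1 (@complex.Re R)) /=.
have [_ _ iF] := LF.
have sE x : complex.Re (F x * conjc (F x)) = sqn (F x).
  by case: (F x) => u v; rewrite /sqn /=; ring.
under eq_Rintegral do rewrite sE.
move=> z.
have s0 (w : R[i]) : 0 <= sqn w by rewrite /sqn addr_ge0 ?sqr_ge0.
have /(ae_eq_integral_abs rho mD (measurable_int _ iF)) : (\int[rho]_(x in D) `|(sqn (F x))%:E| = 0)%E.
  under eq_integral do rewrite /= ger0_norm ?s0//.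
  by rewrite -(fineK (integrable_fin_num mD iF)); congr EFin.
apply: filterS => x h Dx; have := h Dx => -[].
case: (F x) => u v /eqP; rewrite /sqn /= paddr_eq0 ?sqr_ge0// !sqrf_eq0.
by move=> /andP[/eqP -> /eqP ->].
Qed.

End complex_integral.

(** * The maximal domain and the complex Lagrange identity *)

Section domain.
Context (R : realType) (a b : \bar R) (rho : pmeasure R) (vs chi : smeasure R).
Local Notation I := (Iab a b).
Implicit Types t s : elt R.

Definition in_dom t : Prop :=
  [/\ dtau a b rho vs chi (ef t) (ef1 t) (eh t), L2 a b rho (ef t) & L2 a b rho (eh t)].

Let mI : measurable I. Proof. exact: measurable_Iab. Qed.

Lemma dtau_lin (x y : R[i]) f f1 h g g1 k :
  dtau a b rho vs chi f f1 h -> dtau a b rho vs chi g g1 k ->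
  dtau a b rho vs chi (fun z => x * f z + y * g z) (fun z => x * f1 z + y * g1 z) (fun z => x * h z + y * k z).
Proof.
move=> /dtau_realE[fr fi] /dtau_realE[gr gi]; apply/dtau_realE.
have rE (F G : R -> R[i]) : (fun z => complex.Re (x * F z + y * G z)) =
    (fun z => 1 * (complex.Re x * complex.Re (F z) + (- complex.Im x) * complex.Im (F z)) +
       1 * (complex.Re y * complex.Re (G z) + (- complex.Im y) * complex.Im (G z))).
  by apply/funext => z; case: x y (F z) (G z) => ? ? [? ?] [? ?] [? ?] /=; ring.
have iE (F G : R -> R[i]) : (fun z => complex.Im (x * F z + y * G z)) =
    (fun z => 1 * (complex.Re x * complex.Im (F z) + complex.Im x * complex.Re (F z)) +
       1 * (complex.Re y * complex.Im (G z) + complex.Im y * complex.Re (G z))).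
  by clear rE; apply/funext => z; case: x y (F z) (G z) => ? ? [? ?] [? ?] [? ?] /=; ring.
split; first by rewrite !rE; apply: real_dtau_lin; exact: real_dtau_lin.
by rewrite !iE; apply: real_dtau_lin; exact: real_dtau_lin.
Qed.

Lemma dtau_conj f f1 h : dtau a b rho vs chi f f1 h ->
  dtau a b rho vs chi (cconj f) (cconj f1) (cconj h).
Proof.
move=> /dtau_realE[fr fi]; apply/dtau_realE.
have rE (F : R -> R[i]) : (fun z => complex.Re (cconj F z)) = (fun z => complex.Re (F z)).
  by apply/funext => z; rewrite /cconj; case: (F z).
have iE (F : R -> R[i]) : (fun z => complex.Im (cconj F z)) =
    (fun z => (-1) * complex.Im (F z) + 0 * complex.Im (F z)).
  by apply/funext => z; rewrite /cconj; case: (F z) => ? ?; rewrite /=; ring.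
by rewrite !rE !iE; split => //; exact: real_dtau_lin.
Qed.

Lemma in_dom_lin x t y s : in_dom t -> in_dom s -> in_dom (elin x t y s).
Proof. by move=> [t1 t2 t3] [s1 s2 s3]; split; [exact: dtau_lin|exact: L2on_lin|exact: L2on_lin]. Qed.

Lemma in_dom_conj t : in_dom t -> in_dom (econj t).
Proof. by move=> [t1 t2 t3]; split; [exact: dtau_conj|exact: L2on_conj|exact: L2on_conj]. Qed.

Lemma dtau_measurable f f1 h : dtau a b rho vs chi f f1 h ->
  [/\ measurable_fun I (fun x => complex.Re (f x)), measurable_fun I (fun x => complex.Im (f x)),
      measurable_fun I (fun x => complex.Re (h x)) & measurable_fun I (fun x => complex.Im (h x))].
Proof.
move=> /dtau_realE[fr fi].
have mh u u1 k : real_dtau a b rho vs chi u u1 k -> measurable_fun I k.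
  move=> [_ _ s _]; apply: measurable_fun_Iab => c d ic id.
  by have [/measurable_int/measurable_EFinP] := s c d ic id.
by split; [exact: real_dtau_measurable fr|exact: real_dtau_measurable fi|exact: mh fr|exact: mh fi].
Qed.

Hypothesis st : standing a b rho vs chi.
Let ab : (a < b)%E. Proof. by case: st. Qed.

Definition wa := wlim (at_left_end a).
Definition wb := wlim (at_right_end b).

Lemma left_proper : ProperFilter (at_left_end a).
Proof. by apply: at_left_end_proper; case: a ab => //; case: b. Qed.
Lemma right_proper : ProperFilter (at_right_end b).
Proof. by apply: at_right_end_proper; case: b ab => //; case: a. Qed.

(** The bilinear form of the identity, combined from four real ones for the real and imaginary
    parts; the sesquilinear form arises by inserting [econj s]. *)
Lemma dom_lagrange t s : in_dom t -> in_dom s ->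
  [/\ ccvg (at_left_end a) (wr t s) (wa t s), ccvg (at_right_end b) (wr t s) (wb t s) &
   wb t s - wa t s = cint rho I (fun x => eh t x * ef s x - ef t x * eh s x)].
Proof.
move=> [/dtau_realE[t1 t2] /(L2on_realE _ _ mI)[t3 t4] /(L2on_realE _ _ mI)[t5 t6]]
  [/dtau_realE[s1 s2] /(L2on_realE _ _ mI)[s3 s4] /(L2on_realE _ _ mI)[s5 s6]].
have [l1 [r1 [a1 b1 e1]]] := real_wronskian_lim st t1 s1 t3 t5 s3 s5.
have [l2 [r2 [a2 b2 e2]]] := real_wronskian_lim st t2 s2 t4 t6 s4 s6.
have [l3 [r3 [a3 b3 e3]]] := real_wronskian_lim st t1 s2 t3 t5 s4 s6.
have [l4 [r4 [a4 b4 e4]]] := real_wronskian_lim st t2 s1 t4 t6 s3 s5.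
have pa := left_proper; have pb := right_proper.
set fr := fun x => complex.Re (ef t x) in a1 a2 a3 a4 b1 b2 b3 b4 e1 e2 e3 e4.
set fi := fun x => complex.Im (ef t x) in a1 a2 a3 a4 b1 b2 b3 b4 e1 e2 e3 e4.
set gr := fun x => complex.Re (ef s x) in a1 a2 a3 a4 b1 b2 b3 b4 e1 e2 e3 e4.
set gi := fun x => complex.Im (ef s x) in a1 a2 a3 a4 b1 b2 b3 b4 e1 e2 e3 e4.
set f1r := fun x => complex.Re (ef1 t x) in a1 a2 a3 a4 b1 b2 b3 b4.
set f1i := fun x => complex.Im (ef1 t x) in a1 a2 a3 a4 b1 b2 b3 b4.
set g1r := fun x => complex.Re (ef1 s x) in a1 a2 a3 a4 b1 b2 b3 b4.
set g1i := fun x => complex.Im (ef1 s x) in a1 a2 a3 a4 b1 b2 b3 b4.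
have rE : (fun x => complex.Re (wr t s x)) = (fun x => rW fr f1r gr g1r x - rW fi f1i gi g1i x).
  apply/funext => x; rewrite /wr /Wr /rW /fr /fi /gr /gi /f1r /f1i /g1r /g1i.
  by case: (ef t x) (ef1 t x) (ef s x) (ef1 s x) => ? ? [? ?] [? ?] [? ?] /=; ring.
have iE : (fun x => complex.Im (wr t s x)) = (fun x => rW fr f1r gi g1i x + rW fi f1i gr g1r x).
  apply/funext => x; rewrite /wr /Wr /rW /fr /fi /gr /gi /f1r /f1i /g1r /g1i.
  by case: (ef t x) (ef1 t x) (ef s x) (ef1 s x) => ? ? [? ?] [? ?] [? ?] /=; ring.
have ca : ccvg (at_left_end a) (wr t s) (Complex (l1 - l2) (l3 + l4)).
  by split; [rewrite rE; exact: cvgB|rewrite iE; exact: cvgD].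
have cb : ccvg (at_right_end b) (wr t s) (Complex (r1 - r2) (r3 + r4)).
  by split; [rewrite rE; exact: cvgB|rewrite iE; exact: cvgD].
have -> : wa t s = Complex (l1 - l2) (l3 + l4) by exact: ccvg_clim ca.
have -> : wb t s = Complex (r1 - r2) (r3 + r4) by exact: ccvg_clim cb.
split => //.
have J u v w z : realL2 rho I u -> realL2 rho I v -> realL2 rho I w -> realL2 rho I z ->
  rho.-integrable I (EFin \o (fun x => u x * v x - w x * z x)).
  move=> Lu Lv Lw Lz; have := integrableB mI (realL2M mI Lu Lv) (realL2M mI Lw Lz).
  by apply: eq_integrable.
rewrite /cint; apply/eqP; rewrite eq_complex /=; apply/andP; split; apply/eqP.
  have -> : r1 - r2 - (l1 - l2) = (r1 - l1) - (r2 - l2) by ring.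
  rewrite e1 e2 -RintegralB//; try exact: J.
  apply: eq_Rintegral => x _; rewrite /fr /fi /gr /gi.
  by case: (ef t x) (eh t x) (ef s x) (eh s x) => ? ? [? ?] [? ?] [? ?] /=; ring.
have -> : r3 + r4 - (l3 + l4) = (r3 - l3) + (r4 - l4) by ring.
rewrite e3 e4 -RintegralD//; try exact: J.
apply: eq_Rintegral => x _; rewrite /fr /fi /gr /gi.
by case: (ef t x) (eh t x) (ef s x) (eh s x) => ? ? [? ?] [? ?] [? ?] /=; ring.
Qed.

Let cva t s : in_dom t -> in_dom s -> ccvg (at_left_end a) (wr t s) (wa t s).
Proof. by move=> Dt Ds; have [] := dom_lagrange Dt Ds. Qed.
Let cvb t s : in_dom t -> in_dom s -> ccvg (at_right_end b) (wr t s) (wb t s).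
Proof. by move=> Dt Ds; have [] := dom_lagrange Dt Ds. Qed.

Hypotheses (lcl : LC_left a b rho vs chi) (lcr : LC_right a b rho vs chi).

(** All that the later arguments use of the solution theory. [E] and [G] are real, so integrals
    against them are inner products, and [n], [m] are their squared norms. *)
Record fundamental_pair (E G : elt R) (n m : R) : Prop := {
  fpE : in_dom E; fpG : in_dom G;
  fpE_conj : econj E = E; fpG_conj : econj G = G;
  fpE_h : eh E = (fun=> 0); fpG_h : eh G = (fun=> 0);
  fp_wa : wa E G = 1; fp_wb : wb E G = 1;
  fp_n : 0 < n; fp_m : 0 < m;
  fp_EE : cint rho I (fun x => ef E x * ef E x) = Complex n 0;
  fp_GG : cint rho I (fun x => ef G x * ef G x) = Complex m 0;
  fp_EG : cint rho I (fun x => ef E x * ef G x) = 0;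
  fp_solve : forall h, L2 a b rho h -> exists2 t, in_dom t & eh t = h }.

Lemma fundamental_pair_exists : exists E G n m, fundamental_pair E G n m.
Proof.
have [e [e1 [g [g1 [He Hg Le Lg [W1 og ne ng]]]]]] := fundamental_system st lcl lcr.
have mk u u1 : real_dtau a b rho vs chi u u1 (fun=> 0) -> realL2 rho I u -> in_dom (ereal_elt u u1).
  move=> Hu Lu; split.
  - apply/dtau_realE; split; first exact: Hu.
    have Z (w : R -> R) : (fun z => 0 * w z + 0 * w z) = (fun=> 0).
      by apply/funext => z; rewrite !mul0r addr0.
    by have := real_dtau_lin 0 0 Hu Hu; rewrite !Z.
  - by apply/(L2on_realE _ _ mI); split => //; exact: realL2_cst0.
  - by apply/(L2on_realE _ _ mI); split => //; exact: realL2_cst0.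
have cj u u1 : econj (ereal_elt u u1) = ereal_elt u u1.
  by rewrite /econj /ereal_elt /cconj /=; congr Elt; apply/funext => x; rewrite oppr0.
have DE := mk _ _ He Le; have DG := mk _ _ Hg Lg.
have wE x : I x -> wr (ereal_elt e e1) (ereal_elt g g1) x = 1.
  move=> /W1; rewrite /rW /wr /Wr /= => h; apply/eqP; rewrite eq_complex /=.
  by rewrite !mul0r !mulr0 !subr0 !addr0 subrr h !eqxx.
exists (ereal_elt e e1), (ereal_elt g g1), (Rintegral rho I (fun x => e x * e x)),
  (Rintegral rho I (fun x => g x * g x)).
have rc u v : cint rho I (fun x => Complex (u x) 0 * Complex (v x) 0) = Complex (Rintegral rho I (fun x => u x * v x)) 0.
  rewrite /cint; congr Complex; first by apply: eq_Rintegral => x _ /=; rewrite mulr0 subr0.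
  rewrite (@eq_Rintegral _ _ _ _ _ (cst 0)); first by rewrite Rintegral_cst// mul0r.
  by move=> x _ /=; rewrite mulr0 mul0r addr0.
split => //.
- have pa := left_proper; apply: (ccvg_clim pa); apply: (@ccvg_near _ _ _ (cst 1)); last exact: ccvg_cst.
  by apply: filterS (near_at_left_end ab) => x ix; rewrite wE.
- have pb := right_proper; apply: (ccvg_clim pb); apply: (@ccvg_near _ _ _ (cst 1)); last exact: ccvg_cst.
  by apply: filterS (near_at_right_end ab) => x ix; rewrite wE.
- exact: rc.
- exact: rc.
- by rewrite rc og.
move=> h /(L2on_realE _ _ mI)[h1 h2].
have [fr [f1r [Hr Lr]]] := real_dtau_inhomogeneous st He Hg Le Lg W1 h1.
have [fi [f1i [Hi Li]]] := real_dtau_inhomogeneous st He Hg Le Lg W1 h2.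
exists (Elt (fun x => Complex (fr x) (fi x)) (fun x => Complex (f1r x) (f1i x)) h) => //.
split; rewrite /=; [exact/dtau_realE|exact/(L2on_realE _ _ mI)|exact/(L2on_realE _ _ mI)].
Qed.

End domain.

Lemma conjcD (R : realType) (x y : R[i]) : conjc (x + y) = conjc x + conjc y.
Proof. exact: rmorphD. Qed.

Lemma conjcB (R : realType) (x y : R[i]) : conjc (x - y) = conjc x - conjc y.
Proof. exact: rmorphB. Qed.

Lemma conjcM (R : realType) (x y : R[i]) : conjc (x * y) = conjc x * conjc y.
Proof. exact: rmorphM. Qed.

Lemma conjc1 (R : realType) : conjc (1 : R[i]) = 1.
Proof. exact: rmorph1. Qed.

(** * The Wronskian at an endpoint in terms of the boundary functionals *)

Section boundary_algebra.
Context (R : realType) (fl : set_system R) (pf : ProperFilter fl) (P : elt R -> Prop).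
Local Notation w := (wlim fl).
Hypothesis cv : forall t s, P t -> P s -> ccvg fl (wr t s) (w t s).
Hypothesis Pconj : forall t, P t -> P (econj t).
Context (E G w1 w2 : elt R) (PE : P E) (PG : P G) (P1 : P w1) (P2 : P w2).
Hypotheses (cE : econj E = E) (cG : econj G = G) (EG : w E G = 1).
Hypotheses (n12 : w w1 (econj w2) = 1) (n11 : w w1 (econj w1) = 0) (n22 : w w2 (econj w2) = 0).

Let p1 := w w1 E. Let p2 := w w1 G. Let q1 := w w2 E. Let q2 := w w2 G.

Let conjE t : P t -> w (econj t) E = conjc (w t E).
Proof. by move=> Pt; rewrite -(wlim_conj pf cv Pt PE) cE. Qed.
Let conjG t : P t -> w (econj t) G = conjc (w t G).
Proof. by move=> Pt; rewrite -(wlim_conj pf cv Pt PG) cG. Qed.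
Let coord t s : P t -> P s -> w t s = w t E * w s G - w t G * w s E.
Proof. exact: wlim_basis. Qed.

Let XE t : P t -> w t (econj w2) = w t E * conjc q2 - w t G * conjc q1.
Proof. by move=> Pt; rewrite coord ?conjE ?conjG//; exact: Pconj. Qed.
Let YE t : P t -> w (econj w1) t = conjc p1 * w t G - conjc p2 * w t E.
Proof. by move=> Pt; rewrite coord ?conjE ?conjG//; exact: Pconj. Qed.

Let c12 : p1 * conjc q2 - p2 * conjc q1 = 1. Proof. by rewrite -n12 XE. Qed.
Let c12' : conjc p1 * q2 - conjc p2 * q1 = 1.
 by have := congr1 (@conjc R) c12; rewrite conjcB !conjcM !conjcK conjc1. Qed.
Let c11 : p1 * conjc p2 = p2 * conjc p1.
Proof.
by apply/eqP; rewrite -subr_eq0; apply/eqP; rewrite -n11 coord ?conjE ?conjG//; exact: Pconj.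
Qed.
Let c22 : q1 * conjc q2 = q2 * conjc q1.
Proof. by apply/eqP; rewrite -subr_eq0; apply/eqP; rewrite -n22 XE. Qed.

(* The normalisation makes (p1, p2) and (q1, q2) multiples of real vectors by one common phase. *)
Let phases (x1 x2 y1 y2 X1 X2 Y1 Y2 : R[i]) :
  x1 * Y2 - x2 * Y1 = 1 -> X1 * y2 - X2 * y1 = 1 -> x1 * X2 = x2 * X1 -> y1 * Y2 = y2 * Y1 ->
  [/\ x1 * Y2 - X2 * y1 = 1, x2 * Y2 = X2 * y2, x1 * Y1 = X1 * y1, X1 * y2 - x2 * Y1 = 1 &
      (X1 * Y2 - X2 * Y1) * (x1 * y2 - x2 * y1) = 1].
Proof.
move=> h1 h2 h3 h4.
split; apply/eqP; rewrite -subr_eq0; apply/eqP.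
- transitivity (x1 * Y2 * (X1 * y2 - X2 * y1) - X2 * y1 * (x1 * Y2 - x2 * Y1) -
    (x1 * Y2 - x2 * Y1) * (X1 * y2 - X2 * y1)); first by rewrite h1 h2 !mulr1.
  transitivity ((x2 * X1) * (Y1 * y2) - (x1 * X2) * (y1 * Y2)); first by ring.
  by rewrite h3 h4 [y2 * Y1]mulrC subrr.
- transitivity (x2 * Y2 * (X1 * y2 - X2 * y1) - X2 * y2 * (x1 * Y2 - x2 * Y1)).
    by rewrite h1 h2 !mulr1.
  transitivity (Y2 * y2 * (x2 * X1 - x1 * X2) + x2 * X2 * (y2 * Y1 - y1 * Y2)); first by ring.
  by rewrite h3 h4 !subrr !mulr0 addr0.
- transitivity (x1 * Y1 * (X1 * y2 - X2 * y1) - X1 * y1 * (x1 * Y2 - x2 * Y1)).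
    by rewrite h1 h2 !mulr1.
  transitivity (x1 * X1 * (y2 * Y1 - y1 * Y2) + y1 * Y1 * (x2 * X1 - x1 * X2)); first by ring.
  by rewrite h3 h4 !subrr !mulr0 addr0.
- transitivity (X1 * y2 * (x1 * Y2 - x2 * Y1) - x2 * Y1 * (X1 * y2 - X2 * y1) -
    (x1 * Y2 - x2 * Y1) * (X1 * y2 - X2 * y1)); first by rewrite h1 h2 !mulr1.
  transitivity ((x1 * X2) * (y1 * Y2) - (x2 * X1) * (Y1 * y2)); first by ring.
  by rewrite h3 h4 [y2 * Y1]mulrC subrr.
- transitivity ((X1 * Y2 - X2 * Y1) * (x1 * y2 - x2 * y1) - (x1 * Y2 - x2 * Y1) * (X1 * y2 - X2 * y1)).
    by rewrite h1 h2 mulr1.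
  transitivity ((x1 * X2 - x2 * X1) * (y1 * Y2 - y2 * Y1)); first by ring.
  by rewrite h3 h4 !subrr mulr0.
Qed.

(** Both sides are sesquilinear in the coordinates with respect to [E] and [G]; the first four
    identities of [phases] say that their coefficients agree. *)
Lemma wlim_form t s : P t -> P s -> w t (econj s) =
  w t (econj w2) * conjc (w (econj w1) s) - w (econj w1) t * conjc (w s (econj w2)).
Proof.
move=> Pt Ps; have [a1 a2 a3 a4 _] := phases c12 c12' c11 c22.
rewrite (XE Pt) (YE Pt) (XE Ps) (YE Ps) !conjcB !conjcM !conjcK.
rewrite (coord Pt (Pconj Ps)) conjE// conjG//.
set x1 := w t E; set x2 := w t G; set y1 := conjc (w s E); set y2 := conjc (w s G).
set P1' := conjc p1 in a1 a2 a3 a4 *; set P2' := conjc p2 in a1 a2 a3 a4 *.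
set Q1' := conjc q1 in a1 a2 a3 a4 *; set Q2' := conjc q2 in a1 a2 a3 a4 *.
have -> : (x1 * Q2' - x2 * Q1') * (p1 * y2 - p2 * y1) - (P1' * x2 - P2' * x1) * (y1 * q2 - y2 * q1) =
  x1 * y2 * (p1 * Q2' - P2' * q1) - x1 * y1 * (p2 * Q2' - P2' * q2) +
  x2 * y2 * (P1' * q1 - p1 * Q1') - x2 * y1 * (P1' * q2 - p2 * Q1') by ring.
by rewrite a1 a2 a3 a4 !subrr !mulr0 !mulr1 subr0 addr0.
Qed.

Lemma wlim_solve x y : exists al be, forall t, P t -> w t E = al -> w t G = be ->
  w t (econj w2) = x /\ w (econj w1) t = y.
Proof.
have [_ _ _ _ d] := phases c12 c12' c11 c22.
(* Cramer's rule. The determinant of the system is the conjugate of [p1 * q2 - p2 * q1], and by the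
   last identity of [phases] the factor [p1 * q2 - p2 * q1] is its inverse. *)
exists ((p1 * q2 - p2 * q1) * (x * conjc p1 + y * conjc q1)),
       ((p1 * q2 - p2 * q1) * (x * conjc p2 + y * conjc q2)) => t Pt al be.
rewrite (XE Pt) (YE Pt) al be; split.
  by rewrite -[RHS]mulr1 -d; ring.
by rewrite -[RHS]mulr1 -d; ring.
Qed.

Lemma wlim_eq0 t : P t -> w t E = 0 -> w t G = 0 -> w t (econj w2) = 0 /\ w (econj w1) t = 0.
Proof. by move=> Pt z1 z2; rewrite (XE Pt) (YE Pt) z1 z2 !mul0r !mulr0 subrr. Qed.

End boundary_algebra.

(** * The maximal relation *)

Section maximal_relation.
Context (R : realType) (a b : \bar R) (rho : pmeasure R) (vs chi : smeasure R).
Local Notation I := (Iab a b).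
Implicit Types t s : elt R.
Local Notation dom := (in_dom a b rho vs chi).
Local Notation L2 := (L2 a b rho).
Local Notation ip := (ip a b rho).
Local Notation aeeq := (aeeq a b rho).

Let mI : measurable I. Proof. exact: measurable_Iab. Qed.

Lemma TmaxP (p : (R -> R[i]) * (R -> R[i])) : Tmax a b rho vs chi p <->
  [/\ L2 p.1, L2 p.2 & exists t, [/\ dom t, aeeq p.1 (ef t) & aeeq p.2 (eh t)]].
Proof.
split=> [[l1 l2 [f [f1 [h [d e1 e2]]]]]|[l1 l2 [t [[d _ _] e1 e2]]]]; last first.
  by split => //; exists (ef t), (ef1 t), (eh t).
split => //; exists (Elt f f1 h); split => //; have [m1 m2 m3 m4] := dtau_measurable d.
by split => //; [exact: L2on_ae l1 e1|exact: L2on_ae l2 e2].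
Qed.

Lemma ip_ae f f' g g' : L2 f -> L2 g -> L2 f' -> L2 g' -> aeeq f f' -> aeeq g g' -> ip f g = ip f' g'.
Proof.
move=> lf lg lf' lg' e1 e2; apply: cint_ae => //.
- by apply: L2on_cintegrable => //; exact: L2on_conj.
- by apply: L2on_cintegrable => //; exact: L2on_conj.
by apply: filterS2 e1 e2 => x h1 h2 ix; rewrite h1// h2.
Qed.

Hypothesis st : standing a b rho vs chi.

Lemma ip_lagrange t s : dom t -> dom s ->
  ip (eh t) (ef s) - ip (ef t) (eh s) = wb b t (econj s) - wa a t (econj s).
Proof.
move=> Dt Ds; have [_ _ ->] := dom_lagrange st Dt (in_dom_conj Ds).
have [_ t1 t2] := Dt; have [_ s1 s2] := Ds.
by rewrite cintB//; apply: L2on_cintegrable => //; exact: L2on_conj.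
Qed.

Let pa := left_proper st. Let pb := right_proper st.
Let cva t s : dom t -> dom s -> ccvg (at_left_end a) (wr t s) (wa a t s).
Proof. by move=> Dt Ds; have [] := dom_lagrange st Dt Ds. Qed.
Let cvb t s : dom t -> dom s -> ccvg (at_right_end b) (wr t s) (wb b t s).
Proof. by move=> Dt Ds; have [] := dom_lagrange st Dt Ds. Qed.

Context (E G : elt R) (n m : R) (fp : fundamental_pair a b rho vs chi E G n m).

Let DE : dom E := fpE fp. Let DG : dom G := fpG fp.

Let L2E : L2 (ef E). Proof. by case: DE. Qed.
Let L2G : L2 (ef G). Proof. by case: DG. Qed.

(** Lagrange's identity against a solution of tau u = 0: the value at b is controlled by the one at
    a and by an inner product of the image under tau. *)
Lemma wb_E t : dom t -> wb b t E = wa a t E + cint rho I (fun x => eh t x * ef E x).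
Proof.
move=> Dt; have [_ _] := dom_lagrange st Dt DE; rewrite (fpE_h fp).
rewrite (@eq_cint _ _ _ _ (fun x => eh t x * ef E x)); last by move=> x _; rewrite mulr0 subr0.
by move=> <-; ring.
Qed.

Lemma wb_G t : dom t -> wb b t G = wa a t G + cint rho I (fun x => eh t x * ef G x).
Proof.
move=> Dt; have [_ _] := dom_lagrange st Dt DG; rewrite (fpG_h fp).
rewrite (@eq_cint _ _ _ _ (fun x => eh t x * ef G x)); last by move=> x _; rewrite mulr0 subr0.
by move=> <-; ring.
Qed.

Let anti t : dom t -> wa a t t = 0.
Proof.
move=> Dt; apply/eqP; have /eqP := wlim_antisym pa cva Dt Dt.
by rewrite -addr_eq0 -mulr2n mulrn_eq0.
Qed.

Let wGE : wa a G E = -1.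
Proof. by have := wlim_antisym pa cva DE DG; rewrite -/(wa a E G) (fp_wa fp) => <-. Qed.

(** Multiples of [E] and [G] do not change the image under tau, and since W(E,G) = 1 they move the
    two values at a independently. *)
Lemma dom_prescribed h al be : L2 h -> exists t, [/\ dom t, eh t = h, wa a t E = al & wa a t G = be].
Proof.
move=> Lh; have [t0 D0 h0] := fp_solve fp Lh.
have D1 x := in_dom_lin 1 x D0 DE; have D2 x y := in_dom_lin 1 y (D1 x) DG.
exists (elin 1 (elin 1 t0 (be - wa a t0 G) E) (wa a t0 E - al) G); split.
- exact: D2.
- rewrite /elin /= h0 (fpE_h fp) (fpG_h fp).
  by apply/funext => x; rewrite !mulr0 !addr0 !mul1r.
- rewrite /wa (wlim_lin pa cva)// (wlim_lin pa cva)//.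
  by rewrite -!/(wa a _ _) (anti DE) wGE; ring.
- rewrite /wa (wlim_lin pa cva)// (wlim_lin pa cva)//.
  by rewrite -!/(wa a _ _) (anti DG) (fp_wa fp); ring.
Qed.

Let EG0 : cint rho I (fun x => ef G x * ef E x) = 0.
Proof. by rewrite -(fp_EG fp); apply: eq_cint => x _; rewrite mulrC. Qed.

Let iEE := L2on_cintegrable mI L2E L2E. Let iEG := L2on_cintegrable mI L2E L2G.
Let iGE := L2on_cintegrable mI L2G L2E. Let iGG := L2on_cintegrable mI L2G L2G.

Let n0 : Complex n 0 != 0 :> R[i].
Proof. by rewrite eq_complex /= eqxx andbT; apply: lt0r_neq0; exact: fp_n fp. Qed.
Let m0 : Complex m 0 != 0 :> R[i].
Proof. by rewrite eq_complex /= eqxx andbT; apply: lt0r_neq0; exact: fp_m fp. Qed.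

Let cint_linE (x y : R[i]) :
  cint rho I (fun z => (x * ef E z + y * ef G z) * ef E z) = x * Complex n 0.
Proof.
rewrite (@eq_cint _ _ _ _ (fun z => x * (ef E z * ef E z) + y * (ef G z * ef E z))); last by move=> z _; ring.
by rewrite cintD ?cintZ//; [rewrite (fp_EE fp) EG0 mulr0 addr0|exact: cintegrableZ|exact: cintegrableZ].
Qed.

Let cint_linG (x y : R[i]) :
  cint rho I (fun z => (x * ef E z + y * ef G z) * ef G z) = y * Complex m 0.
Proof.
rewrite (@eq_cint _ _ _ _ (fun z => x * (ef E z * ef G z) + y * (ef G z * ef G z))); last by move=> z _; ring.
by rewrite cintD ?cintZ//; [rewrite (fp_GG fp) (fp_EG fp) mulr0 add0r|exact: cintegrableZ|exact: cintegrableZ].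
Qed.

(** The image under tau is taken in the span of [E] and [G], where orthogonality makes the
    coefficients the required shifts divided by the squared norms. *)
Lemma dom_boundary_values (al be al' be' : R[i]) :
  exists t, [/\ dom t, wa a t E = al, wa a t G = be, wb b t E = al' & wb b t G = be'].
Proof.
pose h z := ((al' - al) / Complex n 0) * ef E z + ((be' - be) / Complex m 0) * ef G z.
have Lh : L2 h by exact: L2on_lin.
have [t [Dt ht tE tG]] := dom_prescribed al be Lh.
exists t; split => //.
- by rewrite wb_E// tE ht cint_linE divfK//; ring.
- by rewrite wb_G// tG ht cint_linG divfK//; ring.
Qed.

(* Solve [tau f0 = k]; the part of [g - f0] orthogonal to the solutions of [tau u = 0] is the
   image under tau of an element of S, hence orthogonal to itself. *)
Lemma adjoint_sub_Tmax (S : crel R) (p : (R -> R[i]) * (R -> R[i])) :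
  (forall t, dom t -> wa a t E = 0 -> wa a t G = 0 -> wb b t E = 0 -> wb b t G = 0 -> S (ef t, eh t)) ->
  (forall t s, dom t -> dom s -> wa a t E = 0 -> wa a t G = 0 -> wb b t E = 0 -> wb b t G = 0 ->
     wa a t s = 0 /\ wb b t s = 0) ->
  adjoint a b rho S p -> Tmax a b rho vs chi p.
Proof.
case: p => g k hS hz [/= Lg Lk adj]; apply/TmaxP; split => //.
have [t0 D0 h0] := fp_solve fp Lk; have [_ L0 _] := D0.
pose r z := 1 * g z + (-1) * ef t0 z.
have Lr : L2 r by exact: L2on_lin.
(* [q] is the orthogonal projection of [r] onto the span of [E] and [G], and [u] is the
   remainder. *)
pose c1 := cint rho I (fun z => r z * ef E z) / Complex n 0.
pose c2 := cint rho I (fun z => r z * ef G z) / Complex m 0.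
pose q z := c1 * ef E z + c2 * ef G z.
have Lq : L2 q by exact: L2on_lin.
pose u z := 1 * r z + (-1) * q z.
have Lu : L2 u by exact: L2on_lin.
have irE := L2on_cintegrable mI Lr L2E; have irG := L2on_cintegrable mI Lr L2G.
have iqE := L2on_cintegrable mI Lq L2E; have iqG := L2on_cintegrable mI Lq L2G.
have uE : cint rho I (fun z => u z * ef E z) = 0.
  rewrite (@eq_cint _ _ _ _ (fun z => r z * ef E z - q z * ef E z)); last by move=> z _; rewrite /u; ring.
  by rewrite cintB// cint_linE /c1 divfK// subrr.
have uG : cint rho I (fun z => u z * ef G z) = 0.
  rewrite (@eq_cint _ _ _ _ (fun z => r z * ef G z - q z * ef G z)); last by move=> z _; rewrite /u; ring.
  by rewrite cintB// cint_linG /c2 divfK// subrr.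
(* The values at a are zero by choice, and those at b because [u] is orthogonal to [E] and [G];
   hence [(ef t, eh t)] lies in S. *)
have [t [Dt ht tE tG]] := dom_prescribed 0 0 Lu.
have tE' : wb b t E = 0 by rewrite wb_E// ht tE uE addr0.
have tG' : wb b t G = 0 by rewrite wb_G// ht tG uG addr0.
(* The adjoint condition for [g] and Lagrange's identity for [t0] have the same right-hand side, so
   [u] is orthogonal to their difference [r]. *)
have e1 : ip u g = ip (ef t) k by have := adj _ (hS t Dt tE tG tE' tG'); rewrite /= ht.
have e2 : ip u (ef t0) = ip (ef t) k.
  have := ip_lagrange Dt D0; have [-> ->] := hz t _ Dt (in_dom_conj D0) tE tG tE' tG'.
  by rewrite subrr ht h0 => /eqP; rewrite subr_eq0 => /eqP.
have cf (v : R -> R[i]) : L2 v -> cintegrable rho I (fun z => u z * conjc (v z)).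
  by move=> Lv; apply: L2on_cintegrable => //; exact: L2on_conj.
have ur : cint rho I (fun z => u z * conjc (r z)) = 0.
  rewrite (@eq_cint _ _ _ _ (fun z => u z * conjc (g z) - u z * conjc (ef t0 z))); last first.
    by move=> z _; rewrite /r mul1r mulN1r conjcB mulrBr.
  rewrite cintB//; [|exact: cf|exact: cf].
  by move: e1 e2; rewrite /Defs.ip => -> ->; rewrite subrr.
have uq : cint rho I (fun z => u z * conjc (q z)) = 0.
  have rE z : conjc (ef E z) = ef E z by rewrite -[in RHS](fpE_conj fp).
  have rG z : conjc (ef G z) = ef G z by rewrite -[in RHS](fpG_conj fp).
  have iuE := L2on_cintegrable mI Lu L2E; have iuG := L2on_cintegrable mI Lu L2G.
  rewrite (@eq_cint _ _ _ _ (fun z => conjc c1 * (u z * ef E z) + conjc c2 * (u z * ef G z))); last first.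
    by move=> z _; rewrite /q conjcD !conjcM rE rG; ring.
  by rewrite cintD ?cintZ ?uE ?uG ?mulr0 ?addr0//; exact: cintegrableZ.
have u0 : {ae rho, forall x, I x -> u x = 0}.
  apply: cint_sqr_eq0 => //.
  rewrite (@eq_cint _ _ _ _ (fun z => u z * conjc (r z) - u z * conjc (q z))); last first.
    by move=> z _; rewrite -mulrBr -conjcB /u mul1r mulN1r.
  by rewrite cintB ?ur ?uq ?subrr//; exact: cf.
exists (elin 1 t0 1 (elin c1 E c2 G)); split.
- by do 2 apply: in_dom_lin => //.
- apply: filterS u0 => x hx ix; have := hx ix; rewrite /u /r /q /elin /= => e.
  by apply/eqP; rewrite -subr_eq0 -[X in _ == X]e; apply/eqP; ring.
- by apply: aeW => x ix; rewrite /elin /= h0 (fpE_h fp) (fpG_h fp); ring.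
Qed.

End maximal_relation.

(** * Self-orthogonal subspaces and boundary conditions *)

Section lagrangian_subspaces.
Context (R : realType).
Local Notation C := R[i].
Local Notation J := (Jmx R).

Definition ctr m n (M : 'M[C]_(m, n)) : 'M[C]_(n, m) := (map_mx (@conjc R) M)^T.

Lemma ctrM m n p (M : 'M[C]_(m, n)) (N : 'M[C]_(n, p)) : ctr (M *m N) = ctr N *m ctr M.
Proof. by rewrite /ctr map_mxM trmx_mul. Qed.

Lemma ctrK m n (M : 'M[C]_(m, n)) : ctr (ctr M) = M.
Proof. by apply/matrixP => i j; rewrite !mxE conjcK. Qed.

Lemma ctr0 m n : ctr (0 : 'M[C]_(m, n)) = 0.
Proof. by rewrite /ctr map_mx0 trmx0. Qed.

Lemma ctr_row_mx m n1 n2 (M : 'M[C]_(m, n1)) (N : 'M[C]_(m, n2)) :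
  ctr (row_mx M N) = col_mx (ctr M) (ctr N).
Proof. by rewrite /ctr map_row_mx tr_row_mx. Qed.

Lemma rank_ctr m n (M : 'M[C]_(m, n)) : \rank (ctr M) = \rank M.
Proof. by rewrite /ctr mxrank_tr mxrank_map. Qed.

Lemma Jmx_sqr : J *m J = -1%:M.
Proof.
apply/matrixP => i j; rewrite !mxE !big_ord_recl big_ord0 !mxE /=.
by case: i => [[|[|]]] //= ?; case: j => [[|[|]]] //= ?; rewrite ?mulr0 ?mul0r ?mulr1 ?mul1r ?addr0 ?add0r ?oppr0.
Qed.

Lemma trmx_Jmx : J^T = - J.
Proof.
apply/matrixP => i j; rewrite !mxE.
by case: i => [[|[|]]] //= ?; case: j => [[|[|]]] //= ?; rewrite ?opprK ?oppr0.
Qed.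

Lemma ctr_Jmx : ctr J = - J.
Proof.
rewrite -trmx_Jmx; congr trmx; apply/matrixP => i j; rewrite !mxE.
by case: ifP => _; [rewrite rmorphN rmorph1|case: ifP => _; rewrite ?rmorph1 ?rmorph0].
Qed.

(* The boundary form on [C^2 + C^2], on row vectors. *)
Definition bform : 'M[C]_(2 + 2) := block_mx (- J) 0 0 J.

Lemma ctr_bform : ctr bform = - bform.
Proof.
rewrite /ctr /bform map_block_mx tr_block_mx !map_mx0 !trmx0 opp_block_mx !oppr0.
by rewrite map_mxN linearN /= -/(ctr J) ctr_Jmx.
Qed.

Lemma bform_unit : bform \in unitmx.
Proof.
have [] := @mulmx1_unit _ _ bform (- bform) _ => //.
rewrite mulmxN /bform mulmx_block !mulmx0 !mul0mx !addr0 !add0r.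
rewrite mulNmx mulmxN opprK Jmx_sqr opp_block_mx !oppr0 opprK.
by rewrite -scalar_mx_block.
Qed.

Lemma rank_bform_ctr m (K : 'M[C]_(m, 2 + 2)) : \rank (bform *m ctr K) = \rank K.
Proof.
rewrite -rank_ctr ctrM ctrK ctr_bform mulmxN mxrank_opp mxrankMfree//.
by rewrite row_free_unit bform_unit.
Qed.

(** The form is nondegenerate, so the orthogonal complement of the row space has rank 4 - 2 = 2; it
    contains the row space by isotropy and therefore equals it. *)
Lemma lagrangian_ker (K : 'M[C]_(2, 2 + 2)) m (u : 'M[C]_(m, 2 + 2)) :
  \rank K = 2%N -> K *m bform *m ctr K = 0 -> (u *m bform *m ctr K = 0) <-> (u <= K)%MS.
Proof.
move=> rK iK; have sK : (K <= kermx (bform *m ctr K))%MS by apply/sub_kermxP; rewrite mulmxA.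
have := mxrank_leqif_eq sK; rewrite mxrank_ker rank_bform_ctr rK => -[_ /esym /=].
rewrite eqxx => /eqmxP eqK; rewrite eqK; split => [h|/sub_kermxP].
  by apply/sub_kermxP; rewrite mulmxA.
by rewrite mulmxA.
Qed.

Lemma bform_rows_eq0 m (u : 'rV[C]_(2 + 2)) (K : 'M[C]_(m, 2 + 2)) :
  (forall i, u *m bform *m ctr (row i K) = 0) -> u *m bform *m ctr K = 0.
Proof.
move=> h; apply/matrixP => i j; have /matrixP/(_ i 0) := h j; rewrite !mxE => e; rewrite -[RHS]e.
by apply: eq_bigr => k _; rewrite !mxE.
Qed.

(** V is an arbitrary set here; linearity comes for free, as orthogonal complements are
    subspaces. *)
Definition self_orthogonal (V : set 'rV[C]_(2 + 2)) : Prop :=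
  forall u, V u <-> forall v, V v -> u *m bform *m ctr v = 0.

Lemma lagrangian_self_orthogonal (K : 'M[C]_(2, 2 + 2)) :
  \rank K = 2%N -> K *m bform *m ctr K = 0 -> self_orthogonal [set u | u *m bform *m ctr K = 0].
Proof.
move=> rK iK u; split=> [/= uK v /= /(lagrangian_ker v rK iK)/submxP[c ->]|h /=].
  by rewrite ctrM mulmxA uK mul0mx.
by apply: bform_rows_eq0 => i; apply: h; apply/(lagrangian_ker _ rK iK); exact: row_sub.
Qed.

Lemma self_orthogonal_lagrangian (V : set 'rV[C]_(2 + 2)) : self_orthogonal V ->
  exists K : 'M[C]_(2, 2 + 2), [/\ \rank K = 2%N, K *m bform *m ctr K = 0 &
    V = [set u | u *m bform *m ctr K = 0]].
Proof.
move=> so.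
(* A matrix of maximal rank with row space inside V exhausts V: adjoining a vector of V keeps the
   row space inside V, so the rank cannot grow. *)
pose P k := `[< exists M : 'M[C]_(2 + 2), (forall u : 'rV_(2 + 2), (u <= M)%MS -> V u) /\ \rank M = k >].
have exP : exists k, P k.
  exists 0%N; apply/asboolP; exists 0; split; last exact: mxrank0.
  by move=> u /submx0null ->; apply/so => v _; rewrite !mul0mx.
have leP k : P k -> (k <= 4)%N by move=> /asboolP[M [_ <-]]; exact: rank_leq_row.
case: (ex_maxnP exP leP) => k /asboolP[M [MV rM]] kmax.
have VM u : V u <-> (u <= M)%MS.
  split=> [Vu|]; last exact: MV.
  have /kmax : P (\rank (M + u)%MS).
    apply/asboolP; exists (M + u)%MS; split=> // w /sub_addsmxP[[c d] /= ->]; apply/so => v Vv.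
    have h1 : c *m M *m bform *m ctr v = 0 by have /so/(_ _ Vv) := MV _ (submxMl c M).
    have h2 : d *m (u *m bform *m ctr v) = 0 by move/so/(_ _ Vv): Vu => ->; rewrite mulmx0.
    by rewrite !mulmxDl h1 add0r -h2 !mulmxA.
  rewrite -rM => h; have := mxrank_leqif_sup (addsmxSl M u).
  by rewrite /leqif eqn_leq h andbT => -[-> /esym]; rewrite addsmx_sub => /andP[].
have dual u : V u <-> (u <= kermx (bform *m ctr M))%MS.
  split=> [/so h|/sub_kermxP h].
    apply/sub_kermxP; rewrite mulmxA; apply: bform_rows_eq0 => i.
    by apply: h; apply/VM; exact: row_sub.
  by apply/so => v /VM/submxP[c ->]; rewrite ctrM -(mulmxA u) (mulmxA bform) (mulmxA u) h mul0mx.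
have eqMk : (M :=: kermx (bform *m ctr M))%MS.
  by apply/eqmxP; apply/andP; split; apply/row_subP => i; [apply/dual/VM|apply/VM/dual]; exact: row_sub.
(* The rank r satisfies r = 4 - r with truncated subtraction, which leaves only r = 2. *)
have r2 : \rank M = 2%N.
  have : \rank M = \rank (kermx (bform *m ctr M)) by rewrite {1}eqMk.
  by rewrite mxrank_ker rank_bform_ctr; case: (\rank M) => [|[|[|[|[|r]]]]].
have [K KM] : exists K : 'M[C]_(2, 2 + 2), (K :=: M)%MS.
  by move: (row_base M) (eq_row_base M); rewrite r2 => K; exists K.
have rK : \rank K = 2%N by rewrite KM.
have iK : K *m bform *m ctr K = 0.
  have /sub_kermxP h : (K <= kermx (bform *m ctr M))%MS by rewrite -eqMk KM.
  have /submxP[c Kc] : (K <= M)%MS by rewrite KM.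
  by rewrite {2}Kc ctrM mulmxA -(mulmxA K) h mul0mx.
exists K; split => //; apply/seteqP; split=> u.
  by move=> /VM; rewrite -KM => /(lagrangian_ker _ rK iK).
by move=> /(lagrangian_ker _ rK iK); rewrite KM => /VM.
Qed.

Local Notation conj := (map_mx (@conjc R)).

Lemma conj_mxK m n (M : 'M[C]_(m, n)) : conj (conj M) = M.
Proof. by apply/matrixP => i j; rewrite !mxE conjcK. Qed.

Lemma conj_Jmx : conj J = J.
Proof. by apply: trmx_inj; rewrite -/(ctr J) ctr_Jmx trmx_Jmx. Qed.

(* The matrix whose rows span the orthogonal complement, for the boundary form, of the solution
   space of [Ba x = Bb y]. *)
Definition bc_mx (Ba Bb : 'M[C]_2) : 'M[C]_(2, 2 + 2) := row_mx (conj Ba *m J) (conj Bb *m J).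

Lemma ctr_bc_mx Ba Bb : ctr (bc_mx Ba Bb) = col_mx (- (J *m Ba^T)) (- (J *m Bb^T)).
Proof. by rewrite ctr_row_mx !ctrM ctr_Jmx /ctr !conj_mxK !mulNmx. Qed.

Lemma bc_mxE Ba Bb (x y : 'cV[C]_2) :
  row_mx x^T y^T *m bform *m ctr (bc_mx Ba Bb) = 0 <-> Ba *m x = Bb *m y.
Proof.
have -> : row_mx x^T y^T *m bform *m ctr (bc_mx Ba Bb) = (Bb *m y - Ba *m x)^T.
  rewrite ctr_bc_mx mul_row_block !mulmx0 addr0 add0r mul_row_col !(mulmxN, mulNmx, opprK).
  rewrite !mulmxA -!(mulmxA _ J J) Jmx_sqr !(mulmxN, mulNmx, mulmx1, opprK) addrC.
  by rewrite [in RHS]linearB /= !trmx_mul.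
split=> [/(congr1 trmx)|->]; last by rewrite subrr trmx0.
by rewrite trmxK trmx0 => /eqP; rewrite subr_eq0 => /eqP.
Qed.

Lemma bc_mx_isotropic Ba Bb : bc_mx Ba Bb *m bform *m ctr (bc_mx Ba Bb) = 0 <->
  Ba *m J *m adjmx Ba = Bb *m J *m adjmx Bb.
Proof.
have -> : bc_mx Ba Bb *m bform *m ctr (bc_mx Ba Bb) =
    conj (Bb *m J *m adjmx Bb - Ba *m J *m adjmx Ba).
  rewrite ctr_bc_mx mul_row_block !mulmx0 addr0 add0r mul_row_col !(mulmxN, mulNmx, opprK).
  rewrite -!(mulmxA _ J J) Jmx_sqr !(mulmxN, mulNmx, mulmx1, opprK) addrC !mulmxA.
  by rewrite map_mxB !map_mxM conj_Jmx /adjmx !map_trmx !conj_mxK.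
split=> [/(congr1 conj)|->]; last by rewrite subrr map_mx0.
by rewrite conj_mxK map_mx0 => /eqP; rewrite subr_eq0 => /eqP.
Qed.

Lemma rank_bc_mx Ba Bb : \rank (bc_mx Ba Bb) = \rank (row_mx Ba Bb).
Proof.
rewrite -[RHS](mxrank_map (@conjc R)) map_row_mx.
have -> : bc_mx Ba Bb = row_mx (conj Ba) (conj Bb) *m block_mx J 0 0 J.
  by rewrite mul_row_block !mulmx0 addr0 add0r.
rewrite mxrankMfree// row_free_unit.
have [] := @mulmx1_unit _ _ (block_mx J 0 0 J) (- block_mx J 0 0 J) _ => //.
rewrite mulmxN mulmx_block !mulmx0 !mul0mx !addr0 !add0r Jmx_sqr opp_block_mx !oppr0 opprK.
by rewrite -scalar_mx_block.
Qed.

(** The two blocks are recovered by conjugation and multiplication by -J, the inverse of J. Hence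
    boundary matrices and Lagrangian bases carry the same data. *)
Lemma bc_mx_surj K : exists Ba Bb, bc_mx Ba Bb = K.
Proof.
exists (- (conj (lsubmx K) *m J)), (- (conj (rsubmx K) *m J)).
by rewrite /bc_mx !map_mxN !map_mxM !conj_mxK conj_Jmx !mulNmx -!mulmxA Jmx_sqr !mulmxN !mulmx1
  !opprK hsubmxK.
Qed.

Lemma bform_col2 (x1 x2 y1 y2 z1 z2 u1 u2 : C) :
  row_mx (col2 x1 x2)^T (col2 y1 y2)^T *m bform *m ctr (row_mx (col2 z1 z2)^T (col2 u1 u2)^T) =
  (x1 * conjc z2 - x2 * conjc z1 - (y1 * conjc u2 - y2 * conjc u1))%:M.
Proof.
rewrite ctr_row_mx mul_row_block !mulmx0 addr0 add0r mul_row_col.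
apply/matrixP => i j; rewrite !ord1 !mxE !big_ord_recl !big_ord0 !mxE !big_ord_recl !big_ord0 !mxE /=.
ring.
Qed.

End lagrangian_subspaces.

(** * Self-adjoint restrictions as boundary conditions *)

Section boundary_values.
Context (R : realType) (a b : \bar R) (rho : pmeasure R) (vs chi : smeasure R).
Local Notation C := R[i].
Implicit Types t s : elt R.
Local Notation dom := (in_dom a b rho vs chi).
Local Notation L2 := (L2 a b rho).
Local Notation ip := (ip a b rho).
Local Notation aeeq := (aeeq a b rho).

Hypothesis st : standing a b rho vs chi.
Hypotheses (lcl : LC_left a b rho vs chi) (lcr : LC_right a b rho vs chi).
Context (w1 w2 : elt R) (D1 : dom w1) (D2 : dom w2).
Hypotheses (a12 : wa a w1 (econj w2) = 1) (a11 : wa a w1 (econj w1) = 0) (a22 : wa a w2 (econj w2) = 0).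
Hypotheses (b12 : wb b w1 (econj w2) = 1) (b11 : wb b w1 (econj w1) = 0) (b22 : wb b w2 (econj w2) = 0).

Let pa := left_proper st. Let pb := right_proper st.
Let cva t s : dom t -> dom s -> ccvg (at_left_end a) (wr t s) (wa a t s).
Proof. by move=> Dt Ds; have [] := dom_lagrange st Dt Ds. Qed.
Let cvb t s : dom t -> dom s -> ccvg (at_right_end b) (wr t s) (wb b t s).
Proof. by move=> Dt Ds; have [] := dom_lagrange st Dt Ds. Qed.
Let dconj t : dom t -> dom (econj t). Proof. exact: in_dom_conj. Qed.

Definition bvalues t : 'rV[C]_(2 + 2) :=
  row_mx (col2 (wa a t (econj w2)) (wa a (econj w1) t))^T (col2 (wb b t (econj w2)) (wb b (econj w1) t))^T.

Lemma bvalues_form t s : dom t -> dom s ->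
  bvalues t *m bform R *m ctr (bvalues s) = (ip (ef t) (eh s) - ip (eh t) (ef s))%:M.
Proof.
move=> Dt Ds; have [E [G [n [m fp]]]] := fundamental_pair_exists st lcl lcr.
have -> : ip (ef t) (eh s) - ip (eh t) (ef s) = wa a t (econj s) - wb b t (econj s).
  by rewrite -opprB (ip_lagrange st Dt Ds) opprB.
rewrite bform_col2; congr (_ %:M); congr (_ - _).
  by apply/esym/(wlim_form pa cva dconj (fpE fp) (fpG fp)) => //; case: fp.
by apply/esym/(wlim_form pb cvb dconj (fpE fp) (fpG fp)) => //; case: fp.
Qed.

Lemma bvalues_form_eq0 t s : dom t -> dom s ->
  bvalues t *m bform R *m ctr (bvalues s) = 0 <-> ip (eh t) (ef s) = ip (ef t) (eh s).
Proof.
move=> Dt Ds; rewrite bvalues_form//; split=> [/matrixP/(_ 0 0)|->]; last first.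
  by rewrite subrr; apply/matrixP => i j; rewrite !mxE mul0rn.
by rewrite !mxE eqxx mulr1n => /eqP; rewrite subr_eq0 => /eqP.
Qed.

Let row_col2 (r : 'rV[C]_2) : (col2 (r 0 0) (r 0 1))^T = r.
Proof.
apply/rowP => i; rewrite !mxE; case: i => [[|[|]]] //= ?; congr (r _ _); exact: val_inj.
Qed.

Lemma bvalues_surj v : exists2 t, dom t & bvalues t = v.
Proof.
have [E [G [n [m fp]]]] := fundamental_pair_exists st lcl lcr.
rewrite -[v]hsubmxK -[lsubmx v]row_col2 -[rsubmx v]row_col2.
set x1 := lsubmx v 0 0; set x2 := lsubmx v 0 1; set y1 := rsubmx v 0 0; set y2 := rsubmx v 0 1.
have [al [be hab]] := wlim_solve pa cva dconj (fpE fp) (fpG fp) D1 D2 (fpE_conj fp) (fpG_conj fp)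
  (fp_wa fp) a12 a11 a22 x1 x2.
have [al' [be' hab']] := wlim_solve pb cvb dconj (fpE fp) (fpG fp) D1 D2 (fpE_conj fp) (fpG_conj fp)
  (fp_wb fp) b12 b11 b22 y1 y2.
have [t [Dt tE tG tE' tG']] := dom_boundary_values st fp al be al' be'.
exists t => //; rewrite /bvalues /wa /wb.
by have [-> ->] := hab _ Dt tE tG; have [-> ->] := hab' _ Dt tE' tG'.
Qed.

(** As in [Tmax], a pair is known only almost everywhere, so the condition is put on some element of
    the domain that represents it. *)
Definition bc_relation (V : set 'rV[C]_(2 + 2)) : crel R :=
  [set p | [/\ L2 p.1, L2 p.2 &
     exists t, [/\ dom t, aeeq p.1 (ef t), aeeq p.2 (eh t) & V (bvalues t)]]].

Lemma bc_relation_dom V t : dom t -> V (bvalues t) -> bc_relation V (ef t, eh t).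
Proof.
move=> Dt Vt; have [_ l1 l2] := Dt; split => //.
by exists t; split => //; apply: aeW => x _.
Qed.

Let ip_rep (p q : (R -> C) * (R -> C)) t s : L2 p.1 -> L2 p.2 -> L2 q.1 -> L2 q.2 ->
  dom t -> dom s -> aeeq p.1 (ef t) -> aeeq p.2 (eh t) -> aeeq q.1 (ef s) -> aeeq q.2 (eh s) ->
  ip q.2 p.1 = ip q.1 p.2 <-> bvalues s *m bform R *m ctr (bvalues t) = 0.
Proof.
move=> p1 p2 q1 q2 Dt Ds e1 e2 e3 e4; rewrite bvalues_form_eq0//.
have [_ t1 t2] := Dt; have [_ s1 s2] := Ds.
by rewrite (ip_ae q2 p1 s2 t1)// (ip_ae q1 p2 s1 t2).
Qed.

(** [V 0] puts all elements with vanishing boundary values into the relation, which places the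
    adjoint inside [Tmax]. On elements of the domain the adjoint condition is orthogonality of
    boundary values, and all vectors of V occur as such. *)
Lemma adjoint_bc_relation V : V 0 ->
  adjoint a b rho (bc_relation V) = bc_relation [set u | forall v, V v -> v *m bform R *m ctr u = 0].
Proof.
move=> V0; have [E [G [n [m fp]]]] := fundamental_pair_exists st lcl lcr.
apply/seteqP; split=> [p Sp|p [p1 p2 [t [Dt e1 e2 Vt]]]].
  have [p1 p2 adj] := Sp.
  have /TmaxP[_ _ [t [Dt e1 e2]]] : Tmax a b rho vs chi p.
    apply: (adjoint_sub_Tmax st fp _ _ Sp) => [t Dt z1 z2 z3 z4|t s Dt Ds z1 z2 z3 z4].
      apply: bc_relation_dom => //; rewrite /bvalues /wa /wb.
      have [-> ->] := wlim_eq0 pa cva dconj (fpE fp) (fpG fp) D1 D2 (fpE_conj fp) (fpG_conj fp)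
        (fp_wa fp) Dt z1 z2.
      have [-> ->] := wlim_eq0 pb cvb dconj (fpE fp) (fpG fp) D1 D2 (fpE_conj fp) (fpG_conj fp)
        (fp_wb fp) Dt z3 z4.
      suff -> : (col2 0 0 : 'cV[C]_2) = 0 by rewrite trmx0 row_mx0.
      by apply/matrixP => i j; rewrite !mxE; case: ifP.
    rewrite /wa (wlim_basis pa cva (fpE fp) (fpG fp) (fp_wa fp) Dt Ds).
    rewrite /wb (wlim_basis pb cvb (fpE fp) (fpG fp) (fp_wb fp) Dt Ds).
    by rewrite -!/(wa a _ _) -!/(wb b _ _) z1 z2 z3 z4 !mul0r subrr.
  split => //; exists t; split => // v Vv; have [s Ds sv] := bvalues_surj v.
  have Vs : bc_relation V (ef s, eh s) by apply: bc_relation_dom => //; rewrite sv.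
  by have [q1 q2 _] := Vs; rewrite -sv; apply/(ip_rep p1 p2 q1 q2 Dt Ds e1 e2) => //;
    [exact: aeW|exact: aeW|exact: adj].
split => // q [q1 q2 [s [Ds e3 e4 Vs]]].
by apply/(ip_rep p1 p2 q1 q2 Dt Ds e1 e2) => //; exact: Vt.
Qed.

Lemma bc_relation_sub V : bc_relation V `<=` Tmax a b rho vs chi.
Proof. by move=> p [p1 p2 [t [Dt e1 e2 _]]]; apply/TmaxP; split => //; exists t. Qed.

Let form_sym (u v : 'rV[C]_(2 + 2)) : u *m bform R *m ctr v = 0 -> v *m bform R *m ctr u = 0.
Proof.
by move=> /(congr1 (@ctr R _ _)); rewrite !ctrM ctrK ctr_bform ctr0 mulNmx mulmxN mulmxA
  => /eqP; rewrite oppr_eq0 => /eqP.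
Qed.

Lemma selfadjoint_bc_relation V : self_orthogonal V ->
  selfadjoint_restriction a b rho vs chi (bc_relation V).
Proof.
move=> so; split; first exact: bc_relation_sub.
rewrite adjoint_bc_relation; last by apply/so => v _; rewrite !mul0mx.
congr bc_relation; apply/seteqP; split=> u.
  by move=> /= h; apply/so => v /h /form_sym.
by move=> /so h v /h /form_sym.
Qed.

Lemma selfadjoint_restrictionP S : selfadjoint_restriction a b rho vs chi S <->
  exists2 V, self_orthogonal V & S = bc_relation V.
Proof.
split=> [[sT sS]|[V so ->]]; last exact: selfadjoint_bc_relation.
(* S equals its adjoint and is therefore closed under almost everywhere equality, so a
   representative in the domain can replace the pair. *)
have rep p : S p -> exists t, [/\ dom t, aeeq p.1 (ef t), aeeq p.2 (eh t) & S (ef t, eh t)].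
  move=> Sp; have /TmaxP[p1 p2 [t [Dt e1 e2]]] := sT _ Sp; have [_ l1 l2] := Dt.
  exists t; split => //; rewrite -sS; split => // q Sq.
  have /TmaxP[q1 q2 _] := sT _ Sq; move: Sp; rewrite -{1}sS => -[_ _ /(_ _ Sq)].
  by rewrite (ip_ae q2 p1 q2 l1 _ e1)// ?(ip_ae q1 p2 q1 l2 _ e2)//; exact: aeW.
pose V := [set v | exists t, [/\ dom t, S (ef t, eh t) & bvalues t = v]].
have Sin p t : L2 p.1 -> L2 p.2 -> dom t -> aeeq p.1 (ef t) -> aeeq p.2 (eh t) ->
    (forall v, V v -> v *m bform R *m ctr (bvalues t) = 0) -> S p.
  move=> p1 p2 Dt e1 e2 h; rewrite -sS; split => // q Sq.
  have /TmaxP[q1 q2 _] := sT _ Sq; have [s [Ds e3 e4 Ss]] := rep _ Sq.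
  by apply/(ip_rep p1 p2 q1 q2 Dt Ds e1 e2 e3 e4); apply: h; exists s.
have VV u v : V u -> V v -> v *m bform R *m ctr u = 0.
  move=> [t [Dt St <-]] [s [Ds Ss <-]]; apply/(bvalues_form_eq0 Ds Dt).
  by move: St; rewrite -{1}sS => -[_ _ /(_ _ Ss)].
exists V; last first.
  apply/seteqP; split=> p.
    move=> Sp; have /TmaxP[p1 p2 _] := sT _ Sp; have [t [Dt e1 e2 St]] := rep _ Sp.
    by split => //; exists t; split => //; exists t.
  by move=> [p1 p2 [t [Dt e1 e2 Vt]]]; apply: (Sin _ t) => // v; exact: VV.
(* A vector orthogonal to V consists of the boundary values of some element, and that element lies
   in the adjoint of S, which is S. *)
move=> u; split=> [Vu v Vv|h]; first exact: VV.
have [t Dt tu] := bvalues_surj u; exists t; split => //; have [_ l1 l2] := Dt.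
by apply: (Sin _ t) => //; [exact: aeW|exact: aeW|move=> v /h /form_sym; rewrite tu].
Qed.

End boundary_values.

Theorem theorem7p5 (R : realType) (a b : \bar R) (rho : pmeasure R)
  (vs chi : smeasure R)
  (w1 w11 tw1 w2 w21 tw2 : R -> R[i]) :
  standing a b rho vs chi ->
  (* w1, w2 in T_max, with quasi-derivatives w11, w21 and tau w_j = tw_j *)
  dtau a b rho vs chi w1 w11 tw1 -> L2 a b rho w1 -> L2 a b rho tw1 ->
  dtau a b rho vs chi w2 w21 tw2 -> L2 a b rho w2 -> L2 a b rho tw2 ->
  (* tau is in the limit-circle case at both endpoints *)
  LC_left a b rho vs chi -> LC_right a b rho vs chi ->
  (* normalisation of w1, w2 at a and at b *)
  Wa a w1 w11 (cconj w2) (cconj w21) = 1 ->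
  Wa a w1 w11 (cconj w1) (cconj w11) = 0 ->
  Wa a w2 w21 (cconj w2) (cconj w21) = 0 ->
  Wb b w1 w11 (cconj w2) (cconj w21) = 1 ->
  Wb b w1 w11 (cconj w1) (cconj w11) = 0 ->
  Wb b w2 w21 (cconj w2) (cconj w21) = 0 ->
  forall S : crel R,
    selfadjoint_restriction a b rho vs chi S <->
    exists Ba Bb : 'M[R[i]]_2,
      [/\ \rank (row_mx Ba Bb) = 2%N,
          Ba *m Jmx R *m adjmx Ba = Bb *m Jmx R *m adjmx Bb &
          S = [set p | Tmax a b rho vs chi p /\
                 exists f f1 h,
                   [/\ dtau a b rho vs chi f f1 h,
                       aeeq a b rho p.1 f, aeeq a b rho p.2 h &
                       Ba *m col2 (Wa a f f1 (cconj w2) (cconj w21))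
                                  (Wa a (cconj w1) (cconj w11) f f1)
                       = Bb *m col2 (Wb b f f1 (cconj w2) (cconj w21))
                                    (Wb b (cconj w1) (cconj w11) f f1)]]].
Proof.
move=> st d1 l1 k1 d2 l2 k2 lcl lcr a12 a11 a22 b12 b11 b22 S.
pose W1 := Elt w1 w11 tw1; pose W2 := Elt w2 w21 tw2.
have D1 : in_dom a b rho vs chi W1 by [].
have D2 : in_dom a b rho vs chi W2 by [].
have -> := selfadjoint_restrictionP st lcl lcr D1 D2 a12 a11 a22 b12 b11 b22 S.
have setE Ba Bb : bc_relation a b rho vs chi W1 W2 [set u | u *m bform R *m ctr (bc_mx Ba Bb) = 0] =
    [set p | Tmax a b rho vs chi p /\
                 exists f f1 h,
                   [/\ dtau a b rho vs chi f f1 h,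
                       aeeq a b rho p.1 f, aeeq a b rho p.2 h &
                       Ba *m col2 (Wa a f f1 (cconj w2) (cconj w21))
                                  (Wa a (cconj w1) (cconj w11) f f1)
                       = Bb *m col2 (Wb b f f1 (cconj w2) (cconj w21))
                                    (Wb b (cconj w1) (cconj w11) f f1)]].
  apply/seteqP; split=> p.
    move=> Vp; split; first exact: bc_relation_sub Vp.
    have [_ _ [t [[dt _ _] e1 e2 /bc_mxE Vt]]] := Vp.
    by exists (ef t), (ef1 t), (eh t).
  (* The functions [f] and [h] of the boundary condition are square integrable because they agree
     almost everywhere with the components of [p]. *)
  move=> [[p1 p2 _] [f [f1 [h [d e1 e2 BB]]]]]; split => //; exists (Elt f f1 h).
  have [m1 m2 m3 m4] := dtau_measurable d; have mI := @measurable_Iab R a b.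
  by split => //; [split => //; [exact: L2on_ae p1 e1|exact: L2on_ae p2 e2]|apply/bc_mxE].
split=> [[V so ->]|[Ba [Bb [rB iB ->]]]].
  have [K [rK iK ->]] := self_orthogonal_lagrangian so.
  have [Ba [Bb KE]] := bc_mx_surj K; exists Ba, Bb; rewrite -setE KE; split => //.
    by rewrite -rank_bc_mx KE.
  by apply/bc_mx_isotropic; rewrite KE.
rewrite -setE; eexists; last reflexivity.
by apply: lagrangian_self_orthogonal; [rewrite rank_bc_mx|apply/bc_mx_isotropic].
Qed.
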